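(* Fix $k\in\mathbb{N}$ and let $\{g_t:t\in\mathbb{R}\}$ be a diagonalizable unbounded one-parameter subgroup of $\mathrm{SL}_k(\mathbb{R})$. Let $\{z(t):t\in\mathbb{N}\}$ be an arbitrary sequence of real numbers. Then the set $$\{\Lambda\in\widehat{X}_k:\ \Delta(g_t\Lambda)\ge z(t)\text{ for infinitely many }t\in\mathbb{N}\}$$ has $\widehat\mu$-measure zero if $\sum_{t=1}^\infty e^{-kz(t)}$ converges, and has full $\widehat\mu$-measure if this series diverges.
   Context: $\widehat{X}_k$ is the space of unimodular grids in $\mathbb{R}^k$, i.e. sets $g\mathbb{Z}^k+\mathbf w$ with $g\in\mathrm{SL}_k(\mathbb{R})$, $\mathbf w\in\mathbb{R}^k$; it is identified with $\mathrm{ASL}_k(\mathbb{R})/\mathrm{ASL}_k(\mathbb{Z})$, where $\mathrm{ASL}_k(\mathbb{R})=\mathrm{SL}_k(\mathbb{R})\ltimes\mathbb{R}^k$ and $\mathrm{ASL}_k(\mathbb{Z})=\mathrm{SL}_k(\mathbb{Z})\ltimes\mathbb{Z}^k$, and $\widehat\mu$ is the $\mathrm{ASL}_k(\mathbb{R})$-invariant probability measure on it. $\mathrm{SL}_k(\mathbb{R})$ acts on grids by linear images. For $\Lambda\in\widehat{X}_k$, $\Delta(\Lambda)=\log\inf_{\mathbf v\in\Lambda}\|\mathbf v\|$ with $\|\cdot\|$ the supremum norm ($\Delta(\Lambda)=-\infty$ if $0\in\Lambda$). *)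

(* Defs.v *)
From HB Require Import structures.
From mathcomp Require Import all_boot all_order all_algebra.
From mathcomp Require Import all_classical all_reals all_analysis.

Set Implicit Arguments.
Unset Strict Implicit.
Unset Printing Implicit Defensive.

Import Order.TTheory GRing.Theory Num.Theory.
Import numFieldNormedType.Exports.

Local Open Scope classical_set_scope.
Local Open Scope ring_scope.

(* Coerced to a type, SL R k carries the topology induced from 'M[R]_k. *)
Definition SL (R : realType) (k : nat) : set 'M[R]_k :=
  [set g | \det g = 1].
Arguments SL R k : clear implicits.

(* SL_k(R) x R^k with the product topology; (g, w) stands for the affine map
   v |-> g v + w. *)
Definition ASL (R : realType) (k : nat) : Type := (SL R k * 'cV[R]_k)%type.

HB.instance Definition _ (R : realType) (k : nat) :=
  Topological.on (ASL R k).

Section grids.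
Variables (R : realType) (k : nat).

Definition affine_map (a : ASL R k) (v : 'cV[R]_k) : 'cV[R]_k :=
  set_val a.1 *m v + a.2.

Lemma SL_mul_subproof (g h : SL R k) : set_val g *m set_val h \in SL R k.
Proof.
have SL1 (x : SL R k) : \det (set_val x) = 1 by exact: set_mem (valP x).
by apply/mem_set; rewrite /SL /= det_mulmx !SL1 mulr1.
Qed.

Lemma SL_one_subproof : 1%:M \in SL R k.
Proof. by apply/mem_set; rewrite /SL /= det1. Qed.

Definition SL_mul (g h : SL R k) : SL R k := SigSub (SL_mul_subproof g h).
Definition SL_one : SL R k := SigSub SL_one_subproof.

Definition ASL_mul (a b : ASL R k) : ASL R k :=
  (SL_mul a.1 b.1, set_val a.1 *m b.2 + a.2).

Lemma affine_map_mul (a b : ASL R k) :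
  affine_map (ASL_mul a b) = affine_map a \o affine_map b.
Proof.
by apply/funext => v; rewrite /affine_map /= mulmxDr mulmxA addrA.
Qed.

Definition integer_points : set 'cV[R]_k :=
  [set v | forall i, v i ord0 \is a Num.int].

Record grid := Grid {
  grid_set :> set 'cV[R]_k ;
  gridP : exists a : ASL R k, grid_set = affine_map a @` integer_points }.

Definition grid_of (a : ASL R k) : grid :=
  @Grid (affine_map a @` integer_points) (ex_intro _ a erefl).

Lemma ASL_act_subproof (a : ASL R k) (L : grid) :
  exists b : ASL R k, affine_map a @` L = affine_map b @` integer_points.
Proof.
case: L => L /= [b ->]; exists (ASL_mul a b).
by rewrite affine_map_mul image_comp.
Qed.

Definition ASL_act (a : ASL R k) (L : grid) : grid :=
  Grid (ASL_act_subproof a L).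

Definition SL_act (g : SL R k) (L : grid) : grid := ASL_act (g, 0) L.

HB.instance Definition _ := gen_eqMixin grid.
HB.instance Definition _ := gen_choiceMixin grid.
HB.instance Definition _ := isPointed.Build grid (grid_of (SL_one, 0)).

(* The quotient topology for a |-> a Z^k, whose fibres are the cosets of
   ASL_k(Z) in ASL_k(R). *)
Definition grid_open : set_system grid :=
  [set U | open (grid_of @^-1` U)].

Lemma grid_openT : grid_open setT.
Proof. by rewrite /grid_open /= preimage_setT; exact: openT. Qed.

Lemma grid_openI : setI_closed grid_open.
Proof. by move=> A B oA oB; exact: openI. Qed.

Lemma grid_open_bigU (I : Type) (f : I -> set grid) :
  (forall i, grid_open (f i)) -> grid_open (\bigcup_i f i).
Proof. by move=> of_; apply: bigcup_open => i _; exact: of_. Qed.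

HB.instance Definition _ :=
  isOpenTopological.Build grid grid_openT grid_openI grid_open_bigU.

Definition borel_grid := g_sigma_algebraType (@open grid).

Definition ASL_invariant (mu : set borel_grid -> \bar R) : Prop :=
  forall (a : ASL R k) (A : set borel_grid),
    measurable A -> mu (ASL_act a @^-1` A) = mu A.

(* The norm on 'cV[R]_k is the sup norm, and lne 0 = -oo. *)
Definition Delta (L : grid) : \bar R :=
  lne (ereal_inf [set (`|v|)%:E | v in grid_set L]).

Definition one_parameter_subgroup (g : R -> SL R k) : Prop :=
  continuous g /\ forall s t, g (s + t) = SL_mul (g s) (g t).

Definition diagonalizable_subgroup (g : R -> SL R k) : Prop :=
  exists2 P : 'M[R]_k,
    P \in unitmx & forall t, diagonalizable_for P (set_val (g t)).

Definition unbounded_subgroup (g : R -> SL R k) : Prop :=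
  ~ bounded_set [set set_val (g t) | t in [set: R]].

End grids.

(* Main.v *)
Require Import Defs.
From HB Require Import structures.
From mathcomp Require Import all_boot all_order all_fingroup all_algebra.
From mathcomp Require Import all_classical all_reals all_analysis.
From mathcomp Require Import measurable_realfun ring lra zify.

(** Since the measure is invariant, it suffices to show that, for each fixed
grid, Lebesgue almost every affine map sends it into the set (or into its
complement).  In coordinates diagonalizing [g_t], with exponents sorted, the
condition at time [t] says that the grid misses a box whose [i]-th side is
[exp (- sg_i t + z t)].

If the series converges, a variance estimate for the number of points of a
random grid in a box bounds the probability of missing the box by a constant
times [1 / volume], and the Borel-Cantelli lemma applies.

If the series diverges, transference is used.  Short nonzero vectors [u_t] of
the dual lattice exist for infinitely many [t]: the expected number of dual
points in the relevant boxes is comparable with [exp (- k z t)], so a second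
moment estimate shows that this has positive probability, and invariance under
elementary row operations upgrades it to full probability.  For almost every
translate, [<u_t, w>] stays away from the integers infinitely often, so that
the grid lies in hyperplanes [<u_t, v> = const + n] far from the origin, and
hence misses a large box. *)

Set Implicit Arguments.
Unset Strict Implicit.
Unset Printing Implicit Defensive.
Import Order.TTheory GRing.Theory Num.Theory.
Import numFieldNormedType.Exports.
Local Open Scope classical_set_scope.
Local Open Scope ring_scope.

(** * Integration in one coordinate *)

(** Randomness enters one real entry at a time. Every matrix entry receives the law [lam], which has
    the Lebesgue null sets but treats periodic functions like the uniform law; moments of lattice
    point counts then become exact identities, obtained by unfolding row after row. They are proved
    for unipotent upper triangular matrices, and an arbitrary matrix is brought to that form by
    Gaussian elimination on the rows. A multiple of a row may be added only to rows with longer box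
    sides, whence the sorting of the exponents. Each operation costs a constant factor, whence
    events that are required for every rescaling [c] of the boxes. Right multiplication by a fixed
    affine map preserves these statements as well, so the integer lattice can be replaced by any
    fixed grid. The obstacle in the second moment is that the multiples of one short vector are
    strongly correlated. Counting only vectors whose last two coordinates are coprime removes such
    pairs, at the price of a constant in the mean. Full probability comes from adding rational
    multiples of columns: after clearing denominators, integer vectors go to integer vectors. *)

Section one_dim.
Context {R : realType}.
Local Notation leb := (@lebesgue_measure R).
Local Open Scope ereal_scope.

Lemma measurable_affine (a b : R) :
  measurable_fun [set: R] (fun y : R => a * y + b : R)%R.
Proof. by apply: measurable_funD => //; apply: measurable_funM. Qed.

(** By uniqueness of Lebesgue measure: [|a|] times its pushforward under the affine map agrees with
    it on half-open intervals. *)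
Lemma lebesgue_measure_affine (a b : R) (A : set R) : a != 0%R ->
  measurable A ->
  leb ((fun y => a * y + b)%R @^-1` A) = (`|a|^-1)%:E * leb A.
Proof.
move=> a0 mA.
have an : (`|a|%R != 0%R) by rewrite normr_eq0.
pose f : measurableTypeR R -> measurableTypeR R := fun y => (a * y + b)%R.
have mf : measurable_fun setT f by exact: measurable_affine.
pose r := NngNum (normr_ge0 a).
have := @lebesgue_measure_unique R (mscale r (pushforward leb f)).
move=> /(_ mf _ A mA) ->; last first.
  move=> _ [[p q]] _ <- /=.
  transitivity (`|a|%:E * leb (f @^-1` `]p, q]%classic)); last by [].
  have [a_gt0|a_lt0|/eqP] := ltgtP a 0%R; last by rewrite (negbTE a0).
  - have -> : f @^-1` `]p, q]%classic = `[((q - b) / a)%R, ((p - b) / a)%R[%classic.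
      apply/seteqP; split => y /=; rewrite !in_itv/= /f.
        by rewrite ler_ndivrMr // ltr_ndivlMr //; move=> /andP[? ?]; apply/andP; split; lra.
      by rewrite ler_ndivrMr // ltr_ndivlMr //; move=> /andP[? ?]; apply/andP; split; lra.
    rewrite !lebesgue_measure_itv /= !lte_fin ltr_nM2r ?invr_lt0// ltrD2r.
    case: ifPn => _; last by rewrite mule0.
    by rewrite -!EFinD -EFinM ltr0_norm//; congr (_%:E); field.
  - have -> : f @^-1` `]p, q]%classic = `]((p - b) / a)%R, ((q - b) / a)%R]%classic.
      apply/seteqP; split => y /=; rewrite !in_itv/= /f.
        by rewrite ltr_pdivrMr // ler_pdivlMr //; move=> /andP[? ?]; apply/andP; split; lra.
      by rewrite ltr_pdivrMr // ler_pdivlMr //; move=> /andP[? ?]; apply/andP; split; lra.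
    rewrite !lebesgue_measure_itv /= !lte_fin ltr_pM2r ?invr_gt0// ltrD2r.
    case: ifPn => _; last by rewrite mule0.
    by rewrite -!EFinD -EFinM gtr0_norm//; congr (_%:E); field.
by rewrite /mscale /= muleA -EFinM mulVf// mul1e.
Qed.

Lemma ge0_lebesgue_integral_shift (f : R -> \bar R) (s : R) :
  measurable_fun [set: R] f -> (forall y, 0 <= f y) ->
  \int[leb]_y f (y + s)%R = \int[leb]_y f y.
Proof.
move=> mf f0.
pose h : measurableTypeR R -> measurableTypeR R := fun y => (y + s)%R.
have mh : measurable_fun setT h by exact: measurable_funD.
transitivity (\int[pushforward leb h]_y f y).
  by rewrite (ge0_integral_pushforward mh).
apply: eq_measure_integral => A mA _; rewrite /pushforward.
transitivity (leb ((fun y => 1 * y + s)%R @^-1` A)).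
  by congr (leb _); apply/seteqP; split => y /=; rewrite /h mul1r.
by rewrite lebesgue_measure_affine ?oner_neq0// normr1 invr1 mul1e.
Qed.

(** The enumeration 0, -1, 1, -2, ... of the integers, through which sums over the integers are
    series over [nat]; by [zsumE] the order is immaterial for nonnegative terms. *)
Definition zenum (n : nat) : int := if odd n then Negz n./2 else Posz n./2.

Lemma zenum_bij : set_bij [set: nat] [set: int] zenum.
Proof.
split => //.
- move=> m n _ _; rewrite /zenum.
  have := odd_double_half m; have := odd_double_half n.
  by case: (odd m); case: (odd n) => //= hn hm [e]; rewrite -hm -hn e.
- move=> [n|n] _ /=.
    by exists n.*2 => //; rewrite /zenum odd_double doubleK.
  by exists n.*2.+1 => //; rewrite /zenum /= odd_double /= uphalf_double.
Qed.

Definition zsum (F : int -> \bar R) : \bar R := \sum_(n <oo) F (zenum n).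

Lemma zsumE F : (forall m, 0 <= F m) -> zsum F = \esum_(m in [set: int]) F m.
Proof.
move=> F0; rewrite /zsum nneseries_esumT// [RHS](reindex_esum [set: nat] _ zenum)//.
exact: zenum_bij.
Qed.

Lemma zsum_ge0 F : (forall m, 0 <= F m) -> 0 <= zsum F.
Proof. by move=> F0; apply: nneseries_ge0. Qed.

Lemma eq_zsum F G : F =1 G -> zsum F = zsum G.
Proof. by move=> FG; apply: eq_eseriesr => n _; rewrite FG. Qed.

Lemma le_zsum F G : (forall m, 0 <= F m) -> (forall m, F m <= G m) ->
  zsum F <= zsum G.
Proof. by move=> F0 FG; apply: lee_nneseries => n _ //. Qed.

Lemma zsumD F G : (forall m, 0 <= F m) -> (forall m, 0 <= G m) ->
  zsum (fun m => F m + G m) = zsum F + zsum G.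
Proof. by move=> F0 G0; apply: nneseriesD. Qed.

Lemma zsumZl c F : 0 <= c -> (forall m, 0 <= F m) ->
  zsum (fun m => c * F m) = c * zsum F.
Proof.
move=> c0 F0; rewrite /zsum -!ge0_integral_count//; last first.
  by move=> n; rewrite mule_ge0.
by rewrite ge0_integralZl.
Qed.

Lemma zsum_mul F G : (forall m, 0 <= F m) -> (forall m, 0 <= G m) ->
  zsum F * zsum G = zsum (fun m => zsum (fun m' => F m * G m')).
Proof.
move=> F0 G0; rewrite muleC -zsumZl//; last exact: zsum_ge0.
by apply: eq_zsum => m; rewrite zsumZl// muleC.
Qed.

Lemma zsum_interchange (F : int -> int -> \bar R) : (forall m n, 0 <= F m n) ->
  zsum (fun m => zsum (fun n => F m n)) = zsum (fun n => zsum (fun m => F m n)).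
Proof. by move=> F0; rewrite /zsum nneseries_interchange. Qed.

Lemma zsum_reindex (h : int -> int) F : set_bij setT setT h ->
  (forall m, 0 <= F m) -> zsum (fun m => F (h m)) = zsum F.
Proof. by move=> hb F0; rewrite !zsumE// [RHS](reindex_esum setT _ h). Qed.

Lemma zsum_shift (c : int) F : (forall m, 0 <= F m) ->
  zsum (fun m => F (m + c)%R) = zsum F.
Proof.
move=> F0; apply: (zsum_reindex (h := fun m => (m + c)%R)) => //; split => //.
- by move=> m n _ _ /addIr.
- by move=> m _; exists (m - c)%R => //; rewrite subrK.
Qed.

Lemma zsum_single (m0 : int) F : (forall m, 0 <= F m) ->
  (forall m, m != m0 -> F m = 0) -> zsum F = F m0.
Proof.
move=> F0 Fm; rewrite zsumE// -[RHS]esum_set1// [RHS]esum_mkcond.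
apply: eq_esum => m _; case: ifPn => //; rewrite notin_setE /= => /eqP.
by move=> /Fm.
Qed.

Lemma zsum_ge m F : (forall m, 0 <= F m) -> F m <= zsum F.
Proof.
move=> F0; apply: (@le_trans _ _ (zsum (fun n => if n == m then F n else 0))).
  rewrite (zsum_single (m0 := m)) ?eqxx// => n; first by case: ifP.
  by move=> /negbTE ->.
by apply: le_zsum => n; case: ifP.
Qed.

Lemma measurable_zsum d (T : measurableType d) (F : T -> int -> \bar R) :
  (forall m, measurable_fun setT (F^~ m)) -> (forall x m, 0 <= F x m) ->
  measurable_fun setT (fun x => zsum (F x)).
Proof.
by move=> mF F0; apply: (@ge0_emeasurable_sum _ _ _ _ (fun n x => F x (zenum n))).
Qed.

Lemma integral_zsum d (T : measurableType d) (m : {measure set T -> \bar R})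
    (F : T -> int -> \bar R) :
  (forall m, measurable_fun setT (F^~ m)) -> (forall x m, 0 <= F x m) ->
  \int[m]_x zsum (F x) = zsum (fun n => \int[m]_x F x n).
Proof.
by move=> mF F0; rewrite /zsum (@integral_nneseries _ _ _ _ _ _ (fun n x => F x (zenum n))).
Qed.

Definition unif01 : probability _ R := uniform_prob (@ltr01 R).

Lemma integral_unif01 (f : R -> \bar R) : measurable_fun setT f ->
  (forall y, 0 <= f y) -> \int[unif01]_y f y = \int[leb]_(y in `[0%R, 1%R[) f y.
Proof.
move=> mf f0; rewrite integral_uniform// subr0 invr1 mul1e.
by rewrite integral_itv_bndo_bndc//; exact: measurable_funTS.
Qed.

Lemma integral_shift_unit (f : R -> \bar R) (m : int) : measurable_fun setT f ->
  (forall y, 0 <= f y) ->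
  \int[leb]_(y in `[0%R, 1%R[) f (m%:~R + y)%R =
  \int[leb]_(y in `[m%:~R, (m + 1)%:~R[) f y.
Proof.
move=> mf f0; rewrite [LHS]integral_mkcond [RHS]integral_mkcond.
rewrite -[RHS](@ge0_lebesgue_integral_shift _ m%:~R).
- apply: eq_integral => y _; rewrite !patchE /= !mem_setE !in_itv /= addrC.
  by rewrite lerDr intrD (addrC _ 1%R) ltrD2r.
- by apply/(measurable_restrictT _ _).1 => //; exact: measurable_funTS.
- by move=> y; rewrite patchE; case: ifP.
Qed.

(** Unfolding: the integer translates of [[0, 1[] tile the line. Every expected number of lattice
    points below is computed from this identity. *)
Lemma unfold_unif01 (f : R -> \bar R) : measurable_fun setT f ->
  (forall y, 0 <= f y) ->
  \int[unif01]_v zsum (fun m => f (m%:~R + v)%R) = \int[leb]_y f y.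
Proof.
move=> mf f0.
have mfs (c : R) : measurable_fun setT (fun v : R => f (c + v)%R).
  by apply: measurableT_comp => //; exact: measurable_funD.
rewrite integral_zsum//.
under eq_zsum do rewrite integral_unif01// integral_shift_unit//.
have -> : [set: R] = \bigcup_n `[(zenum n)%:~R, (zenum n + 1)%:~R[%classic.
  apply/esym; rewrite -subTset => y _.
  have [_ _ sj] := zenum_bij.
  have [n _ nE] := sj (Num.floor y) I; exists n => //=.
  by rewrite nE in_itv/= Num.Theory.floor_itv.
rewrite ge0_integral_bigcup//.
- exact: measurable_funTS.
- apply/trivIsetP => i j _ _ ij; apply/eqP; apply: contraT => /set0P[y []] /=.
  rewrite !in_itv/= => yi yj.
  have := @Num.Theory.floor_def _ _ _ yi; have := @Num.Theory.floor_def _ _ _ yj => -> e.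
  have [_ inj _] := zenum_bij.
  by move: ij; rewrite (inj _ _ _ _ e) ?eqxx// inE.
- by move=> m; exact: mfs.
Qed.

(** A periodic function is the periodization of its restriction to one period; only [m = - floor y]
    contributes. This brings periodic integrands within reach of [unfold_unif01]. *)
Lemma periodic_zsum (P : R -> \bar R) (y : R) : (forall y, 0 <= P y) ->
  (forall y, P (y + 1)%R = P y) ->
  P y = zsum (fun m => (P \_ `[0%R, 1%R[) (m%:~R + y)%R).
Proof.
move=> P0 P1.
have Pn (n : nat) z : P (z + n%:R)%R = P z.
  by elim: n => [|n ih]; rewrite ?addr0// -natr1 addrA P1.
have Pz (m : int) z : P (m%:~R + z)%R = P z.
  case: m => n; first by rewrite addrC Pn.
  by rewrite -(Pn n.+1) NegzE mulrNz addrAC addNr add0r.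
rewrite (zsum_single (m0 := - Num.floor y)).
- rewrite patchE /= mem_setE in_itv /= ifT ?Pz// mulrNz.
  have /andP[] := Num.Theory.floor_itv y; rewrite intrD => ? ?.
  by apply/andP; split; lra.
- by move=> m; rewrite patchE; case: ifP.
- move=> m; rewrite patchE /= mem_setE in_itv /=.
  case: ifP => // /andP[h1 h2] /eqP; case; apply/eqP.
  rewrite -eqr_oppLR; apply/eqP/esym; apply: Num.Theory.floor_def.
  by rewrite intrD mulrNz; apply/andP; split; lra.
Qed.

(** Both sides unfold to the integral over the line of [P] cut off to one period, where translation
    invariance is available. *)
Lemma periodic_unif01_shift (P : R -> \bar R) (s : R) : measurable_fun setT P ->
  (forall y, 0 <= P y) -> (forall y, P (y + 1)%R = P y) ->
  \int[unif01]_y P (y + s)%R = \int[unif01]_y P y.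
Proof.
move=> mP P0 P1.
have mQ : measurable_fun setT (P \_ `[0%R, 1%R[).
  by apply/(measurable_restrictT _ _).1 => //; exact: measurable_funTS.
have Q0 y : 0 <= (P \_ `[0%R, 1%R[) y by rewrite patchE; case: ifP.
transitivity (\int[leb]_y (P \_ `[0%R, 1%R[) y).
  under eq_integral do rewrite periodic_zsum//.
  rewrite -(ge0_lebesgue_integral_shift s)// -unfold_unif01//.
  - by apply: eq_integral => y _; apply: eq_zsum => m; rewrite addrA.
  - by apply: measurableT_comp => //; exact: measurable_funD.
under [RHS]eq_integral do rewrite periodic_zsum//.
by rewrite unfold_unif01.
Qed.

Definition zshift (n : nat) : measurableTypeR R -> measurableTypeR R :=
  fun y => (y + (zenum n)%:~R)%R.

Lemma measurable_zshift n : measurable_fun setT (zshift n).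
Proof. exact: measurable_funD. Qed.

HB.instance Definition _ n :=
  isMeasurableFun.Build _ _ _ _ (zshift n) (measurable_zshift n).

Definition half_pow (n : nat) : R := (1 / (2 ^ (n + 1))%:R)%R.

Lemma half_pow_gt0 n : (0 < half_pow n)%R.
Proof. by rewrite divr_gt0// ltr0n expn_gt0. Qed.

Definition half_nng n : {nonneg R} := NngNum (ltW (half_pow_gt0 n)).

Lemma half_pow_sum : \sum_(n <oo) (half_pow n)%:E = 1.
Proof.
have := @cvg_geometric_eseries_half R 1%R 0; rewrite expr0 divr1.
exact: cvg_lim.
Qed.

(* A probability measure with the null sets of Lebesgue measure which, on
   1-periodic functions, integrates like the uniform law on [0, 1]. *)
Definition lam : set (measurableTypeR R) -> \bar R :=
  mseries (fun n => mscale (half_nng n) (distribution unif01 (zshift n))) 0.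
HB.instance Definition _ := Measure.on lam.

Lemma lam_setT : lam setT = 1.
Proof.
rewrite /lam /mseries -half_pow_sum; apply: eq_eseriesr => n _.
transitivity ((half_pow n)%:E * distribution unif01 (zshift n) setT) => //.
by rewrite probability_setT mule1.
Qed.
HB.instance Definition _ := Measure_isProbability.Build _ _ _ lam lam_setT.

Lemma integral_lam (f : R -> \bar R) : measurable_fun setT f ->
  (forall y, 0 <= f y) -> \int[lam]_y f y =
  \sum_(n <oo) (half_pow n)%:E * \int[unif01]_y f (y + (zenum n)%:~R)%R.
Proof.
move=> mf f0; rewrite ge0_integral_measure_series//.
apply: eq_eseriesr => n _; rewrite ge0_integral_mscale//.
by rewrite ge0_integral_distribution.
Qed.

Lemma integral_lam_periodic (P : R -> \bar R) : measurable_fun setT P ->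
  (forall y, 0 <= P y) -> (forall y, P (y + 1)%R = P y) ->
  \int[lam]_y P y = \int[unif01]_y P y.
Proof.
move=> mP P0 P1; rewrite integral_lam//.
under eq_eseriesr do rewrite periodic_unif01_shift// muleC.
rewrite (_ : \sum_(_ <oo) _ = \int[unif01]_y P y * \sum_(n <oo) (half_pow n)%:E); last first.
  have h0 n : 0 <= (half_pow n)%:E by rewrite lee_fin ltW// half_pow_gt0.
  have i0 : 0 <= \int[unif01]_y P y by exact: integral_ge0.
  rewrite -!ge0_integral_count//; first by rewrite ge0_integralZl.
  by move=> n; rewrite mule_ge0.
by rewrite half_pow_sum mule1.
Qed.

(** Both measures are combinations of the masses [J m] of [A] in the unit intervals, with weights
    one for Lebesgue measure and [half_pow] for [lam]. All weights are positive, so either measure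
    vanishes exactly when every [J m] does. *)
Lemma lam_null (A : set R) : measurable A -> lam A = 0 <-> leb A = 0.
Proof.
move=> mA.

have m1 : measurable_fun setT (fun y : R => (\1_A y)%:E : \bar R).
  by apply/measurable_EFinP; exact: measurable_indic.
have m1s (c : R) : measurable_fun setT (fun y : R => (\1_A (c + y)%R)%:E : \bar R).
  by apply: (measurableT_comp m1); exact: measurable_funD.
pose J (m : int) := \int[unif01]_y (\1_A (m%:~R + y)%R)%:E.
have J0 m : 0 <= J m by apply: integral_ge0 => y _; rewrite lee_fin.
have lamE : lam A = \sum_(n <oo) (half_pow n)%:E * J (zenum n).
  transitivity (\int[lam]_y (\1_A y)%:E); first by rewrite integral_indic// setIT.
  rewrite integral_lam//.
  apply: eq_eseriesr => n _; congr (_ * _); apply: eq_integral => y _.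
  by rewrite addrC.
have lebE : leb A = zsum J.
  transitivity (\int[leb]_y (\1_A y)%:E); first by rewrite integral_indic// setIT.
  rewrite -unfold_unif01//.
  by rewrite integral_zsum// => m; exact: m1s.
have h0 n : 0 <= (half_pow n)%:E * J (zenum n).
  by rewrite mule_ge0// lee_fin ltW// half_pow_gt0.
rewrite lamE lebE; split => e.
  apply: eseries0 => n _ _; apply/eqP.
  have : (half_pow n)%:E * J (zenum n) = 0.
    apply/eqP; rewrite eq_le h0 andbT -e.
    rewrite (@nneseriesD1 _ _ n)//= leeDl//; exact: nneseries_ge0.
  move=> /eqP; rewrite mule_eq0 => /orP[|//].
  by rewrite eqe gt_eqF// half_pow_gt0.
apply: eseries0 => n _ _.
suff -> : J (zenum n) = 0 by rewrite mule0.
by apply/eqP; rewrite eq_le J0 andbT -e; exact: zsum_ge.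
Qed.

End one_dim.

(** * Equidistribution and density arguments on the line *)

Section one_dim_equid.
Context {R : realType}.
Local Notation leb := (@lebesgue_measure R).
Local Notation lam := (@lam R).
Local Notation unif01 := (@unif01 R).
Local Notation RR := (measurableTypeR R).
Local Open Scope ereal_scope.

Lemma tonelliR d (T : measurableType d) (m1 : {sigma_finite_measure set RR -> \bar R})
    (m2 : {sigma_finite_measure set T -> \bar R}) (f : R -> T -> \bar R) :
  measurable_fun setT (fun z : R * T => f z.1 z.2) ->
  (forall x y, 0 <= f x y) ->
  \int[m1]_x \int[m2]_y f x y = \int[m2]_y \int[m1]_x f x y.
Proof.
move=> mf f0.
exact: (@fubini_tonelli _ _ RR T R m1 m2 (fun z => f z.1 z.2) mf (fun z => f0 z.1 z.2)).
Qed.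

Lemma measurable_fun_integralR d (T : measurableType d)
    (m : {sigma_finite_measure set RR -> \bar R}) (f : T -> R -> \bar R) :
  measurable_fun setT (fun z : T * R => f z.1 z.2) ->
  (forall x y, 0 <= f x y) -> measurable_fun setT (fun x => \int[m]_y f x y).
Proof.
move=> mf f0.
exact: (@measurable_fun_fubini_tonelli_F _ _ T RR R m (fun z => f z.1 z.2) mf (fun z => f0 z.1 z.2)).
Qed.

Lemma tonelliR3 (m1 m2 m3 : {sigma_finite_measure set RR -> \bar R})
    (f : R -> R -> R -> \bar R) :
  measurable_fun setT (fun z : R * (R * R) => f z.1 z.2.1 z.2.2) ->
  (forall w x y, 0 <= f w x y) ->
  \int[m1]_w \int[m2]_x \int[m3]_y f w x y =
  \int[m2]_x \int[m3]_y \int[m1]_w f w x y.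
Proof.
move=> mf f0.
have m31 : measurable_fun setT (fun z : (R * R) * R => f z.1.1 z.1.2 z.2).
  have mt : measurable_fun setT (fun z : (R * R) * R => (z.1.1, (z.1.2, z.2))).
    apply: measurable_fun_pair; first exact: measurableT_comp.
    by apply: measurable_fun_pair => //; exact: measurableT_comp.
  exact: (measurableT_comp mf mt).
rewrite (@tonelliR _ RR m1 m2 (fun w x => \int[m3]_y f w x y)).
- apply: eq_integral => x _; rewrite (@tonelliR _ RR m1 m3 (fun w y => f w x y))//.
  have mt : measurable_fun setT (fun z : R * R => (z.1, (x : R, z.2))).
    by apply: measurable_fun_pair => //; exact: measurable_fun_pair.
  exact: (measurableT_comp mf mt).
- exact: (@measurable_fun_integralR _ (RR * RR)%type m3 (fun z y => f z.1 z.2 y)).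
- by move=> w x; exact: integral_ge0.
Qed.

Lemma lebesgue_negligibleP (A : set R) : measurable A ->
  leb.-negligible A <-> leb A = 0.
Proof. by move=> mA; exact: (@negligibleP _ RR R leb A mA). Qed.

Lemma le_lebesgue (A B : set R) : measurable A -> measurable B -> A `<=` B ->
  leb A <= leb B.
Proof. by move=> mA mB AB; apply: (@le_measure _ R RR leb) => //; rewrite inE. Qed.

Lemma lebesgueU2 (A B : set R) : measurable A -> measurable B ->
  leb (A `|` B) <= leb A + leb B.
Proof. by move=> mA mB; exact: (@measureU2 _ RR R leb). Qed.

Lemma periodic_int (P : R -> \bar R) : (forall y, P (y + 1)%R = P y) ->
  forall (m : int) y, P (y + m%:~R)%R = P y.
Proof.
move=> P1.
have Pn (n : nat) z : P (z + n%:R)%R = P z.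
  by elim: n => [|n ih]; rewrite ?addr0// -natr1 addrA P1.
by move=> [n|n] y; [rewrite Pn | rewrite -(Pn n.+1) NegzE mulrNz -addrA addNr addr0].
Qed.

Lemma measurable_zsum_shift (f : R -> \bar R) : measurable_fun setT f ->
  (forall y, 0 <= f y) ->
  measurable_fun setT (fun v : R => zsum (fun m => f (m%:~R + v)%R)).
Proof.
move=> mf f0; apply: measurable_zsum => // m.
by apply: measurableT_comp => //; exact: measurable_funD.
Qed.

Lemma zsum_shift_periodic (f : R -> \bar R) v : (forall y, 0 <= f y) ->
  zsum (fun m => f (m%:~R + (v + 1))%R) = zsum (fun m => f (m%:~R + v)%R).
Proof.
move=> f0; rewrite -[RHS](zsum_shift 1)//; apply: eq_zsum => m.
by rewrite intrD -addrA (addrC 1%R v).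
Qed.

Lemma integral_unif01_cst (c : \bar R) : \int[unif01]_y c = c.
Proof.
by rewrite integral_cst// [X in _ * X](_ : _ = 1) ?mule1//; exact: probability_setT.
Qed.

(** A further shift [s] of the argument of [P] is absorbed into [x], since [D] is nonzero. Averaging
    over [s] therefore changes nothing, and integrating [s] before [x] leaves the mean of [P]. *)
Lemma periodic_equidistribution (P : R -> \bar R) (D : int) (c : R) :
  measurable_fun setT P -> (forall y, 0 <= P y) ->
  (forall y, P (y + 1)%R = P y) -> D != 0%R ->
  \int[lam]_x P (c + x * D%:~R)%R = \int[unif01]_v P v.
Proof.
move=> mP P0 P1 D0.
have Dr : (D%:~R != 0 :> R)%R by rewrite intr_eq0.
have maff s : measurable_fun setT (fun x : R => (c + x * D%:~R + s)%R).
  by apply: measurable_funD => //; apply: measurable_funD => //; exact: measurable_funM.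
have mPs s : measurable_fun setT (fun x : R => P (c + x * D%:~R + s)%R).
  exact: measurableT_comp.
have mP0 : measurable_fun setT (fun x : R => P (c + x * D%:~R)%R).
  by have := mPs 0%R; under [X in measurable_fun _ X -> _]eq_fun do rewrite addr0.
have per y : P (c + (y + 1) * D%:~R)%R = P (c + y * D%:~R)%R.
  by rewrite mulrDl mul1r addrA periodic_int.
rewrite integral_lam_periodic//.
have sh s : \int[unif01]_x P (c + x * D%:~R + s)%R =
            \int[unif01]_x P (c + x * D%:~R)%R.
  rewrite -[RHS](periodic_unif01_shift (s / D%:~R)%R)//.
  by apply: eq_integral => x _; rewrite mulrDl divfK// addrA.
transitivity (\int[unif01]_s \int[unif01]_x P (c + x * D%:~R + s)%R).
  by under [RHS]eq_integral do rewrite sh; rewrite integral_unif01_cst.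
have mF : measurable_fun setT
    (fun z : R * R => P (c + z.2 * D%:~R + z.1)%R).
  apply: measurableT_comp => //; apply: measurable_funD => //.
  by apply: measurable_funD => //; exact: measurable_funM.
rewrite (@tonelliR _ RR unif01 unif01 (fun s x => P (c + x * D%:~R + s)%R))//.
under eq_integral.
  move=> x _; under eq_integral do rewrite addrC.
  rewrite periodic_unif01_shift//; over.
by rewrite integral_unif01_cst.
Qed.

(** Two integral forms with nonzero determinant are independent and uniform modulo one. Again shifts
    [v] and [w] of the two arguments amount to a translation of [(x, y)]; averaging over them first
    in [w], then in [v], separates the factors. *)
Lemma periodic_equidistribution2 (P K : R -> \bar R) (a b a' b' : int) (c c' : R) :
  measurable_fun setT P -> (forall y, 0 <= P y) -> (forall y, P (y + 1)%R = P y) ->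
  measurable_fun setT K -> (forall y, 0 <= K y) -> (forall y, K (y + 1)%R = K y) ->
  (a * b' - b * a')%R != 0%R ->
  \int[lam]_x \int[lam]_y (P (c + x * a%:~R + y * b%:~R)%R *
                           K (c' + x * a'%:~R + y * b'%:~R)%R) =
  \int[unif01]_v P v * \int[unif01]_v K v.
Proof.
move=> mP P0 P1 mK K0 K1 D0.
pose D : R := (a%:~R * b'%:~R - b%:~R * a'%:~R)%R.
have Dr : D != 0%R by rewrite /D -!intrM -intrB intr_eq0.
pose L1 (z : R * R) : R := (c + z.1 * a%:~R + z.2 * b%:~R)%R.
pose L2 (z : R * R) : R := (c' + z.1 * a'%:~R + z.2 * b'%:~R)%R.
have mL1 : measurable_fun setT L1.
  by apply: measurable_funD; [apply: measurable_funD|] => //; exact: measurable_funM.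
have mL2 : measurable_fun setT L2.
  by apply: measurable_funD; [apply: measurable_funD|] => //; exact: measurable_funM.
pose G (v w : R) (z : R * R) := P (L1 z + v)%R * K (L2 z + w)%R.
have mG v w : measurable_fun setT (G v w).
  by apply: emeasurable_funM; apply: measurableT_comp => //; exact: measurable_funD.
have G0 v w z : 0 <= G v w z by rewrite mule_ge0.
pose H x y := G 0%R 0%R (x, y).
have mH : measurable_fun setT (fun z : R * R => H z.1 z.2).
  by rewrite (_ : (fun _ => _) = G 0%R 0%R)//; apply/funext => -[].
have H0 x y : 0 <= H x y by exact: G0.
have mHx x : measurable_fun setT (H x) by exact: (measurable_fun_pair2 x (mG _ _)).
have Hx x y : H (x + 1)%R y = H x y.
  rewrite /H /G /L1 /L2 /= !addr0 !mulrDl !mul1r; congr (_ * _).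
    by rewrite -[RHS](periodic_int P1 a); congr P; ring.
  by rewrite -[RHS](periodic_int K1 a'); congr K; ring.
have Hy x y : H x (y + 1)%R = H x y.
  rewrite /H /G /L1 /L2 /= !addr0 !mulrDl !mul1r; congr (_ * _).
    by rewrite -[RHS](periodic_int P1 b); congr P; ring.
  by rewrite -[RHS](periodic_int K1 b'); congr K; ring.
have mHi : measurable_fun setT (fun x => \int[unif01]_y H x y).
  exact: (@measurable_fun_integralR _ RR).
have Hi0 x : 0 <= \int[unif01]_y H x y by exact: integral_ge0.
have Hi1 x : \int[unif01]_y H (x + 1)%R y = \int[unif01]_y H x y.
  by apply: eq_integral => y _.
transitivity (\int[lam]_x \int[lam]_y H x y).
  by apply: eq_integral => x _; apply: eq_integral => y _; rewrite /H /G !addr0.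
under eq_integral do rewrite (integral_lam_periodic (mHx _) (H0 _) (Hy _)).
rewrite (integral_lam_periodic mHi Hi0 Hi1).
have key v w : \int[unif01]_x \int[unif01]_y G v w (x, y) =
               \int[unif01]_x \int[unif01]_y H x y.
  (* Cramer's rule: [a * s + b * r = v] and [a' * s + b' * r = w]. *)
  pose s := ((b'%:~R * v - b%:~R * w) / D)%R.
  pose r := ((a%:~R * w - a'%:~R * v) / D)%R.
  rewrite -[RHS](periodic_unif01_shift s mHi Hi0 Hi1); apply: eq_integral => x _.
  rewrite -[RHS](periodic_unif01_shift r (mHx _) (H0 _) (Hy _)); apply: eq_integral => y _.
  rewrite /H /G /L1 /L2 /= !addr0; congr (P _ * K _); rewrite /s /r /D in Dr *; field.
    exact: Dr.
  exact: Dr.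
transitivity (\int[unif01]_v \int[unif01]_w \int[unif01]_x \int[unif01]_y G v w (x, y)).
  under [RHS]eq_integral do under eq_integral do rewrite key.
  under [RHS]eq_integral do rewrite integral_unif01_cst.
  by rewrite integral_unif01_cst.
pose kap := \int[unif01]_v K v.
have kap0 : 0 <= kap by exact: integral_ge0.
have mPL v : measurable_fun setT (fun z => P (L1 z + v)%R).
  by apply: measurableT_comp => //; exact: measurable_funD.
have mPLx v x : measurable_fun setT (fun y => P (L1 (x, y) + v)%R).
  exact: (measurable_fun_pair2 x (mPL v)).
have mKs (u : R) : measurable_fun setT (fun w : R => K (u + w)%R).
  by apply: measurableT_comp => //; exact: measurable_funD.
have mPvL : measurable_fun setT (fun z : R * (R * R) => P (L1 z.2 + z.1)%R).
  apply: measurableT_comp => //; apply: measurable_funD => //.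
  exact: measurableT_comp.
have mPLi v : measurable_fun setT (fun x => \int[unif01]_y P (L1 (x, y) + v)%R).
  apply: (@measurable_fun_integralR _ RR unif01 (fun x y => P (L1 (x, y) + v)%R)) => //.
  have -> : (fun z : R * R => P (L1 (z.1, z.2) + v)%R) = (fun z => P (L1 z + v)%R).
    by apply/funext => -[].
  exact: mPL.
transitivity (\int[unif01]_v (kap * \int[unif01]_x \int[unif01]_y P (L1 (x, y) + v)%R)).
  apply: eq_integral => v _.
  rewrite (@tonelliR3 unif01 unif01 unif01 (fun w x y => G v w (x, y))); last 2 first.
  - rewrite (_ : (fun _ => _) = (fun z : R * (R * R) => P (L1 z.2 + v)%R * K (L2 z.2 + z.1)%R)); last first.
      by apply/funext => -[? []].
    apply: emeasurable_funM; first exact: (measurableT_comp (mPL v)).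
    apply: measurableT_comp => //; apply: measurable_funD => //.
    exact: measurableT_comp.
  - by move=> *; exact: G0.
  transitivity (\int[unif01]_x \int[unif01]_y (kap * P (L1 (x, y) + v)%R)).
    apply: eq_integral => x _; apply: eq_integral => y _.
    rewrite /G ge0_integralZl; [ | by [] | exact: mKs | by move=> *; exact: K0 | exact: P0].
    under eq_integral do rewrite addrC.
    by rewrite (periodic_unif01_shift _ mK K0 K1) muleC.
  transitivity (\int[unif01]_x (kap * \int[unif01]_y P (L1 (x, y) + v)%R)).
    apply: eq_integral => x _.
    by rewrite ge0_integralZl; [ | by [] | exact: mPLx | by move=> *; exact: P0 | exact: kap0].
  rewrite ge0_integralZl; [by [] | by [] | exact: mPLi | | exact: kap0].
  by move=> x _; exact: integral_ge0.
have mPi : measurable_fun setT (fun v => \int[unif01]_x \int[unif01]_y P (L1 (x, y) + v)%R).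
  apply: (@measurable_fun_integralR _ RR unif01 (fun v x => \int[unif01]_y P (L1 (x, y) + v)%R)).
    apply: (@measurable_fun_integralR _ (RR * RR)%type unif01 (fun z y => P (L1 (z.2, y) + z.1)%R)) => //.
    have mt : measurable_fun setT (fun z : (R * R) * R => (z.1.1, (z.1.2, z.2))).
      apply: measurable_fun_pair; first exact: measurableT_comp.
      by apply: measurable_fun_pair => //; exact: measurableT_comp.
    exact: (measurableT_comp mPvL mt).
  by move=> *; exact: integral_ge0.
rewrite ge0_integralZl; [ | by [] | exact: mPi | | exact: kap0]; last first.
  by move=> v _; apply: integral_ge0 => x _; exact: integral_ge0.
rewrite muleC; congr (_ * _).
rewrite (@tonelliR3 unif01 unif01 unif01 (fun v x y => P (L1 (x, y) + v)%R))//.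
under eq_integral.
  move=> x _; under eq_integral.
    move=> y _; under eq_integral do rewrite addrC.
    rewrite (periodic_unif01_shift _ mP P0 P1); over.
  rewrite integral_unif01_cst; over.
by rewrite integral_unif01_cst.
Qed.

(** At a density point of [D] lying in [D] the proportion of [D] in small balls tends to 1, which a
    uniform bound [th < 1] forbids. *)
Lemma null_of_density (D : set R) (th : R) : measurable D -> (th < 1)%R ->
  (forall a b : R, (a < b)%R -> leb (D `&` `]a, b[) <= (th * (b - a))%:E) ->
  leb D = 0.
Proof.
move=> mD th1 h; apply/(lebesgue_negligibleP mD).
have := lebesgue_density mD; rewrite /prop_near1 /= /almost_everywhere /=.
apply: negligibleS => x /= Dx H.
have : (1%:E <= th%:E :> \bar R).
  rewrite (_ : 1%:E = (\1_D x)%:E); last by rewrite indicE mem_set.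
  refine (cvge_le _ H).
  near=> r.
  have r0 : (0 < r)%R by near: r; exact: nbhs_right_gt.
  rewrite (lebesgue_measure_ball _ (ltW r0)) inver mulrn_eq0/= gt_eqF//.
  rewrite lee_pdivrMr ?mulrn_wgt0// -EFinM ball_itv.
  by apply: le_trans (h _ _ _) _; [lra|rewrite lee_fin mulr2n; lra].
by rewrite lee_fin leNgt th1.
Unshelve. all: by end_near. Qed.

(** Rational translations are dense, so the measure of [C] in a ball depends on the radius only. If
    some point of [C] has density 1, then so does every point, and the complement can contain no
    point of density 0; otherwise [C] itself is null by the density theorem. *)
Lemma zero_one_translation (C : set R) : measurable C ->
  (forall (n : nat) (m : int) y, C y -> C (y + m%:~R / n.+1%:R)%R) ->
  leb C = 0 \/ leb (~` C) = 0.
Proof.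
move=> mC tr.
have mCb (x r : R) : measurable (C `&` ball x r).
  by apply: measurableI => //; exact: measurable_ball.
have le1 (x x' r : R) : (0 < r)%R -> leb (C `&` ball x r) <= leb (C `&` ball x' r).
  move=> r0.
  suff H (e : R) : (0 < e)%R ->
    leb (C `&` ball x r) <= leb (C `&` ball x' r) + e%:E by exact/lee_addgt0Pr.
  move=> e0.
  (* The denominator is chosen so that some rational [q] satisfies [q <= x' - x < q + e / 2]. *)
  pose n := Num.bound (4 / e)%R.
  have n0 : (0 < n.+1%:R :> R)%R by rewrite ltr0n.
  have ne : (1 / n.+1%:R < e / 2)%R.
    rewrite ltr_pdivrMr//.
    have : (4 / e < n%:R)%R by apply: archi_boundP; rewrite divr_ge0 // ltW.
    rewrite ltr_pdivrMr// -natr1 => ?; nra.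
  pose m := Num.floor ((x' - x) * n.+1%:R)%R.
  have /andP[m1 m2] := Num.Theory.floor_itv ((x' - x) * n.+1%:R)%R.
  rewrite -/m intrD in m1 m2.
  pose q : R := (m%:~R / n.+1%:R)%R.
  have q1 : (q <= x' - x)%R by rewrite ler_pdivrMr.
  have q2 : (x' - x < q + 1 / n.+1%:R)%R by rewrite /q -mulrDl ltr_pdivlMr.
  have -> : leb (C `&` ball x r) = leb (C `&` ball (x + q)%R r).
    have := @lebesgue_measure_affine R 1%R q _ (oner_neq0 _) (mCb (x + q)%R r).
    rewrite normr1 invr1 mul1e => <-; congr (leb _); apply/seteqP; split => y /=.
      move=> [Cy]; rewrite !ball_itv /= !in_itv /= mul1r => /andP[? ?].
      by split; [exact: tr|apply/andP; split; lra].
    rewrite mul1r => -[Cy]; rewrite !ball_itv /= !in_itv /= => /andP[? ?].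
    split; last by apply/andP; split; lra.
    have -> : y = ((y + q) + (- m)%:~R / n.+1%:R)%R.
      by rewrite mulrNz mulNr -/q addrK.
    exact: tr.
  (* The ball about [x + q] leaves the ball about [x'] only through a strip of length [e / 2] on the
     left. *)
  apply: (@le_trans _ _ (leb ((C `&` ball x' r) `|` `](x' - r - e / 2)%R, (x' - r)%R]%classic))).
    apply: le_lebesgue => //; first exact: measurableU.
    move=> y [Cy]; rewrite ball_itv /= in_itv /= => /andP[h1 h2].
    rewrite in_itv/=.
    have q3 : (x' - x < q + e / 2)%R by apply: lt_trans q2 _; rewrite ltrD2l.
    clear ne m1 m2 q2; clearbody q.
    have [yr|yr] := leP y (x' - r)%R; [right; apply/andP; split; lra|left].
    by split => //; rewrite ball_itv /= in_itv/=; apply/andP; split; lra.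
  apply: (le_trans (lebesgueU2 _ _)) => //.
  rewrite leeD2l// lebesgue_measure_itv /= lte_fin ifT; last lra.
  by rewrite -EFinB lee_fin; lra.
have eq1 (x x' r : R) : (0 < r)%R -> leb (C `&` ball x r) = leb (C `&` ball x' r).
  by move=> r0; apply/eqP; rewrite eq_le !le1.
have := lebesgue_density mC; rewrite /prop_near1 /= /almost_everywhere /= => negl.
have [[x [Cx Hx]]|nex] := pselect (exists x, C x /\
   leb (C `&` ball x r) * (leb (ball x r))^-1 @[r --> 0^'+] --> (\1_C x)%:E).
  right; apply/(lebesgue_negligibleP (measurableC mC)); apply: negligibleS negl => x' /= nCx' Hx'.
  have : (\1_C x)%:E = (\1_C x')%:E :> \bar R.
    refine (cvg_unique (@ereal_hausdorff R) Hx _).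
    move: Hx'; apply: cvg_trans; apply: near_eq_cvg; near=> r.
    have r0 : (0 < r)%R by near: r; exact: nbhs_right_gt.
    by rewrite (eq1 x x' _ r0) !(lebesgue_measure_ball _ (ltW r0)).
  rewrite !indicE (mem_set Cx) memNset// => /eqP.
  by rewrite eqe oner_eq0.
left; apply/(lebesgue_negligibleP mC); apply: negligibleS negl => x Cx Hx.
by apply: nex; exists x.
Unshelve. all: by end_near. Qed.

Lemma measurable_mod_one (i : interval R) (b c : R) :
  measurable [set s : R | exists m : int, (b * s + c - m%:~R)%R \in i].
Proof.
rewrite (_ : [set s | _] = \bigcup_n [set s : R | (b * s + c - (zenum n)%:~R)%R \in i]); last first.
  apply/seteqP; split => s /=.
    move=> [m hm]; have [_ _ sj] := zenum_bij.
    by have [n _ nE] := sj m I; exists n => //=; rewrite nE.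
  by move=> [n _ hn]; exists (zenum n).
apply: bigcupT_measurable => n; rewrite -[X in measurable X]setTI.
have mf : measurable_fun setT (fun s : R => b * s + c - (zenum n)%:~R)%R.
  by apply: measurable_funB => //; exact: measurable_affine.
exact: (mf measurableT [set` i] (measurable_itv _)).
Qed.

(** Let [D n] be the set avoiding the middle third from index [n] on. In an interval, split [D n]
    according to whether the residue at a large index [j] is below 1/3 or above 2/3. Either piece,
    moved by a third of a period, lands in the middle third and so is disjoint from [D n]; adding
    the two resulting bounds gives density at most 2/3 in every interval. *)
Lemma ae_infinitely_often_middle (b c : nat -> R) :
  (forall K : R, exists n, forall j, (n <= j)%N -> (K < `|b j|)%R) ->
  leb.-negligible [set s | exists n, forall j, (n <= j)%N -> forall m : int,
     ~ (1 / 3 <= b j * s + c j - m%:~R <= 2 / 3)%R].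
Proof.
move=> bK.
pose S j : set R := [set s | exists m : int, (b j * s + c j - m%:~R)%R \in `[(1 / 3)%R, (2 / 3)%R]].
have mS j : measurable (S j) by exact: measurable_mod_one.
pose D n : set R := \bigcap_(j in [set j | (n <= j)%N]) ~` S j.
have mD n : measurable (D n).
  by apply: bigcap_measurable => //; [exists n => /= | move=> j _; exact: measurableC].
suff D0 n : leb (D n) = 0.
  apply: (@negligibleS _ _ _ leb (\bigcup_n D n)).
    move=> s [n hn]; exists n => // j /= nj [m]; rewrite in_itv; exact: hn.
  by apply: negligible_bigcup => n; apply/lebesgue_negligibleP.
apply: (@null_of_density _ (2 / 3)%R) => //; first by lra.
move=> x y xy.
have mI : measurable (D n `&` `]x, y[) by exact: measurableI.
have fin (B : set R) : measurable B -> B `<=` `]x, y[%classic -> leb B \is a fin_num.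
  move=> mB BI; rewrite ge0_fin_numE//; apply: (@le_lt_trans _ _ (leb `]x, y[)).
    exact: le_lebesgue.
  by rewrite lebesgue_measure_itv /= lte_fin xy -EFinB ltry.
pose a := leb (D n `&` `]x, y[).
have afin : a \is a fin_num by apply: fin => //; exact: subIsetr.
rewrite -/a -(fineK afin) lee_fin.
apply/ler_addgt0Pr => e e0.
have [n' hn'] := bK (1 / e)%R.
pose j := maxn n n'.
have bj : (1 / e < `|b j|)%R by apply: hn'; rewrite leq_maxr.
have b0 : b j != 0%R.
  by rewrite -normr_gt0; apply: lt_trans bj; rewrite divr_gt0.
have nb0 : (0 < `|b j|)%R by rewrite normr_gt0.
(* A third of the period of [b j * s]. As [|b j|] is large the shift is at most [e / 3], so that
   shifted pieces stay in an interval hardly longer than the original one. *)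
pose tau := (1 / (3 * b j))%R.
have btau : (b j * tau = 1 / 3)%R by rewrite /tau; field.
have ntau : (`|tau| <= e / 3)%R.
  have : (`|b j| * `|tau| = 1 / 3)%R by rewrite -normrM btau ger0_norm//; lra.
  have : (1 <= e * `|b j|)%R by rewrite -ler_pdivrMl// mulr1 ltW// -div1r.
  by have := normr_ge0 tau; move: e0 nb0; nra.
pose DA := (D n `&` `]x, y[) `&`
  [set s | exists m : int, (b j * s + c j - m%:~R)%R \in `[0%R, (1 / 3)%R[].
pose DC := (D n `&` `]x, y[) `&`
  [set s | exists m : int, (b j * s + c j - m%:~R)%R \in `](2 / 3)%R, 1%R[].
have mDA : measurable DA by apply: measurableI => //; exact: measurable_mod_one.
have mDC : measurable DC by apply: measurableI => //; exact: measurable_mod_one.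
have DAC : a <= leb DA + leb DC.
  apply: le_trans (lebesgueU2 mDA mDC); apply: le_lebesgue => //.
    exact: measurableU.
  move=> s [Ds Is].
  have /andP[h1 h2] := Num.Theory.floor_itv (b j * s + c j)%R.
  rewrite intrD in h2; pose m := Num.floor (b j * s + c j)%R; rewrite -/m in h1 h2.
  have nS : ~ S j s by apply: Ds; rewrite /= leq_maxl.
  have [l1|l1] := ltP (b j * s + c j - m%:~R)%R (1 / 3)%R.
    by left; split => //=; exists m; rewrite in_itv/=; apply/andP; split; lra.
  right; split => //=; exists m; rewrite in_itv/=; apply/andP; split; last lra.
  by rewrite ltNge; apply/negP => l2; apply: nS; exists m; rewrite in_itv/= l1 l2.
have main (B : set R) (t : R) : measurable B -> B `<=` D n `&` `]x, y[ ->
    (`|t| <= e / 3)%R -> (forall s, B s -> S j (s + t)%R) ->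
    a + leb B <= (y - x + 2 / 3 * e)%:E.
  move=> mB BI te BS.
  have mBt : measurable ((fun s => 1 * s + (- t))%R @^-1` B).
    by rewrite -[X in measurable X]setTI; exact: measurable_affine.
  have := @lebesgue_measure_affine R 1%R (- t)%R _ (oner_neq0 _) mB.
  rewrite normr1 invr1 mul1e => <-.
  rewrite -measureU//.
    apply: (@le_trans _ _ (leb `](x - e / 3)%R, (y + e / 3)%R[)).
      apply: le_lebesgue => //; first exact: measurableU.
      move: te; rewrite ler_norml => /andP[? ?].
      move=> s [[_]|/BI[_]] /=; rewrite !in_itv /= => /andP[? ?]; apply/andP; split; lra.
    rewrite lebesgue_measure_itv /= lte_fin ifT; last lra.
    by rewrite -EFinB lee_fin; lra.
  apply/eqP; apply: contraT => /set0P[s [[Ds _]] /= Bs].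
  have := BS _ Bs; rewrite mul1r subrK => Ss.
  by exfalso; apply: (Ds j) => //=; rewrite leq_maxl.
have hA := main DA tau mDA (@subIsetl _ _ _) ntau.
have hC := main DC (- tau)%R mDC (@subIsetl _ _ _).
have {}hA : a + leb DA <= (y - x + 2 / 3 * e)%:E.
  apply: hA => s [_ [m]] /=; rewrite in_itv/= => /andP[? ?].
  by exists m; rewrite in_itv/= mulrDr btau; apply/andP; split; lra.
have {}hC : a + leb DC <= (y - x + 2 / 3 * e)%:E.
  apply: hC; rewrite ?normrN// => s [_ [m]] /=; rewrite in_itv/= => /andP[? ?].
  by exists m; rewrite in_itv/= mulrDr mulrN btau; apply/andP; split; lra.
have fA : leb DA \is a fin_num by apply: fin => // s [[]].
have fC : leb DC \is a fin_num by apply: fin => // s [[]].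
move: hA hC DAC; rewrite -(fineK afin) -(fineK fA) -(fineK fC) -!EFinD !lee_fin.
by move=> ? ? ?; lra.
Qed.

End one_dim_equid.

(** * Iterated integrals over matrix entries *)

(* [(i, j)] stands for the entry in row [i] and column [j]. *)
Definition coord := (nat * nat)%type.

Section iterated.
Context {R : realType}.
Local Notation leb := (@lebesgue_measure R).
Local Notation lam := (@lam R).
Local Notation RR := (measurableTypeR R).
Local Open Scope ereal_scope.

Definition coord_gen : set_system (coord -> R) :=
  [set A | exists c (B : set R), measurable B /\ A = (fun x => x c) @^-1` B].

(** One space for matrices of all sizes: a matrix is read off from finitely many coordinates, and
    the coordinates that are not integrated act as parameters. *)
Definition cspace := g_sigma_algebraType coord_gen.

Definition upd (x : cspace) (c : coord) (y : R) : cspace :=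
  fun c' => if c' == c then y else x c'.

Lemma updE (x : cspace) c y : upd x c y c = y. Proof. by rewrite /upd eqxx. Qed.

Lemma upd_neq (x : cspace) c c' y : c' != c -> upd x c y c' = x c'.
Proof. by rewrite /upd => /negbTE ->. Qed.

Lemma upd_upd (x : cspace) c y y' : upd (upd x c y) c y' = upd x c y'.
Proof. by apply/funext => c'; rewrite /upd; case: (c' == c). Qed.

Lemma updC (x : cspace) c c' y y' : c != c' ->
  upd (upd x c y) c' y' = upd (upd x c' y') c y.
Proof.
move=> cc; apply/funext => d; rewrite /upd.
by case: (eqVneq d c) => [->|//]; rewrite (negbTE cc).
Qed.

Lemma measurable_coord c : measurable_fun [set: cspace] (fun x : cspace => x c : R).
Proof.
move=> _ B mB; rewrite setTI; apply: sub_sigma_algebra.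
by exists c, B.
Qed.

Lemma measurable_to_cspace d (T : measurableType d) (h : T -> cspace) :
  (forall c, measurable_fun setT (fun t => h t c : R)) -> measurable_fun setT h.
Proof.
move=> mh; apply: (@measurability _ _ _ cspace _ _ coord_gen) => //.
move=> _ [A [c [B [mB ->]]] <-].
by have := mh c measurableT B mB; rewrite setTI.
Qed.

Lemma measurable_upd c : measurable_fun setT (fun z : cspace * R => upd z.1 c z.2).
Proof.
apply: measurable_to_cspace => c'; rewrite /upd; case: (c' == c).
  exact: measurable_snd.
exact: (measurableT_comp (measurable_coord c') measurable_fst).
Qed.

Lemma measurable_upd2 x c : measurable_fun [set: RR] (fun y : R => upd x c y).
Proof.
apply: measurable_to_cspace => c'; rewrite /upd; case: (c' == c) => //.
Qed.

Lemma integral_lam_cst (k : \bar R) : \int[lam]_y k = k.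
Proof.
by rewrite integral_cst// [X in _ * X](_ : _ = 1) ?mule1//; exact: probability_setT.
Qed.

(** The expectation of [f] when the coordinates in [l] are independent with law [lam] and the others
    are kept from [x]. *)
Fixpoint it_int (l : seq coord) (f : cspace -> \bar R) (x : cspace) : \bar R :=
  if l is c :: l' then \int[lam]_y it_int l' f (upd x c y) else f x.

Lemma it_int_ge0 l f x : (forall x, 0 <= f x) -> 0 <= it_int l f x.
Proof. by move=> f0; elim: l x => //= c l ih x; exact: integral_ge0. Qed.

Lemma measurable_it_int l f : measurable_fun setT f -> (forall x, 0 <= f x) ->
  measurable_fun setT (it_int l f).
Proof.
move=> mf f0; elim: l => //= c l ih.
apply: (@measurable_fun_integralR _ _ cspace lam (fun x y => it_int l f (upd x c y))).
  exact: (measurableT_comp ih (measurable_upd c)).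
by move=> *; exact: it_int_ge0.
Qed.

Lemma measurable_it_int_upd l f x c : measurable_fun setT f -> (forall x, 0 <= f x) ->
  measurable_fun [set: RR] (fun y => it_int l f (upd x c y)).
Proof.
move=> mf f0; apply: (measurableT_comp (measurable_it_int l mf f0)).
exact: measurable_upd2.
Qed.

Lemma eq_it_int l f g x : f =1 g -> it_int l f x = it_int l g x.
Proof. by move=> /funext ->. Qed.

Lemma le_it_int l f g x : measurable_fun setT f -> measurable_fun setT g ->
  (forall x, 0 <= f x) -> (forall x, f x <= g x) -> it_int l f x <= it_int l g x.
Proof.
move=> mf mg f0 fg.
have g0 z : 0 <= g z by exact: le_trans (fg z).
elim: l x => //= c l ih x.
apply: ge0_le_integral => //.
- by move=> y _; exact: it_int_ge0.
- exact: measurable_it_int_upd.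
- exact: measurable_it_int_upd.
Qed.

Lemma it_int_cst l (k : \bar R) x : it_int l (fun=> k) x = k.
Proof.
elim: l x => //= c l ih x; under eq_integral do rewrite ih.
exact: integral_lam_cst.
Qed.

Lemma it_intD l f g x : measurable_fun setT f -> measurable_fun setT g ->
  (forall x, 0 <= f x) -> (forall x, 0 <= g x) ->
  it_int l (fun z => f z + g z) x = it_int l f x + it_int l g x.
Proof.
move=> mf mg f0 g0; elim: l x => //= c l ih x.
under eq_integral do rewrite ih.
rewrite ge0_integralD//.
- by move=> y _; exact: it_int_ge0.
- exact: measurable_it_int_upd.
- by move=> y _; exact: it_int_ge0.
- exact: measurable_it_int_upd.
Qed.

Lemma it_intZl l f k x : measurable_fun setT f -> (forall x, 0 <= f x) -> 0 <= k ->
  it_int l (fun z => k * f z) x = k * it_int l f x.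
Proof.
move=> mf f0 k0; elim: l x => //= c l ih x.
under eq_integral do rewrite ih.
rewrite ge0_integralZl//.
- exact: measurable_it_int_upd.
- by move=> y _; exact: it_int_ge0.
Qed.

Lemma it_int_nneseries l (f : nat -> cspace -> \bar R) x :
  (forall n, measurable_fun setT (f n)) -> (forall n x, 0 <= f n x) ->
  it_int l (fun z => \sum_(n <oo) f n z) x = \sum_(n <oo) it_int l (f n) x.
Proof.
move=> mf f0; elim: l x => //= c l ih x.
under eq_integral do rewrite ih.
rewrite (@integral_nneseries _ RR _ lam _ _ (fun n y => it_int l (f n) (upd x c y)))//.
- by move=> n; exact: measurable_it_int_upd.
- by move=> n y _; exact: it_int_ge0.
Qed.

Lemma it_int_zsum l (f : int -> cspace -> \bar R) x :
  (forall n, measurable_fun setT (f n)) -> (forall n x, 0 <= f n x) ->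
  it_int l (fun z => zsum (f^~ z)) x = zsum (fun m => it_int l (f m) x).
Proof. by move=> mf f0; rewrite /zsum (@it_int_nneseries _ (fun n z => f (zenum n) z)). Qed.

Lemma it_int_swap l c c' f x : measurable_fun setT f -> (forall x, 0 <= f x) ->
  c != c' -> it_int (c :: c' :: l) f x = it_int (c' :: c :: l) f x.
Proof.
move=> mf f0 cc /=.
rewrite (@tonelliR _ _ RR lam lam (fun y y' => it_int l f (upd (upd x c y) c' y'))).
- by apply: eq_integral => y _; apply: eq_integral => y' _; rewrite updC.
- apply: (measurableT_comp (measurable_it_int l mf f0)).
  apply: measurable_to_cspace => d; rewrite /upd.
  case: (d == c'); first exact: measurable_snd.
  by case: (d == c); [exact: measurable_fst|exact: measurable_cst].
- by move=> *; exact: it_int_ge0.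
Qed.

Lemma it_int_cat l l' f x : it_int (l ++ l') f x = it_int l (it_int l' f) x.
Proof. by elim: l x => //= c l ih x; apply: eq_integral => y _. Qed.

Lemma it_int_head l c f x : measurable_fun setT f -> (forall x, 0 <= f x) ->
  uniq l -> c \in l -> it_int l f x = it_int (c :: rem c l) f x.
Proof.
move=> mf f0; elim: l x => //= d l ih x /andP[dl ul].
rewrite in_cons [c == d]eq_sym; have [->//|cd] /= := eqVneq d c.
move=> cl.
transitivity (it_int [:: d, c & rem c l] f x).
  by apply: eq_integral => y _; exact: ih.
by rewrite it_int_swap.
Qed.

Lemma it_int_perm l l' f x : measurable_fun setT f -> (forall x, 0 <= f x) ->
  uniq l -> perm_eq l l' -> it_int l f x = it_int l' f x.
Proof.
move=> mf f0; elim: l l' x => [|c l ih] l' x.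
  by move=> _; rewrite perm_sym => /perm_nilP ->.
move=> /= /andP[cl ul] pll'.
have cl' : c \in l' by rewrite -(perm_mem pll') mem_head.
have ul' : uniq l' by rewrite -(perm_uniq pll') /= cl.
rewrite (it_int_head _ mf f0 ul' cl') /=.
apply: eq_integral => y _; apply: ih => //.
by rewrite -(perm_cons c) (perm_trans pll')// perm_to_rem.
Qed.

(** As [lam] has mass one, averaging over [c] once more inside changes nothing. This isolates a
    single entry without touching the order of the others. *)
Lemma it_int_upd l c f x : measurable_fun setT f -> (forall x, 0 <= f x) ->
  uniq l -> c \in l ->
  it_int l f x = it_int l (fun z => \int[lam]_y f (upd z c y)) x.
Proof.
move=> mf f0 ul cl.
have mg : measurable_fun setT (fun z => \int[lam]_y f (upd z c y)).
  exact: (measurable_it_int [:: c]).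
have g0 z : 0 <= \int[lam]_y f (upd z c y) by exact: integral_ge0.
have pl : perm_eq l (rem c l ++ [:: c]).
  by rewrite (perm_trans (perm_to_rem cl))// perm_sym -cat1s perm_catC.
rewrite (it_int_perm _ mf f0 ul pl) (it_int_perm _ mg g0 ul pl) !it_int_cat.
apply: eq_it_int => z /=.
under [RHS]eq_integral do under eq_integral do rewrite upd_upd.
by rewrite integral_lam_cst.
Qed.

Lemma it_int_upd2 l c c' f x : measurable_fun setT f -> (forall x, 0 <= f x) ->
  uniq l -> c \in l -> c' \in l ->
  it_int l f x =
  it_int l (fun z => \int[lam]_y \int[lam]_y' f (upd (upd z c y) c' y')) x.
Proof.
move=> mf f0 ul cl cl'; rewrite (it_int_upd _ mf f0 ul cl').
rewrite (it_int_upd (c := c))//; first exact: (measurable_it_int [:: c']).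
by move=> z; exact: integral_ge0.
Qed.

Lemma it_int_bigsum (I : Type) (r : seq I) l (f : I -> cspace -> \bar R) x :
  (forall i, measurable_fun setT (f i)) -> (forall i x, 0 <= f i x) ->
  it_int l (fun z => \sum_(i <- r) f i z) x = \sum_(i <- r) it_int l (f i) x.
Proof.
move=> mf f0; elim: l x => //= c l ih x.
under eq_integral do rewrite ih.
rewrite ge0_integral_sum//.
- by move=> i; exact: measurable_it_int_upd.
- by move=> i y _; exact: it_int_ge0.
Qed.

(** Dominated convergence, one coordinate at a time; the constant 1 dominates. It carries a uniform
    lower bound on probabilities over to a limsup event. *)
Lemma it_int_decreasing_cvg l (A : nat -> set cspace) x :
  (forall n, measurable (A n)) -> (forall n, A n.+1 `<=` A n) ->
  it_int l (fun z => (\1_(A n) z)%:E) x @[n --> \oo] -->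
  it_int l (fun z => (\1_(\bigcap_n A n) z)%:E) x.
Proof.
move=> mA dA.
have m1 (B : set cspace) : measurable B -> measurable_fun setT (fun z => (\1_B z)%:E : \bar R).
  by move=> mB; apply/measurable_EFinP; exact: measurable_indic.
have p1 (B : set cspace) z : 0 <= (\1_B z)%:E :> \bar R by rewrite lee_fin.
have mI : measurable (\bigcap_n A n) by exact: bigcapT_measurable.
have dA' m n : (m <= n)%N -> A n `<=` A m.
  elim: n => [|n ih]; first by rewrite leqn0 => /eqP ->.
  rewrite leq_eqVlt => /orP[/eqP ->//|]; rewrite ltnS => /ih; apply: subset_trans.
  exact: dA.
elim: l x => [|c l ih] x /=.
  have [xA|xA] := pselect ((\bigcap_n A n) x).
    rewrite [in X in _ --> X]indicE mem_set//.
    apply: cvg_near_cst; near=> n; rewrite indicE mem_set//; exact: xA.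
  rewrite [in X in _ --> X]indicE memNset//.
  have [N nN] : exists N, ~ A N x by apply: contrapT => h; apply: xA => n _; apply: contrapT => h'; apply: h; exists n.
  apply: cvg_near_cst; near=> n; rewrite indicE memNset// => An.
  by apply: nN; apply: dA' An; near: n; exact: nbhs_infty_ge.
have := @dominated_cvg _ RR R lam setT measurableT
  (fun n y => it_int l (fun z => (\1_(A n) z)%:E) (upd x c y))
  (fun y => it_int l (fun z => (\1_(\bigcap_n A n) z)%:E) (upd x c y))
  (fun=> 1%:E).
apply.
- by move=> n; apply: measurable_it_int_upd; [exact: m1|exact: p1].
- by move=> y _; exact: ih.
- by [].
- apply/integrableP; split; first exact: measurable_cst.
  by under eq_integral do rewrite gee0_abs//; rewrite integral_lam_cst ltry.
- move=> n y _; rewrite gee0_abs; last by exact: it_int_ge0.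
  rewrite -[leRHS](it_int_cst l 1%:E (upd x c y)); apply: le_it_int => //.
    exact: m1.
  by move=> z; rewrite lee_fin indicE lern1 leq_b1.
Unshelve. all: by end_near. Qed.

(** The quantifier almost everywhere in Fubini form: for almost every value of the first coordinate,
    then of the second, and so on. It is meaningful for arbitrary [Q]; for measurable [Q] the order
    of the coordinates may be changed by [AE_perm]. *)
Fixpoint AE (l : seq coord) (Q : cspace -> Prop) (x : cspace) : Prop :=
  if l is c :: l' then leb.-negligible [set y | ~ AE l' Q (upd x c y)] else Q x.

(** The predicates have to be compared only at points that keep the values of [x] and [x'] outside
    [l]. This is how facts about the fixed coordinates are used under the quantifier. *)
Lemma AE_congr l (Q Q' : cspace -> Prop) x x' :
  (forall z z' : cspace, (forall c, c \in l -> z c = z' c) ->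
     (forall c, c \notin l -> z c = x c) -> (forall c, c \notin l -> z' c = x' c) ->
     Q z -> Q' z') ->
  AE l Q x -> AE l Q' x'.
Proof.
elim: l x x' => [|c l ih] x x' H /=; first by apply: H.
apply: negligibleS => y /= ny hy; apply: ny; move: hy; apply: ih.
move=> z z' zz' zx zx'; apply: H => d.
- rewrite in_cons; have [->|dc] /= := eqVneq d c; last exact: zz'.
  move=> _; have [cl|cl] := boolP (c \in l); first exact: zz'.
  by rewrite zx// zx'// !updE.
- by rewrite in_cons negb_or => /andP[dc dl]; rewrite zx// upd_neq.
- by rewrite in_cons negb_or => /andP[dc dl]; rewrite zx'// upd_neq.
Qed.

Lemma AE_imp l (Q Q' : cspace -> Prop) x : (forall z, Q z -> Q' z) ->
  AE l Q x -> AE l Q' x.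
Proof.
move=> H; apply: AE_congr => z z' zl zx zx' Qz; apply: H.
suff -> : z' = z by [].
apply/funext => c; have [cl|cl] := boolP (c \in l); first by rewrite zl.
by rewrite zx// zx'.
Qed.

Lemma AE_true l (Q : cspace -> Prop) x : (forall z, Q z) -> AE l Q x.
Proof.
move=> H; elim: l x => //= c l ih x.
by apply: (@negligibleS _ _ _ leb set0) => [y /= ny|]; [exact: ny|exact: negligible_set0].
Qed.

Lemma AE_and l (Q Q' : cspace -> Prop) x : AE l Q x -> AE l Q' x ->
  AE l (fun z => Q z /\ Q' z) x.
Proof.
elim: l x => [|c l ih] x //= h h'.
have := negligibleU h h'; apply: negligibleS => y /= ny.
have [hq|] := pselect (AE l Q (upd x c y)); last by left.
have [hq'|] := pselect (AE l Q' (upd x c y)); last by right.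
by exfalso; apply: ny; exact: ih.
Qed.

Lemma AE_cat l l' Q x : AE (l ++ l') Q x = AE l (AE l' Q) x.
Proof.
elim: l x => //= c l ih x; congr (leb.-negligible _).
by apply/seteqP; split => y /=; rewrite ih.
Qed.

Lemma negligible_affine (a b : R) (A : set R) : a != 0%R ->
  leb.-negligible A -> leb.-negligible ((fun y => a * y + b)%R @^-1` A).
Proof.
move=> a0 [B [mB B0 AB]]; exists ((fun y => a * y + b)%R @^-1` B); split.
- by rewrite -[X in measurable X]setTI; exact: measurable_affine.
- by rewrite lebesgue_measure_affine// B0 mule0.
- by move=> y /AB.
Qed.

(* [al c] and [be c] may only depend on the coordinates that are integrated
   before [c], that is, on those outside [drop (index c l) l]. *)
Lemma AE_subst l (Q : cspace -> Prop) (al be : coord -> cspace -> R) x : uniq l ->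
  (forall c (z z' : cspace), c \in l ->
     (forall d, d \notin drop (index c l) l -> z d = z' d) ->
     al c z = al c z' /\ be c z = be c z') ->
  (forall c z, c \in l -> al c z != 0%R) ->
  AE l Q x ->
  AE l (fun z => Q (fun c => if c \in l then (al c z * z c + be c z)%R else z c)) x.
Proof.
elim: l al be x => [|c l ih] al be x //= /andP[cl ul] dep al0 H.
have cc : c \in c :: l by rewrite mem_head.
have := negligible_affine (be c x) (al0 c x cc) H.
apply: negligibleS => y /= ny hy; apply: ny.
apply: (AE_congr _ (ih (fun d z => al d (upd z c y)) (fun d z => be d (upd z c y)) _ ul _ _ hy)); last 2 first.
- move=> d z z' dl zz'; apply: dep; first by rewrite in_cons dl orbT.
  have dc : (c == d) = false by apply/eqP => cd; rewrite cd dl in cl.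
  move=> d'; rewrite /= dc /= => dd'; rewrite /upd; case: ifP => // _.
  exact: zz'.
- by move=> d z dl; apply: al0; rewrite in_cons dl orbT.
move=> z z' zz' zx zx'.
have z'E : upd z c y = z'.
  apply/funext => d; rewrite /upd; case: ifP => [/eqP ->|dc].
    by rewrite zx'// updE.
  have [dl|dl] := boolP (d \in l); first exact: zz'.
  by rewrite zx// zx'// !upd_neq// dc.
have zc : z c = (al c x * y + be c x)%R by rewrite zx// updE.
have z'c : z' c = y by rewrite zx'// updE.
have [ax bx] : al c z' = al c x /\ be c z' = be c x.
  apply: dep => // d; rewrite /= eqxx /= in_cons negb_or => /andP[dc dl].
  by rewrite zx'// upd_neq.
rewrite z'E; congr Q; apply/funext => d; rewrite in_cons.
have [->|dc] /= := eqVneq d c; first by rewrite (negbTE cl) zc ax bx z'c.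
by case: ifP => dl; [rewrite zz'|rewrite zx ?dl// zx' ?dl// !upd_neq].
Qed.

(** The bridge between null sets and integrals: an integral of a nonnegative function vanishes
    exactly when the function does almost everywhere, and [lam] has the Lebesgue null sets. *)
Lemma AE_it_int l (A : set cspace) x : measurable A ->
  AE l (fun z => ~ A z) x <-> it_int l (fun z => (\1_A z)%:E) x = 0.
Proof.
move=> mA.
have m1 : measurable_fun setT (fun z => (\1_A z)%:E : \bar R).
  by apply/measurable_EFinP; exact: measurable_indic.
have p1 z : 0 <= (\1_A z)%:E :> \bar R by rewrite lee_fin.
elim: l x => [|c l ih] x /=.
  rewrite indicE; split => [nA|]; first by rewrite memNset.
  by move=> e Ax; move: e; rewrite mem_set// => /eqP; rewrite eqe oner_eq0.
pose g y := it_int l (fun z => (\1_A z)%:E) (upd x c y).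
have mg : measurable_fun [set: RR] g by exact: measurable_it_int_upd.
have g0 y : 0 <= g y by exact: it_int_ge0.
have mN : measurable [set y : R | g y != 0].
  have := mg measurableT (~` [set 0]) (measurableC (emeasurable_set1 0)).
  by rewrite setTI; congr measurable; apply/seteqP; split => y /= /eqP.
have E : [set y | ~ AE l (fun z => ~ A z) (upd x c y)] = [set y | g y != 0].
  apply/seteqP; split => y /= ny; first by apply/eqP => gy; apply: ny; apply/ih.
  by move=> /ih gy; rewrite /g gy eqxx in ny.
rewrite E lebesgue_negligibleP// -lam_null// -[X in X <-> _](@negligibleP _ RR R lam _ mN).
have := @ae_eq_integral_abs _ RR R lam setT measurableT g mg.
under eq_integral do rewrite gee0_abs//.
move=> ->; rewrite /ae_eq /prop_near1 /= /almost_everywhere /=.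
split => [hN|].
  change (lam.-negligible (~` [set y | True -> g y = 0])); move: hN.
  apply: negligibleS => y /= hy; apply/eqP => gy; exact: hy.
change (lam.-negligible (~` [set y | True -> g y = 0]) -> lam.-negligible [set y | g y != 0]).
apply: negligibleS => y /= /eqP gy hy; apply: gy; exact: hy.
Qed.

Lemma AE_perm l l' (Q : set cspace) x : measurable Q -> uniq l -> perm_eq l l' ->
  AE l Q x -> AE l' Q x.
Proof.
move=> mQ ul pl h.
have E l0 : AE l0 Q x <-> AE l0 (fun z => ~ (~` Q) z) x.
  by split; apply: AE_imp => z; [move=> ?; exact|move=> /contrapT].
apply/E/AE_it_int; first exact: measurableC.
rewrite -(it_int_perm _ _ _ ul pl).
- by apply/AE_it_int; [exact: measurableC|exact/E].
- by apply/measurable_EFinP; apply: measurable_indic; exact: measurableC.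
- by move=> z; rewrite lee_fin.
Qed.

End iterated.

(** * Counting lattice points of unipotent matrices *)

Definition setq (q : nat -> int) (i : nat) (m : int) : nat -> int :=
  fun j => if j == i then m else q j.

Lemma setqE q i m : setq q i m i = m. Proof. by rewrite /setq eqxx. Qed.

Lemma setq_neq q i m j : j != i -> setq q i m j = q j.
Proof. by rewrite /setq => /negbTE ->. Qed.

Section moments.
Context {R : realType}.
Local Notation leb := (@lebesgue_measure R).
Local Notation lam := (@lam R).
Local Notation unif01 := (@unif01 R).
Local Notation RR := (measurableTypeR R).
Local Notation cspace := (@cspace R).
Local Open Scope ereal_scope.

Variables (n : nat) (l : seq coord) (x : cspace).
Hypothesis uniq_l : uniq l.
Hypothesis upper_l : forall i j, (i < j)%N -> (j < n)%N -> (i, j) \in l.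

(* The unipotent matrix of [z] sends [q] to the vector with entries [q i + tl i q z]. *)
Definition tl (i : nat) (q : nat -> int) (z : cspace) : R :=
  (\sum_(i.+1 <= j < n) z (i, j) * (q j)%:~R)%R.

(** Rows are processed from the bottom up. The weight [G] gathers the factors of the rows already
    treated, and must stay fixed while entries of a row above them are averaged. *)
Definition indep (i : nat) (G : cspace -> \bar R) :=
  forall z z' : cspace, (forall r j, (i <= r)%N -> z (r, j) = z' (r, j)) -> G z = G z'.

Lemma measurable_tl i q : measurable_fun setT (tl i q).
Proof.
apply: measurable_sum => j; apply: measurable_funM => //.
exact: measurable_coord.
Qed.

Lemma eq_tl i q q' z : (forall j, (i < j)%N -> q j = q' j) -> tl i q z = tl i q' z.
Proof. by move=> qq'; apply: eq_big_nat => j /andP[ij _]; rewrite qq'. Qed.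

Lemma tl_upd i j q z y : (i < j < n)%N ->
  tl i q (upd z (i, j) y) = (tl i q (upd z (i, j) 0) + y * (q j)%:~R)%R.
Proof.
move=> ijn; rewrite /tl !(bigD1_seq j) ?iota_uniq ?mem_index_iota//=.
rewrite !updE mul0r add0r addrC; congr (_ + _)%R.
apply: eq_bigr => j' jj'.
have cn : (i, j') != (i, j) by rewrite xpair_eqE eqxx.
by rewrite !upd_neq.
Qed.

Lemma tl_upd2 i j j' q z y y' : (i < j < n)%N -> (i < j' < n)%N -> j != j' ->
  tl i q (upd (upd z (i, j) y) (i, j') y') =
  (tl i q (upd (upd z (i, j) 0) (i, j') 0) + y * (q j)%:~R + y' * (q j')%:~R)%R.
Proof.
move=> ij ij' jj'.
have cc : (i, j) != (i, j') by rewrite xpair_eqE eqxx.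
rewrite (tl_upd _ _ y')// (updC z y 0 cc) (tl_upd _ _ y)// -(updC z 0 0 cc).
by [].
Qed.

Lemma indep_upd i G z j y : indep i.+1 G -> G (upd z (i, j) y) = G z.
Proof.
move=> iG; apply: iG => r j' ir; rewrite upd_neq// xpair_eqE.
by rewrite (gtn_eqF ir).
Qed.

Lemma indepW i G : indep i.+1 G -> indep i G.
Proof. by move=> iG z z' zz'; apply: iG => r j ir; apply: zz'; exact: ltnW. Qed.

Lemma indep_tl i q (f : R -> \bar R) (c : R) : indep i (fun z => f (c + tl i q z)%R).
Proof.
move=> z z' zz'; congr (f (_ + _)%R); rewrite /tl.
by apply: eq_bigr => j _; rewrite zz'.
Qed.

Lemma indepM i G G' : indep i G -> indep i G' -> indep i (fun z => G z * G' z).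
Proof. by move=> iG iG' z z' zz'; rewrite (iG _ _ zz') (iG' _ _ zz'). Qed.

(** The entry [(i, j)] alone makes [tl i q] uniform modulo one, because its coefficient [q j] is
    nonzero, and [G] does not see this entry. *)
Lemma equid_row1 i q (P : R -> \bar R) G j : (i < j < n)%N -> q j != 0%R ->
  measurable_fun setT P -> (forall y, 0 <= P y) -> (forall y, P (y + 1)%R = P y) ->
  measurable_fun setT G -> (forall z, 0 <= G z) -> indep i.+1 G ->
  it_int l (fun z => G z * P (tl i q z)) x = \int[unif01]_v P v * it_int l G x.
Proof.
move=> ijn qj mP P0 P1 mG G0 iG.
have /andP[ij jn] := ijn.
rewrite (it_int_upd (c := (i, j)))//; last 3 first.
- by apply: emeasurable_funM => //; apply: measurableT_comp => //; exact: measurable_tl.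
- by move=> z; rewrite mule_ge0.
- exact: upper_l.
rewrite -it_intZl//; last exact: integral_ge0.
apply: eq_it_int => z.
under eq_integral do rewrite (indep_upd _ _ _ iG) (tl_upd q _ _ ijn).
rewrite ge0_integralZl//; last first.
  by apply: measurableT_comp => //; apply: measurable_funD => //; exact: measurable_funM.
by rewrite periodic_equidistribution// muleC.
Qed.

(** The entries [(i, j)] and [(i, j')] enter the two forms with a nonzero determinant, so that the
    forms become independent modulo one. *)
Lemma equid_row2 i q q' (P K : R -> \bar R) G j j' :
  (i < j < n)%N -> (i < j' < n)%N -> (q j * q' j' != q j' * q' j)%R ->
  measurable_fun setT P -> (forall y, 0 <= P y) -> (forall y, P (y + 1)%R = P y) ->
  measurable_fun setT K -> (forall y, 0 <= K y) -> (forall y, K (y + 1)%R = K y) ->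
  measurable_fun setT G -> (forall z, 0 <= G z) -> indep i.+1 G ->
  it_int l (fun z => G z * (P (tl i q z) * K (tl i q' z))) x =
  \int[unif01]_v P v * \int[unif01]_v K v * it_int l G x.
Proof.
move=> ijn ijn' qq mP P0 P1 mK K0 K1 mG G0 iG.
have jj' : j != j' by apply: contraNneq qq => ->; rewrite mulrC.
have /andP[ij jn] := ijn; have /andP[ij' jn'] := ijn'.
have mPK : measurable_fun setT (fun z => P (tl i q z) * K (tl i q' z)).
  by apply: emeasurable_funM; apply: measurableT_comp => //; exact: measurable_tl.
rewrite (it_int_upd2 (c := (i, j)) (c' := (i, j')))//; last 4 first.
- exact: emeasurable_funM.
- by move=> z; rewrite !mule_ge0.
- exact: upper_l.
- exact: upper_l.
rewrite -it_intZl//; last by apply: mule_ge0; exact: integral_ge0.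
apply: eq_it_int => z.
set a := tl i q (upd (upd z (i, j) 0) (i, j') 0).
set b := tl i q' (upd (upd z (i, j) 0) (i, j') 0).
pose HH y y' := P (a + y * (q j)%:~R + y' * (q j')%:~R)%R *
                K (b + y * (q' j)%:~R + y' * (q' j')%:~R)%R.
have HH0 y y' : 0 <= HH y y' by rewrite mule_ge0.
have mlin (c : R) (u v : int) : measurable_fun setT
    (fun w : R * R => (c + w.1 * u%:~R + w.2 * v%:~R)%R).
  by apply: measurable_funD; [apply: measurable_funD|] => //; exact: measurable_funM.
have mHH2 : measurable_fun setT (fun w : R * R => HH w.1 w.2).
  by apply: emeasurable_funM; apply: measurableT_comp => //; exact: mlin.
have mHH y : measurable_fun [set: RR] (HH y).
  exact: (measurable_fun_pair2 y mHH2).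
transitivity (\int[lam]_y \int[lam]_y' (G z * HH y y')).
  apply: eq_integral => y _; apply: eq_integral => y' _.
  rewrite (indep_upd _ _ _ iG) (indep_upd _ _ _ iG) (tl_upd2 q _ _ _ ijn ijn' jj').
  by rewrite (tl_upd2 q' _ _ _ ijn ijn' jj').
transitivity (\int[lam]_y (G z * \int[lam]_y' HH y y')).
  by apply: eq_integral => y _; rewrite ge0_integralZl.
rewrite ge0_integralZl//; last 2 first.
- exact: (@measurable_fun_integralR _ _ RR lam HH).
- by move=> y _; exact: integral_ge0.
rewrite muleC; congr (_ * _); apply: periodic_equidistribution2 => //.
by rewrite subr_eq0.
Qed.

Variables f h : nat -> R -> \bar R.
Hypothesis mf : forall i, measurable_fun setT (f i).
Hypothesis mh : forall i, measurable_fun setT (h i).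
Hypothesis f0 : forall i y, 0 <= f i y.
Hypothesis h0 : forall i y, 0 <= h i y.

(* The coordinates of [q] from [i] on are fixed, the first [i] ones are summed over. *)
Fixpoint Ucount (g : nat -> R -> \bar R) (i : nat) (q : nat -> int) (z : cspace) : \bar R :=
  if i is i'.+1 then
    zsum (fun m => g i' (m%:~R + tl i' q z)%R * Ucount g i' (setq q i' m) z)
  else 1.

Fixpoint Vcount (i : nat) (q q' : nat -> int) (z : cspace) : \bar R :=
  if i is i'.+1 then
    zsum (fun m => zsum (fun m' =>
      f i' (m%:~R + tl i' q z)%R * h i' (m'%:~R + tl i' q' z)%R *
      Vcount i' (setq q i' m) (setq q' i' m') z))
  else 1.

Lemma Ucount_ge0 g i q z : (forall i y, 0 <= g i y) -> 0 <= Ucount g i q z.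
Proof.
move=> g0; elim: i q => //= i ih q; apply: zsum_ge0 => m.
by rewrite mule_ge0.
Qed.

Lemma Vcount_ge0 i q q' z : 0 <= Vcount i q q' z.
Proof.
elim: i q q' => //= i ih q q'; apply: zsum_ge0 => m; apply: zsum_ge0 => m'.
by rewrite !mule_ge0.
Qed.

Lemma measurable_row (g : R -> \bar R) (c : R) i q : measurable_fun setT g ->
  measurable_fun setT (fun z => g (c + tl i q z)%R).
Proof.
move=> mg; apply: measurableT_comp => //; apply: measurable_funD => //.
exact: measurable_tl.
Qed.

Lemma measurable_Ucount g i q : (forall i, measurable_fun setT (g i)) ->
  (forall i y, 0 <= g i y) -> measurable_fun setT (Ucount g i q).
Proof.
move=> mg g0; elim: i q => //= i ih q; apply: measurable_zsum => [m|z m].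
  by apply: emeasurable_funM => //; exact: measurable_row.
by rewrite mule_ge0// Ucount_ge0.
Qed.

Lemma measurable_Vcount i q q' : measurable_fun setT (Vcount i q q').
Proof.
elim: i q q' => //= i ih q q'; apply: measurable_zsum => [m|z m]; last first.
  by apply: zsum_ge0 => m'; rewrite !mule_ge0// Vcount_ge0.
apply: measurable_zsum => [m'|z m']; last by rewrite !mule_ge0// Vcount_ge0.
by apply: emeasurable_funM => //; apply: emeasurable_funM; exact: measurable_row.
Qed.

Lemma Ucount_mul i q q' z : Ucount f i q z * Ucount h i q' z = Vcount i q q' z.
Proof.
elim: i q q' => [|i ih] q q' /=; first by rewrite mul1e.
rewrite zsum_mul; last 2 first.
- by move=> m; rewrite mule_ge0// Ucount_ge0.
- by move=> m; rewrite mule_ge0// Ucount_ge0.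
apply: eq_zsum => m; apply: eq_zsum => m'; rewrite -ih.
by rewrite muleACA.
Qed.

Variables F H M : nat -> R.
Hypothesis F0 : forall i, (0 <= F i)%R.
Hypothesis H0 : forall i, (0 <= H i)%R.
Hypothesis M0 : forall i, (0 <= M i)%R.
Hypothesis FE : forall i, \int[leb]_y f i y = (F i)%:E.
Hypothesis HE : forall i, \int[leb]_y h i y = (H i)%:E.

(** A Siegel mean value formula for unipotent matrices. The factor of row [i] is moved into the
    weight [G] before the induction hypothesis is applied; summing over [m] afterwards gives a
    periodic function of [tl i q], whose mean unfolds to [F i]. *)
Lemma first_moment i q G j : (i <= j < n)%N -> q j != 0%R ->
  measurable_fun setT G -> (forall z, 0 <= G z) -> indep i G ->
  it_int l (fun z => G z * Ucount f i q z) x = (\prod_(r < i) F r)%:E * it_int l G x.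
Proof.
move=> ijn qj.
elim: i q G ijn qj => [|i ih] q G /andP[ij jn] qj mG G0 iG /=.
  by rewrite big_ord0 mul1e; apply: eq_it_int => z; rewrite mule1.
have ji : j != i by rewrite gtn_eqF.
transitivity (it_int l (fun z => zsum (fun m =>
    (G z * f i (m%:~R + tl i q z)%R) * Ucount f i (setq q i m) z)) x).
  apply: eq_it_int => z; rewrite -zsumZl//; last first.
    by move=> m; rewrite mule_ge0// Ucount_ge0.
  by apply: eq_zsum => m; rewrite muleA.
have mGf m : measurable_fun setT (fun z => G z * f i (m%:~R + tl i q z)%R).
  by apply: emeasurable_funM => //; exact: measurable_row.
have Gf0 m z : 0 <= G z * f i (m%:~R + tl i q z)%R by rewrite mule_ge0.
rewrite (@it_int_zsum R l (fun m z =>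
    (G z * f i (m%:~R + tl i q z)%R) * Ucount f i (setq q i m) z) x); last 2 first.
- by move=> m; apply: emeasurable_funM => //; exact: measurable_Ucount.
- by move=> m z; rewrite mule_ge0// Ucount_ge0.
transitivity (zsum (fun m => (\prod_(r < i) F r)%:E *
    it_int l (fun z => G z * f i (m%:~R + tl i q z)%R) x)).
  apply: eq_zsum => m; apply: ih => //; first by rewrite (ltnW ij).
    by rewrite setq_neq.
  by apply: indepM; [exact: indepW|exact: indep_tl].
have pF : 0 <= (\prod_(r < i) F r)%:E :> \bar R by rewrite lee_fin prodr_ge0.
rewrite zsumZl//; last by move=> m; exact: it_int_ge0.
rewrite -(@it_int_zsum R l (fun m z => G z * f i (m%:~R + tl i q z)%R) x)//.
transitivity ((\prod_(r < i) F r)%:E * ((F i)%:E * it_int l G x)); last first.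
  by rewrite muleA -EFinM big_ord_recr.
congr (_ * _); rewrite -FE -unfold_unif01//.
rewrite -(@equid_row1 i q (fun v => zsum (fun m => f i (m%:~R + v)%R)) G j)//.
- by apply: eq_it_int => z; rewrite zsumZl.
- by rewrite ij.
- exact: measurable_zsum_shift.
- by move=> y; exact: zsum_ge0.
- by move=> y; exact: zsum_shift_periodic.
Qed.

(** The induction of [first_moment] carried out on pairs. Nonproportional tails stay so when further
    coordinates are prescribed, so in every row the two counts are independent and the moment
    factors. *)
Lemma second_moment_nonproportional i q q' G j j' :
  (i <= j < n)%N -> (i <= j' < n)%N -> (q j * q' j' != q j' * q' j)%R ->
  measurable_fun setT G -> (forall z, 0 <= G z) -> indep i G ->
  it_int l (fun z => G z * Vcount i q q' z) x =
  (\prod_(r < i) (F r * H r))%:E * it_int l G x.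
Proof.
elim: i q q' G => [|i ih] q q' G /andP[ij jn] /andP[ij' jn'] qq mG G0 iG /=.
  by rewrite big_ord0 mul1e; apply: eq_it_int => z; rewrite mule1.
have ji : j != i by rewrite gtn_eqF.
have ji' : j' != i by rewrite gtn_eqF.
pose K m m' z := G z * (f i (m%:~R + tl i q z)%R * h i (m'%:~R + tl i q' z)%R).
have K0 m m' z : 0 <= K m m' z by rewrite !mule_ge0.
have mK m m' : measurable_fun setT (K m m').
  by do 2 (apply: emeasurable_funM => //); exact: measurable_row.
have iK m m' : indep i (K m m').
  by apply: indepM; [exact: indepW|apply: indepM; exact: indep_tl].
have KV0 m m' z : 0 <= K m m' z * Vcount i (setq q i m) (setq q' i m') z.
  by rewrite mule_ge0// Vcount_ge0.
have mKV m m' : measurable_fun setT (fun z => K m m' z * Vcount i (setq q i m) (setq q' i m') z).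
  by apply: emeasurable_funM => //; exact: measurable_Vcount.
transitivity (it_int l (fun z => zsum (fun m => zsum (fun m' =>
    K m m' z * Vcount i (setq q i m) (setq q' i m') z))) x).
  apply: eq_it_int => z; rewrite -zsumZl//; last first.
    by move=> m; apply: zsum_ge0 => m'; rewrite !mule_ge0// Vcount_ge0.
  apply: eq_zsum => m; rewrite -zsumZl//; last first.
    by move=> m'; rewrite !mule_ge0// Vcount_ge0.
  by apply: eq_zsum => m'; rewrite muleA.
rewrite (@it_int_zsum R l (fun m z => zsum (fun m' =>
    K m m' z * Vcount i (setq q i m) (setq q' i m') z)) x); last 2 first.
- by move=> m; exact: measurable_zsum.
- by move=> m z; exact: zsum_ge0.
have pF : 0 <= (\prod_(r < i) (F r * H r))%:E :> \bar R.
  by rewrite lee_fin prodr_ge0// => r _; rewrite mulr_ge0.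
transitivity (zsum (fun m => zsum (fun m' => (\prod_(r < i) (F r * H r))%:E *
    it_int l (K m m') x))).
  apply: eq_zsum => m.
  rewrite (@it_int_zsum R l (fun m' z => K m m' z * Vcount i (setq q i m) (setq q' i m') z) x)//.
  apply: eq_zsum => m'; apply: ih => //.
  - by rewrite (ltnW ij).
  - by rewrite (ltnW ij').
  - by rewrite !setq_neq.
transitivity ((\prod_(r < i) (F r * H r))%:E * ((F i)%:E * (H i)%:E * it_int l G x)); last first.
  by rewrite muleA -!EFinM big_ord_recr.
transitivity ((\prod_(r < i) (F r * H r))%:E * zsum (fun m => zsum (fun m' => it_int l (K m m') x))).
  rewrite -zsumZl//; last by move=> m; apply: zsum_ge0 => m'; exact: it_int_ge0.
  by apply: eq_zsum => m; rewrite zsumZl// => m'; exact: it_int_ge0.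
congr (_ * _).
transitivity (it_int l (fun z => zsum (fun m => zsum (fun m' => K m m' z))) x).
  rewrite (@it_int_zsum R l (fun m z => zsum (fun m' => K m m' z)) x).
  - by apply: eq_zsum => m; rewrite (@it_int_zsum R l (fun m' z => K m m' z) x).
  - by move=> m; exact: measurable_zsum.
  - by move=> m z; exact: zsum_ge0.
rewrite -FE -HE -unfold_unif01// -(unfold_unif01 (f := h i))//.
rewrite -(@equid_row2 i q q' (fun v => zsum (fun m => f i (m%:~R + v)%R))
   (fun v => zsum (fun m => h i (m%:~R + v)%R)) G j j')//.
- apply: eq_it_int => z; rewrite zsum_mul// -zsumZl//; last first.
    by move=> m; apply: zsum_ge0 => m'; rewrite mule_ge0.
  by apply: eq_zsum => m; rewrite -zsumZl// => m'; rewrite mule_ge0.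
- by rewrite ij.
- by rewrite ij'.
- exact: measurable_zsum_shift.
- by move=> y; exact: zsum_ge0.
- by move=> y; exact: zsum_shift_periodic.
- exact: measurable_zsum_shift.
- by move=> y; exact: zsum_ge0.
- by move=> y; exact: zsum_shift_periodic.
Qed.

Hypothesis ME : forall i, \int[leb]_y (f i y * h i y) = (M i)%:E.
Hypothesis offdiag : forall i, \int[unif01]_v zsum (fun m => zsum (fun m' =>
  if m == m' then 0 else f i (m%:~R + v)%R * h i (m'%:~R + v)%R)) <= (F i * H i)%:E.

(** Unrolled, the sum over [j <= i] of the product of [F r * H r] for [r < j] and of [M r] for
    [j <= r < i]. The term [j] stands for pairs of vectors that agree in the coordinates from [j] on
    and not in the preceding one. *)
Fixpoint Bbound (i : nat) : R :=
  if i is i'.+1 then (M i' * Bbound i' + \prod_(r < i) (F r * H r))%R else 1%R.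

Lemma Bbound_ge0 i : (0 <= Bbound i)%R.
Proof.
elim: i => //= i ih; rewrite addr_ge0 ?mulr_ge0// prodr_ge0// => r _.
by rewrite mulr_ge0.
Qed.

(** Pairs are split by their [i]-th coordinates. If these agree, the tails are still equal and the
    induction applies, with a factor [M i]. If they differ, the common nonzero entry [q j] makes the
    extended tails nonproportional, so the previous lemma factors the remaining rows and [offdiag]
    bounds row [i]. *)
Lemma second_moment_equal i q G j : (i <= j < n)%N -> q j != 0%R ->
  measurable_fun setT G -> (forall z, 0 <= G z) -> indep i G ->
  it_int l (fun z => G z * Vcount i q q z) x <= (Bbound i)%:E * it_int l G x.
Proof.
elim: i q G => [|i ih] q G /andP[ij jn] qj mG G0 iG.
  by rewrite /= mul1e; under eq_it_int do rewrite mule1.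
have ji : j != i by rewrite gtn_eqF.
pose K m m' z := G z * (f i (m%:~R + tl i q z)%R * h i (m'%:~R + tl i q z)%R).
have K0 m m' z : 0 <= K m m' z by rewrite !mule_ge0.
have mK m m' : measurable_fun setT (K m m').
  by do 2 (apply: emeasurable_funM => //); exact: measurable_row.
have iK m m' : indep i (K m m').
  by apply: indepM; [exact: indepW|apply: indepM; exact: indep_tl].
pose KV m m' z := K m m' z * Vcount i (setq q i m) (setq q i m') z.
have KV0 m m' z : 0 <= KV m m' z by rewrite mule_ge0// Vcount_ge0.
have mKV m m' : measurable_fun setT (KV m m').
  by apply: emeasurable_funM => //; exact: measurable_Vcount.
pose KVo m m' z := if m == m' then 0 else KV m m' z.
have KVo0 m m' z : 0 <= KVo m m' z by rewrite /KVo; case: ifP.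
have mKVo m m' : measurable_fun setT (KVo m m') by rewrite /KVo; case: (m == m').
have -> : it_int l (fun z => G z * Vcount i.+1 q q z) x =
    it_int l (fun z => zsum (fun m => KV m m z)) x +
    it_int l (fun z => zsum (fun m => zsum (fun m' => KVo m m' z))) x.
  rewrite -it_intD//; last 4 first.
  - by apply: measurable_zsum.
  - by apply: measurable_zsum => [m|z m]; [exact: measurable_zsum|exact: zsum_ge0].
  - by move=> z; exact: zsum_ge0.
  - by move=> z; apply: zsum_ge0 => m; exact: zsum_ge0.
  apply: eq_it_int => z /=; rewrite -zsumZl//; last first.
    by move=> m; apply: zsum_ge0 => m'; rewrite !mule_ge0// Vcount_ge0.
  rewrite -zsumD//; last by move=> m; exact: zsum_ge0.
  apply: eq_zsum => m; rewrite -zsumZl//; last first.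
    by move=> m'; rewrite !mule_ge0// Vcount_ge0.
  transitivity (zsum (fun m' => (if m' == m then KV m m' z else 0) + KVo m m' z)).
    apply: eq_zsum => m'; rewrite /KVo /KV muleA [m == m']eq_sym.
    by case: eqP => [->|]; rewrite ?adde0 ?add0e.
  rewrite zsumD//; last by move=> m'; case: ifP.
  congr (_ + _); rewrite (zsum_single (m0 := m)) ?eqxx// => m'; first by case: ifP.
  by move=> /negbTE ->.
have iG0 : 0 <= it_int l G x by exact: it_int_ge0.
have dgl : it_int l (fun z => zsum (fun m => KV m m z)) x <=
    (M i * Bbound i)%:E * it_int l G x.
  rewrite (@it_int_zsum R l (fun m z => KV m m z) x)//.
  apply: (@le_trans _ _ (zsum (fun m => (Bbound i)%:E * it_int l (K m m) x))).
    apply: le_zsum => m; first exact: it_int_ge0.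
    by apply: ih => //; [rewrite (ltnW ij)|rewrite setq_neq].
  rewrite zsumZl ?lee_fin ?Bbound_ge0//; last by move=> m; exact: it_int_ge0.
  rewrite -(@it_int_zsum R l (fun m z => K m m z) x)// mulrC EFinM -muleA.
  rewrite lee_wpmul2l// ?lee_fin ?Bbound_ge0//.
  rewrite -ME -unfold_unif01//; last 2 first.
  - exact: emeasurable_funM.
  - by move=> y; rewrite mule_ge0.
  rewrite -(@equid_row1 i q (fun v => zsum (fun m => f i (m%:~R + v)%R * h i (m%:~R + v)%R)) G j)//.
  - by rewrite le_eqVlt; apply/orP; left; apply/eqP; apply: eq_it_int => z;
      rewrite zsumZl// => m; rewrite mule_ge0.
  - by rewrite ij.
  - apply: (measurable_zsum_shift (f := fun y => f i y * h i y)); first exact: emeasurable_funM.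
    by move=> y; rewrite mule_ge0.
  - by move=> y; apply: zsum_ge0 => m; rewrite mule_ge0.
  - by move=> y; apply: (zsum_shift_periodic (f := fun y => f i y * h i y)) => w; rewrite mule_ge0.
pose Ko m m' z := if m == m' then 0 else K m m' z.
have Ko0 m m' z : 0 <= Ko m m' z by rewrite /Ko; case: ifP.
have mKo m m' : measurable_fun setT (Ko m m') by rewrite /Ko; case: (m == m').
have pF : 0 <= (\prod_(r < i) (F r * H r))%:E :> \bar R.
  by rewrite lee_fin prodr_ge0// => r _; rewrite mulr_ge0.
have off : it_int l (fun z => zsum (fun m => zsum (fun m' => KVo m m' z))) x <=
    (\prod_(r < i.+1) (F r * H r))%:E * it_int l G x.
  have -> : it_int l (fun z => zsum (fun m => zsum (fun m' => KVo m m' z))) x =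
      (\prod_(r < i) (F r * H r))%:E *
      it_int l (fun z => zsum (fun m => zsum (fun m' => Ko m m' z))) x.
    rewrite (@it_int_zsum R l (fun m z => zsum (fun m' => KVo m m' z)) x); last 2 first.
    - by move=> m; exact: measurable_zsum.
    - by move=> m z; exact: zsum_ge0.
    rewrite (@it_int_zsum R l (fun m z => zsum (fun m' => Ko m m' z)) x); last 2 first.
    - by move=> m; exact: measurable_zsum.
    - by move=> m z; exact: zsum_ge0.
    rewrite -zsumZl//; last by move=> m; apply: it_int_ge0 => z; exact: zsum_ge0.
    apply: eq_zsum => m.
    rewrite (@it_int_zsum R l (fun m' z => KVo m m' z) x)// (@it_int_zsum R l (fun m' z => Ko m m' z) x)//.
    rewrite -zsumZl//; last by move=> m'; exact: it_int_ge0.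
    apply: eq_zsum => m'; rewrite /KVo /Ko; case: eqVneq => [_|mm'].
      by rewrite it_int_cst mule0.
    apply: (@second_moment_nonproportional _ _ _ _ j i) => //.
    - by rewrite (ltnW ij).
    - by rewrite leqnn (ltn_trans ij).
    - by rewrite !setqE !setq_neq// mulrC (inj_eq (mulIf qj)) eq_sym.
  rewrite big_ord_recr /= EFinM -muleA lee_wpmul2l//.
  pose P v := zsum (fun m => zsum (fun m' =>
    if m == m' then 0 else f i (m%:~R + v)%R * h i (m'%:~R + v)%R)).
  have mfh m m' : measurable_fun setT (fun v : R => if m == m' then 0 else f i (m%:~R + v)%R * h i (m'%:~R + v)%R).
    case: (m == m') => //; apply: emeasurable_funM; apply: measurableT_comp => //; exact: measurable_funD.
  have fh0 m m' v : 0 <= if m == m' then 0 else f i (m%:~R + v)%R * h i (m'%:~R + v)%R.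
    by case: ifP => // _; rewrite mule_ge0.
  have -> : it_int l (fun z => zsum (fun m => zsum (fun m' => Ko m m' z))) x =
            \int[unif01]_v P v * it_int l G x.
    rewrite -(@equid_row1 i q P G j)//.
    - apply: eq_it_int => z; rewrite -zsumZl//; last by move=> m; exact: zsum_ge0.
      apply: eq_zsum => m; rewrite -zsumZl//.
      by apply: eq_zsum => m'; rewrite /Ko; case: ifP; rewrite ?mule0.
    - by rewrite ij.
    - by apply: measurable_zsum => [m|v m]; [exact: measurable_zsum|exact: zsum_ge0].
    - by move=> v; apply: zsum_ge0 => m; exact: zsum_ge0.
    - move=> v; rewrite /P -[RHS](zsum_shift 1); last by move=> m; exact: zsum_ge0.
      apply: eq_zsum => m; rewrite -[RHS](zsum_shift 1)//.
      apply: eq_zsum => m'; rewrite (inj_eq (addIr 1%R)); case: ifP => // _.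
      by rewrite !intrD !(addrAC _ 1%:~R) !addrA.
  by apply: lee_wpmul2r => //; exact: offdiag.
by rewrite /= EFinD ge0_muleDl ?leeD// lee_fin ?mulr_ge0 ?Bbound_ge0// prodr_ge0// => r _; rewrite mulr_ge0.
Qed.

End moments.

(** * Counting integers and pairs of integers in intervals *)

Section boxes.
Context {R : realType}.
Local Notation leb := (@lebesgue_measure R).
Local Notation lam := (@lam R).
Local Notation unif01 := (@unif01 R).
Local Notation RR := (measurableTypeR R).
Local Open Scope ereal_scope.

Definition box (b y : R) : \bar R := ((`|y| <= b)%R%:R)%:E.

Lemma box_ge0 b y : 0 <= box b y. Proof. by rewrite lee_fin. Qed.

Lemma boxE b y : box b y = (\1_(`[(- b)%R, b]%classic) y)%:E.
Proof. by rewrite /box indicE mem_setE in_itv /= ler_norml. Qed.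

Lemma measurable_box b : measurable_fun setT (box b).
Proof.
rewrite (_ : box b = fun y => (\1_(`[(- b)%R, b]%classic) y)%:E); last first.
  by apply/funext => y; exact: boxE.
by apply/measurable_EFinP; exact: measurable_indic.
Qed.

Lemma integral_box b : (0 <= b)%R -> \int[leb]_y box b y = (2 * b)%:E.
Proof.
move=> b0; under eq_integral do rewrite boxE.
transitivity (leb `[(- b)%R, b]%classic); first by rewrite integral_indic// setIT.
rewrite lebesgue_measure_itv /= lte_fin.
case: ltP => [_|]; first by rewrite -EFinB; congr (_%:E); lra.
by move=> ?; congr (_%:E); lra.
Qed.

Lemma box_mul a b y : box a y * box b y = box (Num.min a b) y.
Proof. by rewrite /box -EFinM -natrM mulnb le_min. Qed.

Lemma integral_box_mul a b : (0 <= a)%R -> (0 <= b)%R ->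
  \int[leb]_y (box a y * box b y) = (2 * Num.min a b)%:E.
Proof.
move=> a0 b0; under eq_integral do rewrite box_mul.
by rewrite integral_box// le_min a0.
Qed.

Lemma integral_box_affine a b c : (0 <= b)%R -> a != 0%R ->
  \int[leb]_y box b (c + a * y)%R = (2 * b / `|a|)%:E.
Proof.
move=> b0 a0.
pose A := ((fun y => a * y + c)%R @^-1` `[(- b)%R, b]%classic).
have mA : measurable A by rewrite -[X in measurable X]setTI; exact: measurable_affine.
transitivity (\int[leb]_y (\1_A y)%:E).
  apply: eq_integral => y _; rewrite boxE !indicE; congr (_%:R%:E); congr nat_of_bool.
  by apply/idP/idP => /set_mem /= e; apply/mem_set => /=; move: e; rewrite addrC.
transitivity (leb A); first by rewrite integral_indic// setIT.
rewrite /A lebesgue_measure_affine// lebesgue_measure_itv /= lte_fin.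
case: ltP => [_|?]; first by rewrite -EFinB -EFinM; congr (_%:E); field; rewrite normr_eq0.
have -> : b = 0%R by lra.
by rewrite mule0 mulr0 mul0r.
Qed.

Lemma zsum_bigsum (I : Type) (r : seq I) (F : I -> int -> \bar R) :
  (forall i m, 0 <= F i m) ->
  zsum (fun m => \sum_(i <- r) F i m) = \sum_(i <- r) zsum (F i).
Proof.
move=> F0; elim: r => [|i r ih].
  rewrite big_nil; under eq_zsum do rewrite big_nil.
  by apply: eseries0.
rewrite big_cons -ih -zsumD//; last by move=> m; apply: sume_ge0.
by apply: eq_zsum => m; rewrite big_cons.
Qed.

Lemma zsum_count_pos (B : R) : (0 <= B)%R ->
  zsum (fun e : int => (((1 <= e)%R && (e%:~R <= B)%R)%:R)%:E : \bar R) <= B%:E.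
Proof.
move=> B0; pose N := Num.truncn B.
have NB : (N%:R <= B)%R by have /andP[] := Num.Theory.truncn_itv B0.
apply: (@le_trans _ _ (zsum (fun e => \sum_(j <- iota 1 N) ((e == j%:Z)%:R)%:E : \bar R))).
  apply: le_zsum => e; first by rewrite lee_fin.
  case: (boolP (_ && _)) => [/andP[e1 eB]|_]; last by apply: sume_ge0 => j _; rewrite lee_fin.
  case: e e1 eB => // e e1 eB.
  rewrite (bigD1_seq e) ?iota_uniq//=; last first.
    rewrite mem_iota add1n ltnS -lez_nat e1 /=.
    by rewrite /N truncn_ge_nat.
  by rewrite eqxx leeDl// sume_ge0// => j _; rewrite lee_fin.
rewrite zsum_bigsum; last by move=> *; rewrite lee_fin.
under eq_bigr.
  move=> j _; rewrite (zsum_single (m0 := j%:Z)); last 2 first.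
  - by move=> m; rewrite lee_fin.
  - by move=> m /negbTE ->.
  rewrite eqxx; over.
by rewrite sumEFin big_const_seq count_predT size_iota iter_addr addr0 lee_fin.
Qed.

Lemma zsum_opp F : (forall m, 0 <= F m) -> zsum (fun m => F (- m)%R) = zsum F :> \bar R.
Proof.
move=> F0; apply: (zsum_reindex (h := fun m => (- m)%R)) => //; by split.
Qed.

(** Leaving out zero removes the usual additive constant, so the bound remains proportional to the
    length for short intervals. *)
Lemma zsum_count_range (A B : R) : (0 <= A)%R -> (0 <= B)%R ->
  zsum (fun e : int => (((e != 0)%R && (- A <= e%:~R <= B)%R)%:R)%:E : \bar R) <= (A + B)%:E.
Proof.
move=> A0 B0.
apply: (@le_trans _ _ (zsum (fun e : int =>
   (((1 <= - e)%R && ((- e)%:~R <= A)%R)%:R)%:E + (((1 <= e)%R && (e%:~R <= B)%R)%:R)%:E))).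
  apply: le_zsum => e; first by rewrite lee_fin.
  rewrite -EFinD lee_fin mulrNz lerNl.
  case: (boolP (_ && _)) => [/andP[e0 /andP[-> ->]]|_]; last by rewrite addr_ge0.
  rewrite !andbT; have [e1|e1] := leP 1%R e; first by rewrite lerDr.
  by rewrite (_ : (1 <= - e)%R = true) ?lerDl//; lia.
rewrite zsumD; last 2 first.
- by move=> m; rewrite lee_fin.
- by move=> m; rewrite lee_fin.
rewrite EFinD; apply: leeD; last exact: zsum_count_pos.
rewrite (zsum_opp (F := fun e : int => (((1 <= e)%R && (e%:~R <= A)%R)%:R)%:E)).
  exact: zsum_count_pos.
by move=> m; rewrite lee_fin.
Qed.

(** For a fixed [m] with [y = m + v] in the smaller box, the nonzero differences [m' - m] lie
    between [- (b + y)] and [b - y]. Both lengths are nonnegative because [a <= b], and they add up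
    to [2 * b]. *)
Lemma box_offdiag_le a b : (0 <= a)%R -> (a <= b)%R ->
  \int[unif01]_v zsum (fun m => zsum (fun m' =>
    if m == m' then 0 else box a (m%:~R + v)%R * box b (m'%:~R + v)%R)) <=
  (2 * a * (2 * b))%:E.
Proof.
move=> a0 ab; have b0 : (0 <= b)%R by exact: le_trans ab.
apply: (@le_trans _ _ (\int[unif01]_v zsum (fun m => (2 * b)%:E * box a (m%:~R + v)%R))).
  have mbx c (m : int) : measurable_fun setT (fun v : R => box c (m%:~R + v)%R).
    by apply: (measurableT_comp (measurable_box c)); exact: measurable_funD.
  apply: ge0_le_integral => //.
  - move=> v _; apply: zsum_ge0 => m; apply: zsum_ge0 => m'.
    by case: ifP => // _; rewrite mule_ge0// box_ge0.
  - apply: measurable_zsum => [m|v m]; last first.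
      by apply: zsum_ge0 => m'; case: ifP => // _; rewrite mule_ge0// box_ge0.
    apply: measurable_zsum => [m'|v m']; last by case: ifP => // _; rewrite mule_ge0// box_ge0.
    by case: (m == m') => //; apply: emeasurable_funM; exact: mbx.
  - apply: measurable_zsum => [m|v m]; first by apply: emeasurable_funM => //; exact: mbx.
    by rewrite mule_ge0 ?box_ge0// lee_fin mulr_ge0.
  - move=> v _; apply: le_zsum => m.
      by apply: zsum_ge0 => m'; case: ifP => // _; rewrite mule_ge0// box_ge0.
    rewrite -(zsum_shift m); last by move=> m'; case: ifP => // _; rewrite mule_ge0// box_ge0.
    rewrite {1}/box; case: (lerP `|m%:~R + v|%R a) => [mva|mva]; last first.
      rewrite (_ : zsum _ = 0) ?mule_ge0 ?box_ge0 ?lee_fin ?mulr_ge0//.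
      by apply: eseries0 => e _ _; rewrite mul0e; case: ifP.
    rewrite /box mva mule1.
    move: mva; rewrite ler_norml => /andP[v1 v2].
    set y := (m%:~R + v)%R in v1 v2.
    have h1 : (0 <= b + y)%R by lra.
    have h2 : (0 <= b - y)%R by lra.
    have := zsum_count_range h1 h2; rewrite (_ : b + y + (b - y) = 2 * b)%R; last lra.
    apply: le_trans; apply: le_zsum => e.
      by case: ifP => // _; rewrite mul1e lee_fin.
    rewrite -[X in X == _]add0r (inj_eq (addIr m)) eq_sym.
    case: eqP => [_|_] /=; first by rewrite lee_fin.
    rewrite mul1e lee_fin ler_nat.
    case: (lerP `|_|%R b) => //; rewrite intrD ler_norml => /andP[? ?].
    by rewrite (_ : _ && _ = true)//; apply/andP; split; rewrite /y; lra.
rewrite (unfold_unif01 (f := fun y => (2 * b)%:E * box a y)); last 2 first.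
- by apply: emeasurable_funM => //; exact: measurable_box.
- by move=> y; rewrite mule_ge0 ?box_ge0// lee_fin mulr_ge0.
rewrite ge0_integralZl//; last 3 first.
- exact: measurable_box.
- by move=> y _; exact: box_ge0.
- by rewrite lee_fin mulr_ge0.
by rewrite integral_box// -EFinM lee_fin mulrC.
Qed.

Lemma box_offdiag a b : (0 <= a)%R -> (0 <= b)%R ->
  \int[unif01]_v zsum (fun m => zsum (fun m' =>
    if m == m' then 0 else box a (m%:~R + v)%R * box b (m'%:~R + v)%R)) <=
  (2 * a * (2 * b))%:E.
Proof.
move=> a0 b0; have [ab|/ltW ba] := leP a b; first exact: box_offdiag_le.
have := box_offdiag_le b0 ba; rewrite [X in _ <= X%:E -> _]mulrC; apply: le_trans.
rewrite le_eqVlt; apply/orP; left; apply/eqP; apply: eq_integral => v _.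
rewrite zsum_interchange; last by move=> *; case: ifP => // _; rewrite mule_ge0// box_ge0.
by apply: eq_zsum => m; apply: eq_zsum => m'; rewrite eq_sym muleC.
Qed.

Lemma zsum2_reindex (phi : int * int -> int * int) (F : int -> int -> \bar R) :
  set_bij setT setT phi -> (forall m m', 0 <= F m m') ->
  zsum (fun e => zsum (fun j => F (phi (e, j)).1 (phi (e, j)).2)) =
  zsum (fun m => zsum (fun m' => F m m')).
Proof.
move=> pb F0.
have E (H : int -> int -> \bar R) : (forall m m', 0 <= H m m') ->
    zsum (fun m => zsum (fun m' => H m m')) = \esum_(p in [set: int * int]) H p.1 p.2.
  move=> H0; rewrite zsumE; last by move=> m; exact: zsum_ge0.
  under eq_esum do rewrite zsumE//.
  rewrite esum_esum//; congr esum.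
  by apply/seteqP; split => -[].
rewrite !E// [RHS](reindex_esum setT _ phi)//.
by apply: eq_esum => -[].
Qed.

(** The unimodular substitution [phi] replaces [(m, m')] by the determinant [e = m * b - m' * a] and
    a second integer [j], and the sum over [j] unfolds to an integral over the line. Only nonzero
    [e] with [|e| <= b * al + a * be] occur, and each contributes at most the length of the shorter
    of two intervals. *)
Lemma pair_count_coprime (a b : nat) (al be : R) : (0 < a)%N -> (0 < b)%N ->
  coprime a b -> (0 <= al)%R -> (0 <= be)%R ->
  \int[unif01]_v zsum (fun m => zsum (fun m' =>
    if (m * b%:Z == m' * a%:Z)%R then 0
    else box al (m%:~R + v * a%:R)%R * box be (m'%:~R + v * b%:R)%R)) <=
  (8 * al * be)%:E.
Proof.
move=> a0 b0 ab al0 be0.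
have ar : (0 < a%:R :> R)%R by rewrite ltr0n.
have br : (0 < b%:R :> R)%R by rewrite ltr0n.
have [u [w uw]] : exists u w : int, (u * b%:Z - w * a%:Z = 1)%R.
  have /coprimezP[[s t] /= st] : coprimez a%:Z b%:Z by rewrite coprimezE.
  by exists t, (- s)%R; rewrite mulNr opprK addrC.
pose phi (p : int * int) : int * int := (p.1 * u + p.2 * a%:Z, p.1 * w + p.2 * b%:Z)%R.
have phib : set_bij setT setT phi.
  split => //.
  - move=> [e j] [e' j'] _ _ [/= h1 h2].
    have h3 : (e = e')%R.
      have : (e * (u * b%:Z - w * a%:Z) = e' * (u * b%:Z - w * a%:Z))%R.
        transitivity ((e * u + j * a%:Z) * b%:Z - (e * w + j * b%:Z) * a%:Z)%R; first by ring.
        by rewrite h1 h2; ring.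
      by rewrite uw !mulr1.
    congr pair => //.
    have : (j * (u * b%:Z - w * a%:Z) = j' * (u * b%:Z - w * a%:Z))%R.
      transitivity ((e * w + j * b%:Z) * u - (e * u + j * a%:Z) * w)%R; first by ring.
      by rewrite h1 h2; ring.
    by rewrite uw !mulr1.
  - move=> [m m'] _; exists (m * b%:Z - m' * a%:Z, m' * u - m * w)%R => //.
    rewrite /phi /=; congr pair.
      by rewrite -[RHS]mulr1 -uw; ring.
    by rewrite -[RHS]mulr1 -uw; ring.
pose g (e : int) (y : R) : \bar R :=
  box al ((e * u)%:~R + a%:R * y)%R * box be ((e * w)%:~R + b%:R * y)%R.
have g0 e y : 0 <= g e y by rewrite mule_ge0 ?box_ge0.
have maff (c d : R) (r : R) : measurable_fun setT (fun y : R => box r (c + d * y)%R).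
  by apply: (measurableT_comp (measurable_box r)); apply: measurable_funD => //; exact: measurable_funM.
have mg e : measurable_fun setT (g e) by exact: emeasurable_funM.
pose G e y := if e == 0%R then 0 else g e y.
have G0 e y : 0 <= G e y by rewrite /G; case: ifP.
have mG e : measurable_fun setT (G e) by rewrite /G; case: (e == 0%R).
have -> : \int[unif01]_v zsum (fun m => zsum (fun m' =>
    if (m * b%:Z == m' * a%:Z)%R then 0
    else box al (m%:~R + v * a%:R)%R * box be (m'%:~R + v * b%:R)%R)) =
  \int[unif01]_v zsum (fun e => zsum (fun j => G e (j%:~R + v)%R)).
  apply: eq_integral => v _.
  rewrite -(zsum2_reindex (phi := phi))//; last first.
    by move=> m m'; case: ifP => // _; rewrite mule_ge0 ?box_ge0.
  apply: eq_zsum => e; apply: eq_zsum => j; rewrite /phi /= /G /g.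
  have -> : ((e * u + j * a%:Z) * b%:Z == (e * w + j * b%:Z) * a%:Z)%R = (e == 0)%R.
    rewrite -subr_eq0.
    have -> : ((e * u + j * a%:Z) * b%:Z - (e * w + j * b%:Z) * a%:Z =
               e * (u * b%:Z - w * a%:Z))%R by ring.
    by rewrite uw mulr1.
  case: ifP => // _; congr (box _ _ * box _ _).
    by rewrite intrD [(j * _)%:~R]intrM -pmulrn; ring.
  by rewrite intrD [(j * _)%:~R]intrM -pmulrn; ring.
have mGs e (c : R) : measurable_fun setT (fun v : R => G e (c + v)%R).
  by apply: (measurableT_comp (mG e)); exact: measurable_funD.
rewrite integral_zsum; last 2 first.
- move=> e; apply: measurable_zsum_shift => //.
- by move=> v e; exact: zsum_ge0.
under eq_zsum do rewrite unfold_unif01//.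
(* Since [mn * a <= 2 * al] and [mn * b <= 2 * be], the total [2 * mn * (b * al + a * be)] is at
   most [8 * al * be], whatever [a] and [b] are. *)
pose mn : R := (Num.min (2 * al / a%:R) (2 * be / b%:R))%R.
have mn0 : (0 <= mn)%R.
  by rewrite le_min !mulr_ge0// ?invr_ge0 ?ltW.
pose K : R := (b%:R * al + a%:R * be)%R.
have K0 : (0 <= K)%R by rewrite addr_ge0// mulr_ge0// ltW.
apply: (@le_trans _ _ (zsum (fun e : int => mn%:E * (((e != 0)%R && (- K <= e%:~R <= K)%R)%:R)%:E))).
  apply: le_zsum => e; first exact: integral_ge0.
  rewrite /G; case: eqVneq => [_|e0] /=; first by rewrite integral0 mule0.
  have [eK|eK] := boolP (- K <= e%:~R <= K)%R; last first.
    rewrite mule0 (_ : \int[leb]_y _ = 0)//.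
    apply: integral0_eq => y _; rewrite /g /box.
    case: (lerP `|_|%R al) => [h1|_]; last by rewrite mul0e.
    case: (lerP `|_|%R be) => [h2|_]; last by rewrite mule0.
    exfalso; move: eK; rewrite -ler_norml => /negP; apply.
    have -> : (e%:~R = b%:R * ((e * u)%:~R + a%:R * y) - a%:R * ((e * w)%:~R + b%:R * y) :> R)%R.
      have : (e = b%:Z * (e * u) - a%:Z * (e * w))%R by rewrite -[LHS]mulr1 -uw; ring.
      move=> /(congr1 (fun t : int => t%:~R : R)); rewrite intrB !(intrM _ _%:Z) -!pmulrn => ->.
      by ring.
    apply: le_trans (ler_normB _ _) _; rewrite !normrM !(ger0_norm (ler0n _ _)).
    by rewrite lerD// ler_wpM2l.
  rewrite mule1 EFin_min le_min; apply/andP; split.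
    rewrite -(ger0_norm (ltW ar)) -(integral_box_affine (e * u)%:~R al0 (lt0r_neq0 ar)).
    apply: ge0_le_integral => //; [exact: mg|exact: maff|].
    move=> y _; rewrite /g -[leRHS]mule1 lee_wpmul2l ?box_ge0//.
    by rewrite /box lee_fin lern1 leq_b1.
  rewrite -(ger0_norm (ltW br)) -(integral_box_affine (e * w)%:~R be0 (lt0r_neq0 br)).
  apply: ge0_le_integral => //; [exact: mg|exact: maff|].
  move=> y _; rewrite /g -[leRHS]mul1e lee_wpmul2r ?box_ge0//.
  by rewrite /box lee_fin lern1 leq_b1.
rewrite zsumZl ?lee_fin//.
apply: (@le_trans _ _ (mn%:E * (K + K)%:E)).
  by rewrite lee_wpmul2l ?lee_fin// zsum_count_range.
rewrite -EFinM lee_fin /K.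
have m1 : (mn * a%:R <= 2 * al)%R.
  by rewrite -ler_pdivlMr// /mn ge_min lexx.
have m2 : (mn * b%:R <= 2 * be)%R.
  by rewrite -ler_pdivlMr// /mn ge_min lexx orbT.
by nra.
Qed.

(** Dividing [a] and [b] by their gcd [d] replaces [v] by [d * v], which is again uniform modulo
    one. *)
Lemma pair_count (a b : nat) (al be : R) : (0 < a)%N -> (0 < b)%N ->
  (0 <= al)%R -> (0 <= be)%R ->
  \int[lam]_v zsum (fun m => zsum (fun m' =>
    if (m * b%:Z == m' * a%:Z)%R then 0
    else box al (m%:~R + v * a%:R)%R * box be (m'%:~R + v * b%:R)%R)) <=
  (8 * al * be)%:E.
Proof.
move=> a0 b0 al0 be0; pose d := gcdn a b.
have d0 : (0 < d)%N by rewrite gcdn_gt0 a0.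
pose a' := (a %/ d)%N; pose b' := (b %/ d)%N.
have aE : a = (a' * d)%N by rewrite divnK// dvdn_gcdl.
have bE : b = (b' * d)%N by rewrite divnK// dvdn_gcdr.
have a'0 : (0 < a')%N by move: a0; rewrite aE muln_gt0 => /andP[].
have b'0 : (0 < b')%N by move: b0; rewrite bE muln_gt0 => /andP[].
have cop : coprime a' b'.
  rewrite /coprime -(eqn_pmul2r d0) mul1n muln_gcdl -aE -bE.
  by rewrite -/d.
pose P (v : R) := zsum (fun m => zsum (fun m' =>
    if (m * b'%:Z == m' * a'%:Z)%R then 0
    else box al (m%:~R + v * a'%:R)%R * box be (m'%:~R + v * b'%:R)%R)).
have fh0 (m m' : int) (v : R) : 0 <= if (m * b'%:Z == m' * a'%:Z)%R then 0
    else box al (m%:~R + v * a'%:R)%R * box be (m'%:~R + v * b'%:R)%R.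
  by case: ifP => // _; rewrite mule_ge0 ?box_ge0.
have mbx (c : R) (m : int) (r : R) : measurable_fun setT (fun v : R => box c (m%:~R + v * r)%R).
  by apply: (measurableT_comp (measurable_box c)); apply: measurable_funD => //; exact: measurable_funM.
have mP : measurable_fun setT P.
  apply: measurable_zsum => [m|v m]; last exact: zsum_ge0.
  apply: measurable_zsum => [m'|v m'//].
  by case: (_ == _)%R => //; exact: emeasurable_funM.
have P0 v : 0 <= P v by apply: zsum_ge0 => m; exact: zsum_ge0.
have P1 v : P (v + 1)%R = P v.
  rewrite /P -[RHS](zsum_shift a'%:Z); last by move=> m; exact: zsum_ge0.
  apply: eq_zsum => m; rewrite -[RHS](zsum_shift b'%:Z)//.
  apply: eq_zsum => m'; rewrite !mulrDl (mulrC b'%:Z a'%:Z) (inj_eq (addIr _)).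
  case: ifP => // _; rewrite !mul1r !intrD -!pmulrn.
  by congr (box _ _ * box _ _); ring.
have dz : d%:Z != 0%R by rewrite eqz_nat -lt0n.
apply: (@le_trans _ _ (\int[unif01]_v P v)); last first.
  exact: (pair_count_coprime a'0 b'0 cop al0 be0).
rewrite -(@periodic_equidistribution R P d%:Z 0%R mP P0 P1 dz).
rewrite le_eqVlt; apply/orP; left; apply/eqP.
apply: eq_integral => v _; apply: eq_zsum => m; apply: eq_zsum => m'.
rewrite add0r -pmulrn.
have -> : (m * b%:Z == m' * a%:Z)%R = (m * b'%:Z == m' * a'%:Z)%R.
  by rewrite aE bE !PoszM !mulrA (inj_eq (mulIf dz)).
case: ifP => // _; congr (box _ _ * box _ _); rewrite ?aE ?bE natrM; ring.
Qed.

Lemma zsum_multiples (d : nat) (F : int -> \bar R) : (0 < d)%N ->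
  (forall m, 0 <= F m) ->
  zsum (fun m => if (d%:Z %| m)%Z then F m else 0) = zsum (fun m => F (d%:Z * m)%R).
Proof.
move=> d0 F0.
have dz : d%:Z != 0%R by rewrite eqz_nat -lt0n.
transitivity (zsum (fun m => zsum (fun m' => if m == (d%:Z * m')%R then F m else 0))).
  apply: eq_zsum => m; case: ifPn => [/dvdzP[m0 ->]|dm].
    rewrite (zsum_single (m0 := m0)).
    - by rewrite mulrC eqxx.
    - by move=> m'; case: ifP.
    - by move=> m' mm; rewrite mulrC (inj_eq (mulfI dz)) eq_sym (negbTE mm).
  apply/esym/eseries0 => e _ _; case: eqP => // h.
  by move: dm; rewrite h dvdz_mulr.
rewrite zsum_interchange; last by move=> m m'; case: ifP.
apply: eq_zsum => m'; rewrite (zsum_single (m0 := (d%:Z * m')%R)) ?eqxx//.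
- by move=> m; case: ifP.
- by move=> m /negbTE ->.
Qed.

(** A union bound: an integer [m] not coprime to [a] is a multiple of the divisor [gcd(m, a) >= 2]
    of [a], and the multiples of [d] have mean count [2 * b / d]. *)
Lemma coprime_first_moment (a : nat) (b : R) : (0 < a)%N -> (0 <= b)%R ->
  (2 * b)%:E <= \int[lam]_v zsum (fun m =>
       if coprime `|m|%N a then box b (m%:~R + v * a%:R)%R else 0) +
    \sum_(d <- [seq d <- iota 2 a | (d %| a)%N]) (2 * b / d%:R)%:E.
Proof.
move=> a0 b0.
have mbx (m : int) (r : R) : measurable_fun setT (fun v : R => box b (m%:~R + v * r)%R).
  by apply: (measurableT_comp (measurable_box b)); apply: measurable_funD => //; exact: measurable_funM.
have az : a%:Z != 0%R by rewrite eqz_nat -lt0n.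
pose P (w : R) := zsum (fun m => box b (m%:~R + w)%R).
have mP : measurable_fun setT P.
  by apply: measurable_zsum_shift => //; [exact: measurable_box|exact: box_ge0].
have P0 w : 0 <= P w by apply: zsum_ge0 => m; exact: box_ge0.
have P1 w : P (w + 1)%R = P w by apply: zsum_shift_periodic; exact: box_ge0.
have -> : (2 * b)%:E = \int[lam]_v P (v * a%:R)%R.
  under eq_integral do rewrite pmulrn -[(_ * _)%R]add0r.
  rewrite (@periodic_equidistribution R P a%:Z 0%R mP P0 P1 az) unfold_unif01 ?integral_box//.
  - exact: measurable_box.
  - exact: box_ge0.
pose C v := zsum (fun m => if coprime `|m|%N a then box b (m%:~R + v * a%:R)%R else 0).
have C0 v : 0 <= C v by apply: zsum_ge0 => m; case: ifP => // _; exact: box_ge0.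
have mC : measurable_fun setT C.
  apply: measurable_zsum => [m|v m]; first by case: (coprime _ _).
  by case: ifP => // _; exact: box_ge0.
pose D (d : nat) v := zsum (fun m => box b ((d%:Z * m)%:~R + v * a%:R)%R).
have D0 d v : 0 <= D d v by apply: zsum_ge0 => m; exact: box_ge0.
have mD d : measurable_fun setT (D d).
  by apply: measurable_zsum => [m|v m]; [exact: mbx|exact: box_ge0].
have -> : \sum_(d <- [seq d <- iota 2 a | (d %| a)%N]) (2 * b / d%:R)%:E =
          \int[lam]_v \sum_(d <- [seq d <- iota 2 a | (d %| a)%N]) D d v.
  rewrite ge0_integral_sum//; apply: eq_big_seq => d.
  rewrite mem_filter mem_iota => /andP[/dvdnP[a' aE] /andP[d2 _]].
  have d0 : (0 < d)%N by exact: leq_trans d2.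
  have dr : (d%:R != 0 :> R)%R by rewrite pnatr_eq0 -lt0n.
  have a'0 : a'%:Z != 0%R by apply: contraNneq az => -[a'0]; rewrite aE a'0.
  pose Q (w : R) := zsum (fun m => box b (0 + d%:R * (m%:~R + w))%R).
  have mbd : measurable_fun setT (fun y : R => box b (0 + d%:R * y)%R).
    by apply: (measurableT_comp (measurable_box b)); apply: measurable_funD => //; exact: measurable_funM.
  have mQ : measurable_fun setT Q.
    by apply: (measurable_zsum_shift (f := fun y => box b (0 + d%:R * y)%R)) => // y; exact: box_ge0.
  have Q0 w : 0 <= Q w by apply: zsum_ge0 => m; exact: box_ge0.
  have Q1 w : Q (w + 1)%R = Q w.
    by apply: (zsum_shift_periodic (f := fun y => box b (0 + d%:R * y)%R)) => y; exact: box_ge0.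
  have := @periodic_equidistribution R Q a'%:Z 0%R mQ Q0 Q1 a'0.
  have -> : \int[unif01]_v Q v = (2 * b / d%:R)%:E.
    rewrite (unfold_unif01 (f := fun y => box b (0 + d%:R * y)%R))//; last first.
      by move=> y; exact: box_ge0.
    by rewrite integral_box_affine// ger0_norm.
  move=> <-.
  apply: eq_integral => v _; apply: eq_zsum => m; congr box.
  by rewrite aE natrM intrM -!pmulrn; ring.
rewrite -ge0_integralD//; last 3 first.
- by move=> v _; exact: C0.
- by move=> v _; apply: sume_ge0.
- by apply: emeasurable_sum.
have mPa : measurable_fun setT (fun v : R => P (v * a%:R)%R).
  by apply: (measurableT_comp mP); exact: measurable_funM.
apply: ge0_le_integral => //.
- by apply: emeasurable_funD => //; apply: emeasurable_sum.
move=> v _; rewrite /P /C /D.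
under [in leRHS]eq_big_seq.
  move=> d; rewrite mem_filter mem_iota => /andP[_ /andP[d2 _]].
  rewrite -(@zsum_multiples d (fun m => box b (m%:~R + v * a%:R)%R)); last 2 first.
  - exact: leq_trans d2.
  - by move=> m; exact: box_ge0.
  over.
rewrite -zsum_bigsum; last by move=> d m; case: ifP => // _; exact: box_ge0.
rewrite -zsumD; last 2 first.
- by move=> m; case: ifP => // _; exact: box_ge0.
- by move=> m; apply: sume_ge0 => d _; case: ifP => // _; exact: box_ge0.
apply: le_zsum => m; first exact: box_ge0.
case: ifPn => [_|ncop].
  by rewrite leeDl//; apply: sume_ge0 => d _; case: ifP => // _; exact: box_ge0.
rewrite add0e; pose d := gcdn `|m|%N a.
have d0 : (0 < d)%N by rewrite gcdn_gt0 a0 orbT.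
have d2 : (1 < d)%N by rewrite ltn_neqAle eq_sym d0 andbT; exact: ncop.
rewrite (bigD1_seq d) ?filter_uniq ?iota_uniq//=; last first.
  rewrite mem_filter dvdn_gcdr mem_iota d2 /= addnC addn2 ltnS ltnW// ltnS.
  by rewrite dvdn_leq// dvdn_gcdr.
rewrite dvdzE /= dvdn_gcdl leeDl//; apply: sume_ge0 => d' _.
by case: ifP => // _; exact: box_ge0.
Qed.

End boxes.

Section box_moments.
Context {R : realType}.
Local Notation leb := (@lebesgue_measure R).
Local Notation lam := (@lam R).
Local Notation unif01 := (@unif01 R).
Local Notation RR := (measurableTypeR R).
Local Notation cspace := (@cspace R).
Local Open Scope ereal_scope.

Variables (n : nat) (l : seq coord) (x : cspace).
Hypothesis uniq_l : uniq l.
Hypothesis upper_l : forall i j, (i < j)%N -> (j < n)%N -> (i, j) \in l.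

Definition Bbox (al be : nat -> R) : nat -> R :=
  Bbound (fun i => 2 * al i)%R (fun i => 2 * be i)%R (fun i => 2 * Num.min (al i) (be i))%R.

Definition Ubox (b : nat -> R) := Ucount n (fun i => box (b i)).
Definition Vbox (a b : nat -> R) := Vcount n (fun i => box (a i)) (fun i => box (b i)).

Lemma Ubox_ge0 b i q z : 0 <= Ubox b i q z.
Proof. by apply: Ucount_ge0 => *; exact: box_ge0. Qed.

Lemma Vbox_ge0 a b i q q' z : 0 <= Vbox a b i q q' z.
Proof. by apply: Vcount_ge0 => *; exact: box_ge0. Qed.

Lemma measurable_Ubox b i q : measurable_fun setT (Ubox b i q).
Proof. by apply: measurable_Ucount => *; [exact: measurable_box|exact: box_ge0]. Qed.

Lemma measurable_Vbox a b i q q' : measurable_fun setT (Vbox a b i q q').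
Proof. by apply: measurable_Vcount => *; (exact: measurable_box || exact: box_ge0). Qed.

Lemma Ubox_mul a b i q q' z : Ubox a i q z * Ubox b i q' z = Vbox a b i q q' z.
Proof. by apply: Ucount_mul => *; exact: box_ge0. Qed.

Lemma Ubox_hit b i q z : Ubox b i q z != 0 -> exists q' : nat -> int,
  (forall j, (i <= j)%N -> q' j = q j) /\
  (forall r, (r < i)%N -> (`|(q' r)%:~R + tl n r q' z| <= b r)%R).
Proof.
elim: i q => [|i ih] q; first by move=> _; exists q.
rewrite /Ubox /= => U0.
have [m mU] : exists m, box (b i) (m%:~R + tl n i q z)%R * Ubox b i (setq q i m) z != 0.
  apply: contrapT => h; move: U0 => /negP; apply; apply/eqP; apply: eseries0 => e _ _.
  by apply: contrapT => /eqP he; apply: h; exists (zenum e).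
have bm : (`|m%:~R + tl n i q z| <= b i)%R.
  apply: contraT => nb; move: mU; rewrite /box (negbTE nb) mul0e.
  by rewrite eqxx.
have : Ubox b i (setq q i m) z != 0 by apply: contraNneq mU => ->; rewrite mule0.
move=> /ih[q' [q'1 q'2]]; exists q'; split.
  by move=> j ij; rewrite q'1 ?setq_neq ?gtn_eqF// ltnW.
move=> r; rewrite ltnS leq_eqVlt => /orP[/eqP ->|ri]; last exact: q'2.
rewrite q'1// setqE (eq_tl _ (q' := q))// => j ij.
by rewrite q'1 ?setq_neq ?gtn_eqF// ltnW.
Qed.

Lemma box_first_moment b i q G j : (forall r, (0 <= b r)%R) ->
  (i <= j < n)%N -> q j != 0%R ->
  measurable_fun setT G -> (forall z, 0 <= G z) -> indep i G ->
  it_int l (fun z => G z * Ubox b i q z) x =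
  (\prod_(r < i) (2 * b r))%:E * it_int l G x.
Proof.
move=> b0 ij qj mG G0 iG.
have := @first_moment R n l x uniq_l upper_l (fun i => box (b i)) _ _
  (fun i => 2 * b i)%R _ _ i q G j ij qj mG G0 iG.
apply.
- by move=> *; exact: measurable_box.
- by move=> *; exact: box_ge0.
- by move=> r; rewrite mulr_ge0.
- by move=> r; exact: integral_box.
Qed.

Lemma box_second_moment_nonproportional a b i q q' G j j' :
  (forall r, (0 <= a r)%R) -> (forall r, (0 <= b r)%R) ->
  (i <= j < n)%N -> (i <= j' < n)%N -> (q j * q' j' != q j' * q' j)%R ->
  measurable_fun setT G -> (forall z, 0 <= G z) -> indep i G ->
  it_int l (fun z => G z * Vbox a b i q q' z) x =
  (\prod_(r < i) (2 * a r * (2 * b r)))%:E * it_int l G x.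
Proof.
move=> a0 b0 ij ij' qq mG G0 iG.
have := @second_moment_nonproportional R n l x uniq_l upper_l
  (fun i => box (a i)) (fun i => box (b i)) _ _ _ _
  (fun i => 2 * a i)%R (fun i => 2 * b i)%R _ _ _ _ i q q' G j j' ij ij' qq mG G0 iG.
apply.
- by move=> *; exact: measurable_box.
- by move=> *; exact: measurable_box.
- by move=> *; exact: box_ge0.
- by move=> *; exact: box_ge0.
- by move=> r; rewrite mulr_ge0.
- by move=> r; rewrite mulr_ge0.
- by move=> r; exact: integral_box.
- by move=> r; exact: integral_box.
Qed.

Lemma box_second_moment_equal a b i q G j :
  (forall r, (0 <= a r)%R) -> (forall r, (0 <= b r)%R) ->
  (i <= j < n)%N -> q j != 0%R ->
  measurable_fun setT G -> (forall z, 0 <= G z) -> indep i G ->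
  it_int l (fun z => G z * Vbox a b i q q z) x <= (Bbox a b i)%:E * it_int l G x.
Proof.
move=> a0 b0 ij qj mG G0 iG.
have := @second_moment_equal R n l x uniq_l upper_l
  (fun i => box (a i)) (fun i => box (b i)) _ _ _ _
  (fun i => 2 * a i)%R (fun i => 2 * b i)%R (fun i => 2 * Num.min (a i) (b i))%R
  _ _ _ _ _ _ _ i q G j ij qj mG G0 iG.
apply.
- by move=> *; exact: measurable_box.
- by move=> *; exact: measurable_box.
- by move=> *; exact: box_ge0.
- by move=> *; exact: box_ge0.
- by move=> r; rewrite mulr_ge0.
- by move=> r; rewrite mulr_ge0.
- by move=> r; rewrite mulr_ge0// le_min a0 b0.
- by move=> r; exact: integral_box.
- by move=> r; exact: integral_box.
- by move=> r; exact: integral_box_mul.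
- by move=> r; exact: box_offdiag.
Qed.

End box_moments.

(** * The probability that an affine lattice misses a box *)

Section miss_probability.
Context {R : realType}.
Local Notation cspace := (@cspace R).
Local Open Scope ereal_scope.
Variables (k : nat) (l : seq coord) (x : cspace).
Hypothesis uniq_l : uniq l.
Hypothesis upper_l : forall i j, (i < j)%N -> (j < k.+1)%N -> (i, j) \in l.
Variable b : nat -> R.
Hypothesis b0 : forall i, (0 < b i)%R.

(** The homogeneous coordinate 1 selects the last column of the matrix as a translation. *)
Definition q_one : nat -> int := setq (fun=> 0%R) k 1%R.

Let p (j : nat) : R := (\prod_(r < j) (2 * b r))%R.

(** The recursion solved for two equal boxes: the square of the mean plus a term that thereby bounds
    the variance. *)
Lemma Bbox_diag i : Bbox b b i = (p i * p i + p i * \sum_(j < i) p j)%R.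
Proof.
rewrite /Bbox; elim: i => [|i ih] /=; first by rewrite /p !big_ord0; lra.
rewrite ih minxx big_ord_recr big_split /= -/(p i) [p i.+1]big_ord_recr /= -/(p i).
rewrite [(\sum_(j < i.+1) _)%R]big_ord_recr /=; ring.
Qed.

(** Chebyshev's inequality: where the count [U] vanishes it deviates from its mean [p k] by all of
    [p k], and the variance is at most [p k] times the sum of the [p j]. *)
Lemma miss_probability :
  it_int l (fun z => (\1_[set z | Ubox k.+1 b k q_one z = 0] z)%:E) x <=
  ((\sum_(j < k) p j) / p k)%:E.
Proof.
have b0' i : (0 <= b i)%R by exact: ltW.
have p0 j : (0 < p j)%R by apply: prodr_gt0 => r _; rewrite mulr_gt0.
pose U := Ubox k.+1 b k q_one.
have mU : measurable_fun setT U by exact: measurable_Ubox.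
have U0 z : 0 <= U z by exact: Ubox_ge0.
pose A : set cspace := [set z | U z = 0].
have mA : measurable A.
  by have := mU measurableT [set 0] (emeasurable_set1 0); rewrite setTI.
have kk : (k <= k < k.+1)%N by rewrite leqnn ltnSn.
have q1 : q_one k != 0%R by rewrite /q_one setqE.
have m1 : measurable_fun setT (fun _ : cspace => 1 : \bar R) by exact: measurable_cst.
have p1 (z : cspace) : 0 <= 1 :> \bar R by [].
have i1 : indep k (fun _ : cspace => 1 : \bar R) by [].
have EU : it_int l U x = (p k)%:E.
  have := box_first_moment x uniq_l upper_l b0' kk q1 m1 p1 i1.
  under eq_it_int do rewrite mul1e.
  by rewrite it_int_cst mule1.
have EV : it_int l (fun z => U z * U z) x <= (Bbox b b k)%:E.
  have := box_second_moment_equal x uniq_l upper_l b0' b0' kk q1 m1 p1 i1.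
  rewrite it_int_cst mule1; apply: le_trans.
  rewrite le_eqVlt; apply/orP; left; apply/eqP; apply: eq_it_int => z.
  by rewrite mul1e Ubox_mul.
have mA1 : measurable_fun setT (fun z => (\1_A z)%:E : \bar R).
  by apply/measurable_EFinP; exact: measurable_indic.
have A1 z : 0 <= (\1_A z)%:E :> \bar R by rewrite lee_fin.
(* This is [1_A <= (U / p k - 1) ^ 2] with the negative terms moved to the other side, as [U] may be
   infinite. *)
have le1 : it_int l (fun z => (\1_A z)%:E + (2 / p k)%:E * U z) x <=
           it_int l (fun z => 1 + ((p k)^-1 ^+ 2)%:E * (U z * U z)) x.
  apply: le_it_int.
  - by apply: emeasurable_funD => //; exact: emeasurable_funM.
  - by apply: emeasurable_funD => //; do 2 (apply: emeasurable_funM => //).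
  - by move=> z; rewrite adde_ge0// mule_ge0// lee_fin divr_ge0// ltW.
  - move=> z; rewrite indicE.
    have [Az|Az] := boolP (z \in A).
      have -> : U z = 0 by exact: (set_mem Az).
      by rewrite !mule0 !adde0.
    rewrite add0e; move: (U0 z); case: (U z) => [u||]; rewrite ?lee_fin// => u0.
      have := sqr_ge0 (u / p k - 1)%R; rewrite !expr2 => ?.
      rewrite (_ : 2 / p k * u = 2 * (u / p k))%R; last by ring.
      rewrite (_ : (p k)^-1 * (p k)^-1 * (u * u) = (u / p k) * (u / p k))%R; last by ring.
      by clear p1; nra.
    by rewrite [in leRHS]mulyy [in leRHS]gt0_muley ?lte_fin ?exprn_gt0 ?invr_gt0// addey// leey.
have {le1} : it_int l (fun z => (\1_A z)%:E) x + 2%:E <= 1 + ((p k)^-1 ^+ 2 * Bbox b b k)%:E.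
  move: le1; rewrite it_intD//; last 2 first.
  - exact: emeasurable_funM.
  - by move=> z; rewrite mule_ge0// lee_fin divr_ge0// ltW.
  rewrite it_intD//; last 2 first.
  - by do 2 (apply: emeasurable_funM => //).
  - by move=> z; rewrite !mule_ge0// lee_fin exprn_ge0// invr_ge0 ltW.
  rewrite it_int_cst !it_intZl//; last 4 first.
  - exact: emeasurable_funM.
  - by move=> z; rewrite mule_ge0.
  - by rewrite lee_fin exprn_ge0// invr_ge0 ltW.
  - by rewrite lee_fin divr_ge0// ltW.
  rewrite EU -EFinM divfK ?gt_eqF// => h; apply: le_trans h _.
  by rewrite leeD2l// [in leRHS]EFinM lee_wpmul2l// lee_fin exprn_ge0// invr_ge0 ltW.
rewrite Bbox_diag.
have -> : ((p k)^-1 ^+ 2 * (p k * p k + p k * \sum_(j < k) p j) =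
          1 + (\sum_(j < k) p j) / p k)%R by field; rewrite gt_eqF.
move: (it_int_ge0 l x A1); case: (it_int _ _ _) => [r||]//; rewrite -?EFinD ?lee_fin => _.
  by clear p1 => ?; lra.
Qed.

End miss_probability.

(** * Counting vectors with coprime last coordinates *)

Section coprime_count.
Context {R : realType}.
Local Notation lam := (@lam R).
Local Notation unif01 := (@unif01 R).
Local Notation cspace := (@cspace R).
Local Open Scope ereal_scope.
Variables (K : nat) (l : seq coord) (x : cspace).
Hypothesis uniq_l : uniq l.
Hypothesis upper_l : forall i j, (i < j)%N -> (j < K.+2)%N -> (i, j) \in l.

Definition q_top (a : nat) : nat -> int := setq (fun=> 0%R) K.+1 a%:Z.

Definition Crow (b : nat -> R) (a : nat) (m : int) (z : cspace) : \bar R :=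
  if coprime `|m|%N a then box (b K) (m%:~R + tl K.+2 K (q_top a) z)%R else 0.

(* Only vectors whose last two coordinates are coprime are counted, so that
   distinct counted vectors are never proportional. *)
Definition Ncount (b : nat -> R) (z : cspace) : \bar R :=
  \sum_(a <- iota 1 (Num.truncn (b K.+1))) zsum (fun m =>
     Crow b a m z * Ubox K.+2 b K (setq (q_top a) K m) z).

Lemma tl_top a (z : cspace) : tl K.+2 K (q_top a) z = (z (K, K.+1) * a%:R)%R.
Proof. by rewrite /tl big_nat1 /q_top setqE. Qed.

Lemma Crow_ge0 b a m z : 0 <= Crow b a m z.
Proof. by rewrite /Crow; case: ifP => // _; exact: box_ge0. Qed.

Lemma measurable_Crow b a m : measurable_fun setT (Crow b a m).
Proof.
by rewrite /Crow; case: (coprime _ _) => //; apply: measurable_row; exact: measurable_box.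
Qed.

Lemma indep_Crow b a m : indep K (Crow b a m).
Proof.
rewrite /Crow; case: (coprime _ _) => //.
exact: indep_tl.
Qed.

Lemma Ncount_ge0 b z : 0 <= Ncount b z.
Proof.
by apply: sume_ge0 => a _; apply: zsum_ge0 => m; rewrite mule_ge0 ?Crow_ge0 ?Ubox_ge0.
Qed.

Lemma measurable_Ncount b : measurable_fun setT (Ncount b).
Proof.
apply: emeasurable_sum => a; apply: measurable_zsum => [m|z m].
  by apply: emeasurable_funM; [exact: measurable_Crow|exact: measurable_Ubox].
by rewrite mule_ge0 ?Crow_ge0 ?Ubox_ge0.
Qed.

Lemma Ncount_hit b z : (forall r, (0 <= b r)%R) -> Ncount b z != 0 ->
  exists q : nat -> int, [/\ q K.+1 != 0%R, (`|(q K.+1)%:~R| <= b K.+1)%R &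
    forall r, (r <= K)%N -> (`|(q r)%:~R + tl K.+2 r q z| <= b r)%R].
Proof.
move=> b0 N0.
have [a al aN] : exists2 a, a \in iota 1 (Num.truncn (b K.+1)) &
    zsum (fun m => Crow b a m z * Ubox K.+2 b K (setq (q_top a) K m) z) != 0.
  apply: contrapT => h; move: N0 => /negP; apply; rewrite /Ncount big_seq big1// => a al.
  by apply: contrapT => /eqP he; apply: h; exists a.
have [m] : exists m, Crow b a m z * Ubox K.+2 b K (setq (q_top a) K m) z != 0.
  apply: contrapT => h; move: aN => /negP; apply; apply/eqP; apply: eseries0 => e _ _.
  by apply: contrapT => /eqP he; apply: h; exists (zenum e).
rewrite mule_eq0 negb_or => /andP[Cm /Ubox_hit[q [q1 q2]]].
exists q; rewrite q1// setq_neq ?gtn_eqF// /q_top setqE.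
move: al; rewrite mem_iota add1n ltnS => /andP[a1 aA]; split.
- by rewrite eqz_nat -lt0n.
- by rewrite -pmulrn ger0_norm// -truncn_ge_nat.
move=> r; rewrite leq_eqVlt => /orP[/eqP ->|]; last exact: q2.
rewrite q1// setqE (eq_tl _ (q' := q_top a)); last first.
  by move=> j Kj; rewrite q1 ?setq_neq ?gtn_eqF// ltnW.
move: Cm; rewrite /Crow; case: ifP => [_|]; last by rewrite eqxx.
by rewrite /box; case: (_ <= _)%R => //; rewrite eqxx.
Qed.

Lemma it_int_top (P : R -> \bar R) : measurable_fun setT P -> (forall y, 0 <= P y) ->
  it_int l (fun z => P (z (K, K.+1))) x = \int[lam]_v P v.
Proof.
move=> mP P0; rewrite (it_int_upd (c := (K, K.+1)))//; last 2 first.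
- exact: (measurableT_comp mP (measurable_coord _)).
- exact: upper_l.
by under eq_it_int do under eq_integral do rewrite updE; rewrite it_int_cst.
Qed.

(** Strengthened to [3 / 4 - 1 / (E + 2)] for an induction that telescopes. What matters is a bound
    below 1: it keeps a positive proportion of the vectors after the coprimality condition is
    imposed. *)
Lemma harmonic_square_sum (D : nat) :
  (\sum_(d <- iota 2 D) (d%:R ^- 2 : R) <= 3 / 4)%R.
Proof.
have H E : (\sum_(d <- iota 2 E.+1) (d%:R ^- 2 : R) <= 3 / 4 - E.+2%:R^-1)%R.
  elim: E => [|E ih]; first by rewrite big_seq1 -exprVn; lra.
  rewrite -[E.+2]addn1 iotaD big_cat big_seq1 /=.
  apply: le_trans (lerD ih (lexx _)) _; rewrite add2n addn1.
  have d0 : (0 < E.+2%:R :> R)%R by rewrite ltr0n.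
  have d1 : (0 < E.+3%:R :> R)%R by rewrite ltr0n.
  have dE : (E.+3%:R = E.+2%:R + 1 :> R)%R by rewrite natr1.
  rewrite -subr_ge0.
  have -> : (3 / 4 - E.+3%:R^-1 - (3 / 4 - E.+2%:R^-1 + E.+3%:R ^- 2) =
     (E.+2%:R * E.+3%:R ^+ 2)^-1 :> R)%R.
    by move: (E.+2%:R : R)%R d0 dE => y y0 ->; field; apply/andP; split; apply: lt0r_neq0; lra.
  by rewrite invr_ge0 mulr_ge0// ltW// exprn_gt0.
case: D => [|D]; first by rewrite big_nil; lra.
by apply: le_trans (H D) _; rewrite gerBl.
Qed.

(** After exchanging the sums, each [d] is weighted by its number of multiples up to [A], which is
    at most [A / d]; this leaves the sum of the [1 / d ^ 2]. *)
Lemma divisor_sum (A : nat) :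
  (\sum_(a <- iota 1 A) \sum_(d <- [seq d <- iota 2 a | (d %| a)%N]) (d%:R^-1 : R) <= 3 / 4 * A%:R)%R.
Proof.
apply: (@le_trans _ _ (\sum_(a <- iota 1 A) \sum_(d <- iota 2 A | (d %| a)%N) (d%:R^-1 : R))%R).
  rewrite big_seq [leRHS]big_seq; apply: ler_sum => a; rewrite mem_iota => /andP[_ aA].
  rewrite big_filter.
  have aA' : (a <= A)%N by rewrite -ltnS -add1n.
  rewrite -(subnKC aA') iotaD big_cat /= lerDl sumr_ge0// => d _.
rewrite (exchange_big_dep predT)//=.
apply: (@le_trans _ _ (\sum_(d <- iota 2 A) (A%:R * (d%:R ^- 2 : R)))%R).
  rewrite big_seq [leRHS]big_seq; apply: ler_sum => d; rewrite mem_iota => /andP[d2 _].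
  have d0 : (0 < d%:R :> R)%R by rewrite ltr0n (leq_trans _ d2).
  rewrite -big_filter big_const_seq count_predT iter_addr addr0 -[leLHS]mulr_natr mulrC.
  rewrite ?mulr1 expr2 invfM mulrA ler_pM2r ?invr_gt0// ler_pdivlMr// -natrM ler_nat.
  rewrite size_filter.
  have -> : count (dvdn d) (iota 1 A) = (A %/ d)%N.
    elim: A => [|A ih]; first by rewrite div0n.
    by rewrite -[A.+1]addn1 iotaD count_cat ih /= addn0 add1n addn1 divnS ?(leq_trans _ d2)// addnC.
  exact: leq_trunc_div.
rewrite -mulr_sumr mulrC ler_wpM2r//; exact: harmonic_square_sum.
Qed.

(** For each last coordinate [a], [coprime_first_moment] gives [2 * b K] minus the contribution of
    the divisors of [a]; by [divisor_sum] at least a quarter survives on average. The rows above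
    contribute by [box_first_moment]. *)
Lemma Ncount_first_moment b : (forall r, (0 <= b r)%R) -> (1 <= b K.+1)%R ->
  (4^-1 * \prod_(r < K.+2) b r)%:E <= it_int l (Ncount b) x.
Proof.
move=> b0 b1; set A := Num.truncn (b K.+1).
pose C a z := zsum (fun m => Crow b a m z).
pose Ca a v := zsum (fun m => if coprime `|m|%N a then box (b K) (m%:~R + v * a%:R)%R else 0).
have mbx (m : int) (r : R) : measurable_fun setT (fun v : R => box (b K) (m%:~R + v * r)%R).
  by apply: (measurableT_comp (measurable_box _)); apply: measurable_funD => //; exact: measurable_funM.
have Ca0 a v : 0 <= Ca a v by apply: zsum_ge0 => m; case: ifP => // _; exact: box_ge0.
have mCa a : measurable_fun setT (Ca a).
  apply: measurable_zsum => [m|v m]; first by case: (coprime _ _).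
  by case: ifP => // _; exact: box_ge0.
have CE a : it_int l (C a) x = \int[lam]_v Ca a v.
  rewrite -it_int_top//; apply: eq_it_int => z; apply: eq_zsum => m.
  by rewrite /Crow tl_top.
have C0 a : 0 <= it_int l (C a) x by rewrite CE; exact: integral_ge0.
have sumC : (b K * A%:R / 2)%:E <= \sum_(a <- iota 1 A) it_int l (C a) x.
  have : \sum_(a <- iota 1 A) (2 * b K)%:E <= \sum_(a <- iota 1 A) (it_int l (C a) x +
     \sum_(d <- [seq d <- iota 2 a | (d %| a)%N]) (2 * b K / d%:R)%:E).
    rewrite big_seq [leRHS]big_seq; apply: lee_sum => a; rewrite mem_iota => /andP[a1 _].
    by rewrite CE; exact: coprime_first_moment.
  rewrite big_split /= sumEFin big_const_seq count_predT size_iota iter_addr addr0.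
  under [X in _ <= _ + X]eq_bigr do rewrite sumEFin -mulr_sumr.
  rewrite sumEFin -mulr_sumr => h.
  have ds := divisor_sum A.
  have : (2 * b K *+ A)%:E <= \sum_(a <- iota 1 A) it_int l (C a) x + (2 * b K * (3 / 4 * A%:R))%:E.
    by apply: le_trans h _; rewrite leeD2l// lee_fin ler_wpM2l// mulr_ge0.
  move: (\sum_(a <- iota 1 A) it_int l (C a) x) => S; case: S => [s| |].
  - by rewrite -EFinD !lee_fin -mulr_natr => ?; lra.
  - by move=> _; rewrite leey.
  - by [].
have mUK q : measurable_fun setT (Ubox K.+2 b K q) by exact: measurable_Ubox.
have mC a m : measurable_fun setT (Crow b a m) by exact: measurable_Crow.
rewrite /Ncount it_int_bigsum; last 2 first.
- move=> a; apply: measurable_zsum => [m|z m]; first exact: emeasurable_funM.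
  by rewrite mule_ge0 ?Crow_ge0 ?Ubox_ge0.
- by move=> a z; apply: zsum_ge0 => m; rewrite mule_ge0 ?Crow_ge0 ?Ubox_ge0.
have KK : (K <= K.+1 < K.+2)%N by rewrite leqnSn ltnSn.
pose p := (\prod_(r < K) (2 * b r))%R.
have p0 : (0 <= p)%R by apply: prodr_ge0 => r _; rewrite mulr_ge0.
have -> : \sum_(a <- iota 1 A) it_int l (fun z => zsum (fun m =>
     Crow b a m z * Ubox K.+2 b K (setq (q_top a) K m) z)) x =
   p%:E * \sum_(a <- iota 1 A) it_int l (C a) x.
  rewrite ge0_sume_distrr//; rewrite big_seq [RHS]big_seq; apply: eq_bigr => a.
  rewrite mem_iota => /andP[a1 _].
  rewrite (@it_int_zsum R l (fun m z => Crow b a m z * Ubox K.+2 b K (setq (q_top a) K m) z) x); last 2 first.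
  - by move=> m; exact: emeasurable_funM.
  - by move=> m z; rewrite mule_ge0 ?Crow_ge0 ?Ubox_ge0.
  rewrite (@it_int_zsum R l (fun m z => Crow b a m z) x)//; last by move=> *; exact: Crow_ge0.
  rewrite -zsumZl ?lee_fin//; last by move=> m; apply: it_int_ge0 => z; exact: Crow_ge0.
  apply: eq_zsum => m.
  apply: (box_first_moment x uniq_l upper_l b0 KK) => //.
  - by rewrite setq_neq ?gtn_eqF// /q_top setqE eqz_nat -lt0n.
  - by move=> z; exact: Crow_ge0.
  - exact: indep_Crow.
apply: (@le_trans _ _ (p%:E * (b K * A%:R / 2)%:E)); last by rewrite lee_wpmul2l ?lee_fin.
rewrite -EFinM lee_fin 2!big_ord_recr /= -/p.
have -> : p = (2 ^+ K * \prod_(r < K) b r)%R.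
  by rewrite /p big_split /= prodr_const card_ord.
have /andP[_ bA] := Num.Theory.truncn_itv (b0 K.+1).
have A1 : (1 <= A%:R :> R)%R by rewrite ler1n /A truncn_ge_nat.
have pb : (0 <= \prod_(r < K) b r)%R by apply: prodr_ge0.
(* The number [A] of admissible last coordinates is an integer part; as [b K.+1 >= 1], rounding
   loses at most a factor 2. *)
have bA2 : (b K.+1 <= 2 * A%:R)%R by apply: le_trans (ltW bA) _; rewrite -natr1 -/A; lra.
have t1 : (1 <= 2 ^+ K :> R)%R by apply: exprn_ege1; lra.
have bK0 := b0 K.
set P := (\prod_(r < K) b r)%R in pb *.
have PK : (0 <= P * b K)%R by rewrite mulr_ge0.
apply: (@le_trans _ _ (P * b K * (A%:R / 2)))%R.
  rewrite mulrCA ler_wpM2l//; lra.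
rewrite (_ : 2 ^+ K * P * (b K * A%:R / 2) = 2 ^+ K * (P * b K * (A%:R / 2)))%R; last by ring.
by rewrite ler_peMl// mulr_ge0// divr_ge0.
Qed.

(** A fraction has only one representation in lowest terms with positive denominator. *)
Lemma coprime_proportional (m m' : int) (a b : nat) : (0 < a)%N -> (0 < b)%N ->
  coprime `|m|%N a -> coprime `|m'|%N b -> (m * b%:Z = m' * a%:Z)%R ->
  a = b /\ m = m'.
Proof.
move=> a0 b0 ca cb e.
have ab : a = b.
  apply/eqP; rewrite eqn_dvd; apply/andP; split.
    rewrite -(@Gauss_dvdr _ `|m|%N) 1?coprime_sym//.
    by rewrite -[(_ * b)%N]/(`|m| * `|b%:Z|)%N -abszM e abszM dvdn_mull.
  rewrite -(@Gauss_dvdr _ `|m'|%N) 1?coprime_sym//.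
  by rewrite -[(_ * a)%N]/(`|m'| * `|a%:Z|)%N -abszM -e abszM dvdn_mull.
split => //; move: e; rewrite ab; apply: mulIf.
by rewrite eqz_nat -lt0n.
Qed.

Lemma diagonal_count (r r' : seq nat) : uniq r' ->
  (\sum_(a <- r) \sum_(b <- r') ((a == b)%:R : R) <= (size r)%:R)%R.
Proof.
move=> ur; rewrite -sum1_size natr_sum; apply: ler_sum => a _.
rewrite -natr_sum ler_nat.
have -> : (\sum_(b <- r') (a == b :> nat))%N = count_mem a r'.
  rewrite -sum1_count [RHS]big_mkcond /=; apply: eq_bigr => b _.
  by rewrite eq_sym /=; case: (b == a).
by rewrite count_uniq_mem// leq_b1.
Qed.

Section pair_moment.
Variables (al be : nat -> R) (a b : nat).
Hypothesis al0 : forall r, (0 <= al r)%R.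
Hypothesis be0 : forall r, (0 <= be r)%R.
Hypothesis a0 : (0 < a)%N.
Hypothesis b0 : (0 < b)%N.

Let CC m m' z := Crow al a m z * Crow be b m' z.
Let TT m m' z := CC m m' z *
  Vbox K.+2 al be K (setq (q_top a) K m) (setq (q_top b) K m') z.

Let CC0 m m' z : 0 <= CC m m' z. Proof. by rewrite mule_ge0 ?Crow_ge0. Qed.

Let mCC m m' : measurable_fun setT (CC m m').
Proof. by apply: emeasurable_funM; exact: measurable_Crow. Qed.

Let iCC m m' : indep K (CC m m').
Proof. by apply: indepM; exact: indep_Crow. Qed.

Let TT0 m m' z : 0 <= TT m m' z. Proof. by rewrite mule_ge0 ?Vbox_ge0. Qed.

Let mTT m m' : measurable_fun setT (TT m m').
Proof. by apply: emeasurable_funM => //; exact: measurable_Vbox. Qed.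

Let Crow_le (c : nat -> R) d m (z : cspace) :
  Crow c d m z <= box (c K) (m%:~R + z (K, K.+1) * d%:R)%R.
Proof. by rewrite /Crow tl_top; case: ifP => // _; exact: box_ge0. Qed.

Let KK : (K <= K.+1 < K.+2)%N. Proof. by rewrite leqnSn ltnSn. Qed.
Let KK' : (K <= K < K.+2)%N. Proof. by rewrite leqnn ltnW. Qed.

Let p := (\prod_(r < K) (2 * al r * (2 * be r)))%R.

(** When the last two coordinates are not proportional, the rows above row [K] factor by
    [box_second_moment_nonproportional]. In row [K] only the entry [(K, K.+1)] occurs, and
    [pair_count] bounds the number of pairs. *)
Lemma nonproportional_moment :
  it_int l (fun z => zsum (fun m => zsum (fun m' =>
     if (m * b%:Z == m' * a%:Z)%R then 0 else TT m m' z))) x <=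
  (p * (8 * al K * be K))%:E.
Proof.
have p0 : (0 <= p)%R by apply: prodr_ge0 => r _; rewrite !mulr_ge0.
have t0 m m' z : 0 <= if (m * b%:Z == m' * a%:Z)%R then 0 else TT m m' z.
  by case: ifP.
have mt m m' : measurable_fun setT (fun z => if (m * b%:Z == m' * a%:Z)%R then 0 else TT m m' z).
  by case: (_ == _).
pose P (v : R) := zsum (fun m => zsum (fun m' =>
    if (m * b%:Z == m' * a%:Z)%R then 0
    else box (al K) (m%:~R + v * a%:R)%R * box (be K) (m'%:~R + v * b%:R)%R)).
have mbx (c : R) (m : int) (r : R) : measurable_fun setT (fun v : R => box c (m%:~R + v * r)%R).
  by apply: (measurableT_comp (measurable_box _)); apply: measurable_funD => //; exact: measurable_funM.
have b0' m m' (v : R) : 0 <= if (m * b%:Z == m' * a%:Z)%R then 0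
    else box (al K) (m%:~R + v * a%:R)%R * box (be K) (m'%:~R + v * b%:R)%R.
  by case: ifP => // _; rewrite mule_ge0// box_ge0.
have mb' m m' : measurable_fun setT (fun v : R => if (m * b%:Z == m' * a%:Z)%R then 0
    else box (al K) (m%:~R + v * a%:R)%R * box (be K) (m'%:~R + v * b%:R)%R).
  by case: (_ == _) => //; exact: emeasurable_funM.
have P0 v : 0 <= P v by apply: zsum_ge0 => m; exact: zsum_ge0.
have mP : measurable_fun setT P.
  by apply: measurable_zsum => [m|v m]; [exact: measurable_zsum|exact: zsum_ge0].
pose c m m' z := if (m * b%:Z == m' * a%:Z)%R then 0 else CC m m' z.
have c0 m m' z : 0 <= c m m' z by rewrite /c; case: ifP.
have mc m m' : measurable_fun setT (c m m') by rewrite /c; case: (_ == _).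
have -> : it_int l (fun z => zsum (fun m => zsum (fun m' =>
     if (m * b%:Z == m' * a%:Z)%R then 0 else TT m m' z))) x =
   p%:E * it_int l (fun z => zsum (fun m => zsum (fun m' => c m m' z))) x.
  rewrite (@it_int_zsum R l (fun m z => zsum (fun m' =>
     if (m * b%:Z == m' * a%:Z)%R then 0 else TT m m' z)) x); last 2 first.
  - by move=> m; exact: measurable_zsum.
  - by move=> m z; exact: zsum_ge0.
  rewrite (@it_int_zsum R l (fun m z => zsum (fun m' => c m m' z)) x); last 2 first.
  - by move=> m; exact: measurable_zsum.
  - by move=> m z; exact: zsum_ge0.
  rewrite -zsumZl ?lee_fin//; last by move=> m; apply: it_int_ge0 => z; exact: zsum_ge0.
  apply: eq_zsum => m.
  rewrite (@it_int_zsum R l (fun m' z =>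
     if (m * b%:Z == m' * a%:Z)%R then 0 else TT m m' z) x)//.
  rewrite (@it_int_zsum R l (fun m' z => c m m' z) x)//.
  rewrite -zsumZl ?lee_fin//; last by move=> m'; exact: it_int_ge0.
  apply: eq_zsum => m'; rewrite /c; case: eqVneq => [_|ne].
    by rewrite it_int_cst mule0.
  apply: (box_second_moment_nonproportional x uniq_l upper_l al0 be0 KK' KK) => //.
  by rewrite !setqE !setq_neq ?gtn_eqF// /q_top !setqE [X in _ != X]mulrC.
rewrite EFinM lee_wpmul2l ?lee_fin//.
apply: le_trans (pair_count a0 b0 (al0 K) (be0 K)).
rewrite -(it_int_top mP P0); apply: le_it_int.
- by apply: measurable_zsum => [m|v m]; [exact: measurable_zsum|exact: zsum_ge0].
- exact: (measurableT_comp mP (measurable_coord _)).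
- by move=> z; apply: zsum_ge0 => m; exact: zsum_ge0.
move=> z; apply: le_zsum => m; first exact: zsum_ge0.
apply: le_zsum => m' //; rewrite /c; case: ifP => // _.
by apply: lee_pmul; rewrite ?Crow_ge0 ?Crow_le.
Qed.

(** Coprimality forces proportional last coordinates to be equal, so only pairs with a common tail
    remain and [box_second_moment_equal] applies. *)
Lemma proportional_moment :
  it_int l (fun z => zsum (fun m => zsum (fun m' =>
     if (m * b%:Z == m' * a%:Z)%R then TT m m' z else 0))) x <=
  ((a == b)%:R * (Bbox al be K * (2 * Num.min (al K) (be K))))%:E.
Proof.
have TE m m' z : (if (m * b%:Z == m' * a%:Z)%R then TT m m' z else 0) =
    if (a == b) && (m' == m) then TT m m' z else 0.
  case: ifPn => [/eqP mm|mm]; last first.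
    by case: ifP => // /andP[/eqP ab /eqP m'm]; rewrite ab m'm eqxx in mm.
  case: ifPn => // nn; rewrite /TT /CC /Crow.
  case: ifP => ca; last by rewrite !mul0e.
  case: ifP => cb; last by rewrite mule0 mul0e.
  have [ab em] := coprime_proportional a0 b0 ca cb mm.
  by rewrite ab em !eqxx in nn.
under eq_it_int do under eq_zsum do under eq_zsum do rewrite TE.
have [ab|ab] := eqVneq a b; last first.
  rewrite mul0r (_ : (fun z => _) = fun _ => 0) ?it_int_cst//; apply/funext => z.
  by apply: eseries0 => e _ _; exact: eseries0.
rewrite mul1r.
have -> : it_int l (fun z => zsum (fun m => zsum (fun m' =>
    if true && (m' == m) then TT m m' z else 0))) x =
    it_int l (fun z => zsum (fun m => TT m m z)) x.
  apply: eq_it_int => z; apply: eq_zsum => m.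
  rewrite (zsum_single (m0 := m)) ?eqxx// => m'; first by case: ifP.
  by move=> /negbTE ->.
have B0 : (0 <= Bbox al be K)%R.
  by apply: Bbound_ge0 => r; rewrite mulr_ge0// le_min al0 be0.
rewrite (@it_int_zsum R l (fun m z => TT m m z) x)//.
apply: (@le_trans _ _ (zsum (fun m => (Bbox al be K)%:E * it_int l (CC m m) x))).
  apply: le_zsum => m; first exact: it_int_ge0.
  rewrite /TT -ab.
  apply: (box_second_moment_equal x uniq_l upper_l al0 be0 KK) => //.
  by rewrite setq_neq ?gtn_eqF// /q_top setqE eqz_nat -lt0n.
rewrite zsumZl ?lee_fin//; last by move=> m; exact: it_int_ge0.
rewrite EFinM lee_wpmul2l ?lee_fin//.
rewrite -(@it_int_zsum R l (fun m z => CC m m z) x)//.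
pose Q (v : R) := zsum (fun m => box (al K) (m%:~R + v)%R * box (be K) (m%:~R + v)%R).
have m2 : measurable_fun setT (fun y : R => box (al K) y * box (be K) y).
  by apply: emeasurable_funM; exact: measurable_box.
have p2 y : 0 <= box (al K) y * box (be K) y by rewrite mule_ge0 ?box_ge0.
have mQ : measurable_fun setT Q by exact: (measurable_zsum_shift m2 p2).
have Q0 v : 0 <= Q v by apply: zsum_ge0 => m.
have Q1 v : Q (v + 1)%R = Q v by exact: (zsum_shift_periodic v p2).
rewrite -(integral_box_mul (al0 K) (be0 K)) -(unfold_unif01 m2 p2).
have az : a%:Z != 0%R by rewrite eqz_nat -lt0n.
rewrite -(periodic_equidistribution 0%R mQ Q0 Q1 az).
have mQa : measurable_fun setT (fun v : R => Q (0 + v * a%:Z%:~R)%R).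
  by apply: (measurableT_comp mQ); apply: measurable_funD => //; exact: measurable_funM.
rewrite -(it_int_top mQa)//; apply: le_it_int.
- by apply: measurable_zsum.
- exact: (measurableT_comp mQa (measurable_coord _)).
- by move=> z; apply: zsum_ge0 => m.
move=> z; apply: le_zsum => m //; rewrite add0r /CC -ab -pmulrn.
by apply: lee_pmul; rewrite ?Crow_ge0 ?Crow_le.
Qed.

Lemma pair_moment :
  it_int l (fun z => zsum (fun m => zsum (fun m' => TT m m' z))) x <=
  (p * (8 * al K * be K) + (a == b)%:R * (Bbox al be K * (2 * Num.min (al K) (be K))))%:E.
Proof.
rewrite EFinD; apply: le_trans (leeD nonproportional_moment proportional_moment).
rewrite -it_intD; last 4 first.
- apply: measurable_zsum => [m|z m]; [apply: measurable_zsum => [m'|z m']|apply: zsum_ge0 => m'].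
  + by case: (_ == _).
  + by case: (_ == _).
  + by case: (_ == _).
- apply: measurable_zsum => [m|z m]; [apply: measurable_zsum => [m'|z m']|apply: zsum_ge0 => m'].
  + by case: (_ == _).
  + by case: (_ == _).
  + by case: (_ == _).
- by move=> z; apply: zsum_ge0 => m; apply: zsum_ge0 => m'; case: (_ == _).
- by move=> z; apply: zsum_ge0 => m; apply: zsum_ge0 => m'; case: (_ == _).
rewrite le_eqVlt; apply/orP; left; apply/eqP; apply: eq_it_int => z.
rewrite -zsumD; last 2 first.
- by move=> m; apply: zsum_ge0 => m'; case: (_ == _).
- by move=> m; apply: zsum_ge0 => m'; case: (_ == _).
apply: eq_zsum => m; rewrite -zsumD; last 2 first.
- by move=> m'; case: (_ == _).
- by move=> m'; case: (_ == _).
by apply: eq_zsum => m'; case: (_ == _); rewrite ?adde0 ?add0e.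
Qed.

End pair_moment.

(** The first summand collects all pairs of last coordinates, at most [al K.+1 * be K.+1] of them.
    The second arises from equal last coordinates only, whose number is bounded by the smaller of
    the two sides. *)
Lemma Ncount_second_moment (al be : nat -> R) :
  (forall r, (0 <= al r)%R) -> (forall r, (0 <= be r)%R) ->
  it_int l (fun z => Ncount al z * Ncount be z) x <=
  ((\prod_(r < K) (2 * al r * (2 * be r))) * (8 * al K * be K) * (al K.+1 * be K.+1) +
   Bbox al be K * (2 * Num.min (al K) (be K)) * Num.min (al K.+1) (be K.+1))%:E.
Proof.
move=> al0 be0.
set A := iota 1 (Num.truncn (al K.+1)); set B := iota 1 (Num.truncn (be K.+1)).
set p := (\prod_(r < K) _)%R.
have p0 : (0 <= p)%R by apply: prodr_ge0 => r _; rewrite !mulr_ge0.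
pose TT a b m m' z := (Crow al a m z * Crow be b m' z) *
  Vbox K.+2 al be K (setq (q_top a) K m) (setq (q_top b) K m') z.
pose W a b z := zsum (fun m => zsum (fun m' => TT a b m m' z)).
have TT0 a b m m' z : 0 <= TT a b m m' z by rewrite !mule_ge0 ?Crow_ge0 ?Vbox_ge0.
have mTT a b m m' : measurable_fun setT (TT a b m m').
  apply: emeasurable_funM; last exact: measurable_Vbox.
  by apply: emeasurable_funM; exact: measurable_Crow.
have W0 a b z : 0 <= W a b z by apply: zsum_ge0 => m; exact: zsum_ge0.
have mW a b : measurable_fun setT (W a b).
  by apply: measurable_zsum => [m|z m]; [exact: measurable_zsum|exact: zsum_ge0].
have -> : it_int l (fun z => Ncount al z * Ncount be z) x =
          \sum_(a <- A) \sum_(b <- B) it_int l (W a b) x.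
  rewrite -[RHS](_ : it_int l (fun z => \sum_(a <- A) \sum_(b <- B) W a b z) x = _); last first.
    rewrite (@it_int_bigsum R _ A l (fun a z => \sum_(b <- B) W a b z) x); last 2 first.
    - by move=> a; exact: emeasurable_sum.
    - by move=> a z; exact: sume_ge0.
    by apply: eq_bigr => a _; rewrite (@it_int_bigsum R _ B l (fun b z => W a b z) x).
  apply: eq_it_int => z; rewrite /Ncount -/A -/B.
  have g0 (c : nat -> R) a m : 0 <= Crow c a m z * Ubox K.+2 c K (setq (q_top a) K m) z.
    by rewrite mule_ge0 ?Crow_ge0 ?Ubox_ge0.
  rewrite ge0_sume_distrl; last by move=> a _; exact: zsum_ge0.
  apply: eq_bigr => a _; rewrite ge0_sume_distrr; last by move=> b _; exact: zsum_ge0.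
  apply: eq_bigr => b _; rewrite zsum_mul//; apply: eq_zsum => m; apply: eq_zsum => m'.
  by rewrite /TT -Ubox_mul muleACA.
set Y := (Bbox al be K * (2 * Num.min (al K) (be K)))%R.
have Y0 : (0 <= Y)%R.
  rewrite mulr_ge0//; last by rewrite mulr_ge0// le_min al0 be0.
  by apply: Bbound_ge0 => r; rewrite mulr_ge0// le_min al0 be0.
apply: (@le_trans _ _ (\sum_(a <- A) \sum_(b <- B)
    (p * (8 * al K * be K) + (a == b)%:R * Y)%:E)).
  rewrite big_seq [leRHS]big_seq; apply: lee_sum => a; rewrite mem_iota => /andP[a1 _].
  rewrite big_seq [leRHS]big_seq; apply: lee_sum => b; rewrite mem_iota => /andP[b1 _].
  exact: pair_moment.
under eq_bigr do rewrite sumEFin.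
rewrite sumEFin lee_fin.
under eq_bigr do rewrite big_split /= big_const_seq count_predT iter_addr addr0 -mulr_suml.
rewrite big_split /= big_const_seq count_predT iter_addr addr0 -mulr_suml !size_iota.
have tr (c : R) : (0 <= c)%R -> ((Num.truncn c)%:R <= c)%R.
  by move=> c0; have /andP[] := Num.Theory.truncn_itv c0.
apply: lerD.
  rewrite -mulrnA -[leLHS]mulr_natr natrM; apply: ler_wpM2l; first by rewrite !mulr_ge0.
  by rewrite mulrC; apply: ler_pM => //; exact: tr.
rewrite mulrC ler_wpM2l// le_min; apply/andP; split.
  apply: le_trans (diagonal_count _ _) _; rewrite ?iota_uniq// size_iota; exact: tr.
rewrite exchange_big /=.
under eq_bigr do under eq_bigr do rewrite eq_sym.
apply: le_trans (diagonal_count _ _) _; rewrite ?iota_uniq// size_iota; exact: tr.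
Qed.

End coprime_count.

(** * Borel-Cantelli and second moment inequalities *)

Section borel_cantelli.
Context {R : realType}.
Local Notation cspace := (@cspace R).
Local Open Scope ereal_scope.

Lemma AE_forall l (Q : nat -> cspace -> Prop) x : (forall n, AE l (Q n) x) ->
  AE l (fun z => forall n, Q n z) x.
Proof.
elim: l x => [|c l ih] x //= h.
have := negligible_bigcup h; apply: negligibleS => y /= ny.
apply: contrapT => hn; apply: ny; apply: ih => n; apply: contrapT => nq.
by apply: hn; exists n.
Qed.

(** The indicator of the limsup set is dominated by every tail of the series of indicators, and the
    tails of a convergent series tend to zero. *)
Lemma AE_borel_cantelli l (A : nat -> set cspace) x : (forall t, measurable (A t)) ->
  \sum_(t <oo) it_int l (fun z => (\1_(A t) z)%:E) x < +oo ->
  AE l (fun z => exists N, forall t, (N <= t)%N -> ~ A t z) x.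
Proof.
move=> mA fin.
pose L := \bigcap_N \bigcup_t A (t + N)%N.
have mL : measurable L.
  by apply: bigcapT_measurable => N; exact: bigcupT_measurable.
have m1 (B : set cspace) : measurable B -> measurable_fun setT (fun z => (\1_B z)%:E : \bar R).
  by move=> mB; apply/measurable_EFinP; exact: measurable_indic.
have p1 (B : set cspace) z : 0 <= (\1_B z)%:E :> \bar R by rewrite lee_fin.
apply: (@AE_imp _ _ (fun z => ~ L z)) => [z nL|].
  apply: contrapT => h; apply: nL => N _; apply: contrapT => h'; apply: h; exists N.
  by move=> t Nt At; apply: h'; exists (t - N)%N => //; rewrite subnK.
apply/(AE_it_int l x mL).
pose u t := it_int l (fun z => (\1_(A t) z)%:E) x.
have u0 t : 0 <= u t by exact: it_int_ge0.
have le N : it_int l (fun z => (\1_L z)%:E) x <= \sum_(N <= t <oo) u t.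
  rewrite -nneseries_addn//.
  rewrite -(@it_int_nneseries R l (fun n z => (\1_(A (n + N)%N) z)%:E) x); last 2 first.
  - by move=> n; exact: m1.
  - by move=> n z; exact: p1.
  apply: le_it_int; [exact: m1| |exact: p1|].
    by apply: ge0_emeasurable_sum => // n *; exact: m1.
  move=> z; rewrite indicE; have [Lz|_] := boolP (z \in L); last first.
    by apply: nneseries_ge0 => n *; exact: p1.
  have [t _ At] := (set_mem Lz) N I.
  apply: (@le_trans _ _ (\sum_(0 <= n < t.+1) (\1_(A (n + N)%N) z)%:E)).
    by rewrite big_nat_recr//= indicE mem_set// lee_paddl// sume_ge0.
  by apply: nneseries_lim_ge => n *; exact: p1.
have c0 := nneseries_tail_cvg fin (fun k _ => u0 k).
apply/eqP; rewrite eq_le it_int_ge0 ?andbT//.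
rewrite -(cvg_lim _ c0)//; apply: lime_ge; first by apply/cvg_ex; exists 0.
by apply: nearW => N; exact: le.
Qed.

(** In place of the Cauchy-Schwarz inequality, the pointwise bound
    [N <= th / 2 * N ^ 2 + 1_A / (2 * th)] is integrated with the optimal [th = e / v]; it remains
    meaningful where [N] is infinite. *)
Lemma paley_zygmund l (N : cspace -> \bar R) x (e v : R) : measurable_fun setT N ->
  (forall z, 0 <= N z) -> (0 < e)%R -> (0 < v)%R -> e%:E <= it_int l N x ->
  it_int l (fun z => N z * N z) x <= v%:E ->
  (e ^+ 2 / v)%:E <= it_int l (fun z => (\1_[set z | N z != 0] z)%:E) x.
Proof.
move=> mN N0 e0 v0 eN Nv.
set A := [set z | N z != 0].
have mA : measurable A.
  have := mN measurableT (~` [set 0]) (measurableC (emeasurable_set1 0)).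
  by rewrite setTI; congr measurable; apply/seteqP; split => y /= /eqP.
have mA1 : measurable_fun setT (fun z => (\1_A z)%:E : \bar R).
  by apply/measurable_EFinP; exact: measurable_indic.
have A0 z : 0 <= (\1_A z)%:E :> \bar R by rewrite lee_fin.
pose th := (e / v)%R.
have th0 : (0 < th)%R by rewrite divr_gt0.
have N20 z : 0 <= N z * N z by rewrite mule_ge0.
have mN2 : measurable_fun setT (fun z => N z * N z) by exact: emeasurable_funM.
have a0 : 0 <= (th / 2)%:E by rewrite lee_fin divr_ge0// ltW.
have b0 : 0 <= ((2 * th)^-1)%:E by rewrite lee_fin invr_ge0 mulr_ge0// ltW.
have : it_int l N x <= it_int l (fun z => (th / 2)%:E * (N z * N z) + ((2 * th)^-1)%:E * (\1_A z)%:E) x.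
  apply: le_it_int => //.
    by apply: emeasurable_funD; exact: emeasurable_funM.
  move=> z; rewrite indicE.
  have [Az|Az] := boolP (z \in A); last first.
    have -> : N z = 0 by apply/eqP/negPn/negP => Nz; move: Az; rewrite mem_set.
    by rewrite !mule0 adde0.
  rewrite mule1; move: (N0 z); case: (N z) => [u| |] u0.
  - rewrite -!EFinM -EFinD lee_fin.
    have -> : (th / 2 * (u * u) + (2 * th)^-1 = u + (th * u - 1) ^+ 2 / (2 * th))%R.
      by field; rewrite gt_eqF.
    by rewrite lerDl divr_ge0 ?sqr_ge0// mulr_ge0// ltW.
  - by rewrite mulyy gt0_muley ?lte_fin ?divr_gt0// addye// leey.
  - by [].
rewrite it_intD; last 4 first.
- exact: emeasurable_funM.
- exact: emeasurable_funM.
- by move=> z; rewrite mule_ge0.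
- by move=> z; rewrite mule_ge0.
rewrite (it_intZl _ _ mN2)// (it_intZl _ _ mA1)// => h.
have {h} : e%:E <= (th / 2 * v)%:E + ((2 * th)^-1)%:E * it_int l (fun z => (\1_A z)%:E) x.
  apply: le_trans eN _; apply: le_trans h _.
  by rewrite [X in _ <= X + _]EFinM leeD2r// lee_wpmul2l.
have : 0 <= it_int l (fun z => (\1_A z)%:E) x by exact: it_int_ge0.
case: (it_int l (fun z => (\1_A z)%:E) x) => [p| |] // p0; last by rewrite leey.
rewrite -EFinM -EFinD !lee_fin.
have -> : (th / 2 * v = e / 2)%R by rewrite /th; field; rewrite gt_eqF.
move=> h; have {}h : (e / 2 <= (2 * th)^-1 * p)%R by lra.
have : (2 * th * (e / 2) <= p)%R.
  apply: le_trans (ler_wpM2l _ h) _; first by rewrite mulr_ge0// ltW.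
  by rewrite mulrA mulfV ?mul1r// mulf_neq0// gt_eqF.
by congr (_ <= _)%R; rewrite /th; field; rewrite gt_eqF.
Qed.

End borel_cantelli.

Section miss_eventually.
Context {R : realType}.
Local Notation cspace := (@cspace R).
Local Open Scope ereal_scope.
Variables (k : nat) (l : seq coord) (x : cspace).
Hypothesis uniq_l : uniq l.
Hypothesis upper_l : forall i j, (i < j)%N -> (j < k.+1)%N -> (i, j) \in l.

(** If all shorter products of sides are at most 1, [miss_probability] is at most [k] divided by the
    full product, which is summable in [t]. *)
Lemma AE_hit_eventually (b : nat -> nat -> R) : (forall t r, (0 < b t r)%R) ->
  (forall t j, (j < k)%N -> (\prod_(r < j) (2 * b t r) <= 1)%R) ->
  \sum_(t <oo) ((\prod_(r < k) (2 * b t r))^-1)%:E < +oo ->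
  AE l (fun z => exists N, forall t, (N <= t)%N -> exists q : nat -> int,
    q k = 1%R /\ forall r, (r < k)%N -> (`|(q r)%:~R + tl k.+1 r q z| <= b t r)%R) x.
Proof.
move=> b0 b1 fin.
pose A t := [set z | Ubox k.+1 (b t) k (q_one k) z = 0].
have mA t : measurable (A t).
  have mU := @measurable_Ubox R k.+1 (b t) k (q_one k).
  by have := mU measurableT [set 0] (emeasurable_set1 0); rewrite setTI.
have p0 t : (0 < \prod_(r < k) (2 * b t r))%R by apply: prodr_gt0 => r _; rewrite mulr_gt0.
have AEA : AE l (fun z => exists N, forall t, (N <= t)%N -> ~ A t z) x.
  apply: AE_borel_cantelli => //.
  apply: (@le_lt_trans _ _ (\sum_(t <oo) (k%:R%:E * ((\prod_(r < k) (2 * b t r))^-1)%:E))).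
    apply: lee_nneseries => [t _ _|t _].
      by apply: it_int_ge0 => z; rewrite lee_fin.
    apply: le_trans (miss_probability x uniq_l upper_l (b0 t)) _.
    have pi : (0 <= (\prod_(r < k) (2 * b t r))^-1)%R by rewrite invr_ge0 ltW.
    rewrite -EFinM lee_fin ler_wpM2r//.
    rewrite -[k%:R](_ : \sum_(j < k) 1 = _)%R; last by rewrite sumr_const card_ord.
    by apply: ler_sum => j _; exact: b1.
  rewrite nneseriesZl; last by move=> t _; rewrite lee_fin invr_ge0 ltW.
  rewrite lte_mul_pinfty ?lee_fin//.
apply: AE_imp AEA => z [N hN]; exists N => t Nt.
have /eqP/Ubox_hit[q [q1 q2]] := hN t Nt.
by exists q; split => //; rewrite q1// /q_one setqE.
Qed.

End miss_eventually.

(** * Infinitely many hits with positive probability *)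

Section hit_infinitely_often.
Context {R : realType}.
Local Notation cspace := (@cspace R).
Variables (K : nat) (l : seq coord) (x : cspace).
Hypothesis uniq_l : uniq l.
Hypothesis upper_l : forall i j, (i < j)%N -> (j < K.+2)%N -> (i, j) \in l.

(** Unrolling [Bbox] gives [i + 1] terms. Completed by the minima of the remaining sides, each is at
    most [4 ^ k * D], the power collecting the factors 2 from passing to side lengths. *)
Lemma Bbox_tail (al be : nat -> R) (D : R) (k i : nat) :
  (forall r, 0 <= al r) -> (forall r, 0 <= be r) -> (i <= k)%N ->
  (forall j, (j <= i)%N -> (\prod_(r < j) (al r * be r)) *
     \prod_(j <= r < k) Num.min (al r) (be r) <= D) ->
  Bbox al be i * \prod_(i <= r < k) (2 * Num.min (al r) (be r)) <= i.+1%:R * 4 ^+ k * D.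
Proof.
move=> al0 be0.
have m0 r : 0 <= Num.min (al r) (be r) by rewrite le_min al0 be0.
have pw (j : nat) : (j <= k)%N ->
    (\prod_(r < j) (2 * al r * (2 * be r))) * \prod_(j <= r < k) (2 * Num.min (al r) (be r)) <=
    4 ^+ k * ((\prod_(r < j) (al r * be r)) * \prod_(j <= r < k) Num.min (al r) (be r)).
  move=> jk.
  have -> : \prod_(r < j) (2 * al r * (2 * be r)) = 4 ^+ j * \prod_(r < j) (al r * be r).
    transitivity (\prod_(r < j) (4 * (al r * be r))); first by apply: eq_bigr => r _; ring.
    by rewrite big_split /= prodr_const card_ord.
  have -> : \prod_(j <= r < k) (2 * Num.min (al r) (be r)) =
            2 ^+ (k - j) * \prod_(j <= r < k) Num.min (al r) (be r).
    by rewrite big_split /= prodr_const_nat.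
  rewrite mulrACA; apply: ler_wpM2r.
    by rewrite mulr_ge0// prodr_ge0// => r _; rewrite mulr_ge0.
  rewrite -[in leRHS](subnKC jk) exprD ler_wpM2l ?exprn_ge0//.
  by apply: lerXn2r; rewrite ?nnegrE//; lra.
elim: i => [|i ih] ik H.
  rewrite /Bbox /= mul1r -mulrA mul1r.
  apply: le_trans (_ : 4 ^+ k * ((\prod_(r < 0) (al r * be r)) * \prod_(0 <= r < k) Num.min (al r) (be r)) <= _).
    by apply: le_trans (pw 0 isT); rewrite big_ord0 mul1r.
  by rewrite ler_wpM2l ?exprn_ge0// H.
have -> : Bbox al be i.+1 = 2 * Num.min (al i) (be i) * Bbox al be i +
    \prod_(r < i.+1) (2 * al r * (2 * be r)) by [].
have Zi : \prod_(i <= r < k) (2 * Num.min (al r) (be r)) =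
    2 * Num.min (al i) (be i) * \prod_(i.+1 <= r < k) (2 * Num.min (al r) (be r)).
  by rewrite big_ltn.
set P := \prod_(r < i.+1) _; set Z := \prod_(i.+1 <= r < k) _ in Zi *.
have -> : (2 * Num.min (al i) (be i) * Bbox al be i + P) * Z =
    Bbox al be i * (2 * Num.min (al i) (be i) * Z) + P * Z by ring.
rewrite -Zi.
apply: (@le_trans _ _ (i.+1%:R * 4 ^+ k * D + 4 ^+ k * D)).
  apply: lerD; first by apply: ih; [exact: ltnW|move=> j ji; apply: H; exact: leqW].
  apply: le_trans (pw _ ik) _; rewrite ler_wpM2l ?exprn_ge0//; exact: H.
by rewrite -[i.+2%:R]natr1 mulrDl mulrDl mul1r.
Qed.

(** With truncated subtraction the exponent is the distance between [s] and [t]. Multiplied by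
    [1 - w], the sum telescopes on either side of [s]. *)
Lemma two_sided_geometric (w : R) (s T : nat) : 0 <= w < 1 ->
  \sum_(t < T) w ^+ ((s - t) + (t - s)) <= 2 / (1 - w).
Proof.
move=> /andP[w0 w1].
have w1' : 0 < 1 - w by rewrite subr_gt0.
have wp n : w ^+ n <= 1 by apply: exprn_ile1 => //; exact: ltW.
have H1 U : (U <= s)%N -> (1 - w) * \sum_(t < U) w ^+ ((s - t) + (t - s)) <= w ^+ (s - U).+1.
  elim: U => [|U ih] Us; first by rewrite big_ord0 mulr0 exprn_ge0.
  rewrite big_ord_recr /= mulrDr; apply: le_trans (lerD (ih (ltnW Us)) (lexx _)) _.
  have -> : (U - s = 0)%N by apply/eqP; rewrite subn_eq0 ltnW.
  rewrite addn0 -subnSK// [w ^+ (s - U.+1).+2]exprS; lra.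
have H2 U : (1 - w) * \sum_(t < s + U) w ^+ ((s - t) + (t - s)) <= 2 - w ^+ U.
  elim: U => [|U ih].
    rewrite addn0 expr0; apply: le_trans (H1 s (leqnn _)) _.
    by rewrite subnn expr1; lra.
  rewrite addnS big_ord_recr /= mulrDr; apply: le_trans (lerD ih (lexx _)) _.
  have -> : (s - (s + U) = 0)%N by apply/eqP; rewrite subn_eq0 leq_addr.
  by rewrite add0n addKn exprS; lra.
rewrite ler_pdivlMr// mulrC.
have [Ts|sT] := leqP T s.
  by apply: le_trans (H1 T Ts) _; apply: le_trans (wp _) _; lra.
rewrite -(subnKC (ltnW sT)); apply: le_trans (H2 _) _.
by rewrite gerBl exprn_ge0.
Qed.

Variables (sg : nat -> R) (de : R).
Hypothesis de0 : 0 < de.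
Hypothesis sg_sum : \sum_(r < K.+2) sg r = 0.
Hypothesis sg_part : forall j, (0 < j < K.+2)%N -> \sum_(r < j) sg r <= - de.

Definition ebox (rr : nat -> R) (t r : nat) : R := expR (sg r * t%:R) * rr t.

Lemma ebox_prod rr t j : \prod_(r < j) ebox rr t r = expR ((\sum_(r < j) sg r) * t%:R) * rr t ^+ j.
Proof.
rewrite /ebox big_split /= prodr_const card_ord; congr (_ * _).
by rewrite mulr_suml expR_sum.
Qed.

Section moments.
Variable rr : nat -> R.
Hypothesis rr01 : forall t, 0 <= rr t <= 1.
Hypothesis rr_large : forall t, rr t = 0 \/ 1 <= ebox rr t K.+1.

Let rr0 t : 0 <= rr t. Proof. by have /andP[] := rr01 t. Qed.
Let rr1 t : rr t <= 1. Proof. by have /andP[] := rr01 t. Qed.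

Let rho t := rr t ^+ K.+2.
Let rho0 t : 0 <= rho t. Proof. by rewrite exprn_ge0. Qed.

Lemma ebox_ge0 t r : 0 <= ebox rr t r.
Proof. by rewrite mulr_ge0// expR_ge0. Qed.

Lemma ebox_prod_all t : \prod_(r < K.+2) ebox rr t r = rho t.
Proof. by rewrite ebox_prod sg_sum mul0r expR0 mul1r. Qed.

Let CC : R := K.+2%:R * 4 ^+ K.+2.

(** Quasi-independence in time. The boxes at times [s] and [t] have volumes governed by [rho s] and
    [rho t], but very different shapes, so vectors counted in both are rarer by a factor exponential
    in [t - s]. *)
Lemma cross_moment_le (s t : nat) : (s <= t)%N ->
  (it_int l (fun z => Ncount K (ebox rr s) z * Ncount K (ebox rr t) z) x <=
  (CC * (rho s * rho t + expR (- de) ^+ (t - s) * (rho s + rho t)))%:E)%E.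
Proof.
move=> st; apply: le_trans (Ncount_second_moment x uniq_l upper_l (ebox_ge0 s) (ebox_ge0 t)) _.
rewrite lee_fin mulrDr; apply: lerD.
  have -> : \prod_(r < K) (2 * ebox rr s r * (2 * ebox rr t r)) = 4 ^+ K *
      (\prod_(r < K) ebox rr s r * \prod_(r < K) ebox rr t r).
    transitivity (\prod_(r < K) (4 * (ebox rr s r * ebox rr t r))).
      by apply: eq_bigr => r _; ring.
    by rewrite !big_split /= prodr_const card_ord.
  rewrite -!ebox_prod_all !big_ord_recr /=.
  set a := \prod_(r < K) ebox rr s r; set b := \prod_(r < K) ebox rr t r.
  set a' := ebox rr s K; set a'' := ebox rr s K.+1.
  set b' := ebox rr t K; set b'' := ebox rr t K.+1.
  have ab : 0 <= a * a' * a'' * (b * b' * b'').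
    by rewrite !mulr_ge0 ?ebox_ge0// prodr_ge0// => r _; exact: ebox_ge0.
  rewrite [leLHS](_ : _ = (8 * 4 ^+ K) * (a * a' * a'' * (b * b' * b''))); last by ring.
  rewrite ler_wpM2r// /CC !exprS mulrA mulrA ler_wpM2r ?exprn_ge0//.
  have : 2 <= K.+2%:R :> R by rewrite ler_nat.
  by lra.
set D := expR (- de) ^+ (t - s) * (rho s + rho t).
have D0 : 0 <= D by rewrite mulr_ge0 ?addr_ge0// exprn_ge0 ?expR_ge0.
have mm r : 0 <= Num.min (ebox rr s r) (ebox rr t r) by rewrite le_min !ebox_ge0.
have ets : expR (- de) ^+ (t - s) = expR (- de * (t%:R - s%:R)).
  by rewrite -expRM_natr natrB.
(* For [j = 0] the first minimum is taken at time [t] and the others at time [s], which leaves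
   [exp (sg 0 * (t - s))]. For [j > 0] all minima are taken at time [s], where they complete the
   product to [rho s], and the first [j] sides at time [t] supply the factor [exp (- de * t)]. *)
have Tj j : (j <= K)%N -> (\prod_(r < j) (ebox rr s r * ebox rr t r)) *
     \prod_(j <= r < K.+2) Num.min (ebox rr s r) (ebox rr t r) <= D.
  case: j => [|j] jK.
    rewrite big_ord0 mul1r big_ltn//.
    apply: (@le_trans _ _ (ebox rr t 0 * \prod_(1 <= r < K.+2) ebox rr s r)).
      apply: ler_pM => //; first by apply: prodr_ge0.
        by rewrite ge_min lexx orbT.
      by apply: ler_prod => r _; rewrite mm ge_min lexx.
    have -> : \prod_(1 <= r < K.+2) ebox rr s r = expR (- sg 0%N * s%:R) * rr s ^+ K.+1.
      rewrite /ebox big_split /= prodr_const_nat subn1 /=; congr (_ * _).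
      transitivity (expR (\sum_(1 <= r < K.+2) sg r * s%:R)); first by rewrite expR_sum.
      have sE : \sum_(1 <= r < K.+2) sg r = - sg 0%N.
        have := sg_sum; rewrite -(big_mkord xpredT) big_ltn// => /eqP.
        by rewrite addrC addr_eq0 => /eqP.
      by rewrite -sE mulr_suml.
    rewrite /ebox mulrACA -expRD /D ets.
    apply: ler_pM; rewrite ?expR_ge0 ?mulr_ge0 ?exprn_ge0//.
      rewrite ler_expR.
      have s0 := sg_part (isT : (0 < 1 < K.+2)%N); rewrite big_ord1 in s0.
      have st' : 0 <= t%:R - s%:R :> R by rewrite subr_ge0 ler_nat.
      by nra.
    have [rst|rts] := leP (rr s) (rr t).
      apply: (@le_trans _ _ (rho t)); last by rewrite lerDr.
      by rewrite /rho [leRHS]exprS ler_wpM2l//; apply: lerXn2r; rewrite ?nnegrE.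
    apply: (@le_trans _ _ (rho s)); last by rewrite lerDl.
    by rewrite /rho [leRHS]exprS ler_wpM2r ?exprn_ge0// ltW.
  apply: (@le_trans _ _ (\prod_(r < j.+1) (ebox rr s r * ebox rr t r) * \prod_(j.+1 <= r < K.+2) ebox rr s r)).
    apply: ler_wpM2l; first by apply: prodr_ge0 => r _; rewrite mulr_ge0 ?ebox_ge0.
    by apply: ler_prod => r _; rewrite mm ge_min lexx.
  rewrite big_split /= mulrAC.
  have -> : \prod_(i < j.+1) ebox rr s i * \prod_(j.+1 <= r < K.+2) ebox rr s r = rho s.
    have jK2 : (j.+1 <= K.+2)%N by exact: leq_trans jK (leqW (leqnSn K)).
    by rewrite -(big_mkord xpredT (ebox rr s)) -big_cat_nat//= big_mkord ebox_prod_all.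
  rewrite ebox_prod mulrC /D.
  apply: (@le_trans _ _ (expR (- de) ^+ (t - s) * rho s)); last first.
    by rewrite ler_wpM2l ?exprn_ge0 ?expR_ge0// lerDl.
  rewrite ler_wpM2r// ets -[leRHS]mulr1; apply: ler_pM; rewrite ?expR_ge0 ?exprn_ge0//.
    rewrite ler_expR.
    have s0 := sg_part (_ : (0 < j.+1 < K.+2)%N).
    have {}s0 : \sum_(r < j.+1) sg r <= - de by apply: s0; rewrite /= !ltnS ltnW.
    have s1 : 0 <= s%:R :> R by rewrite ler0n.
    have t1 : 0 <= t%:R :> R by rewrite ler0n.
    apply: le_trans (ler_wpM2r t1 s0) _; rewrite !mulNr lerN2.
    by apply: ler_wpM2l; [exact: ltW|rewrite gerBl].
  exact: exprn_ile1.
have B0 : 0 <= Bbox (ebox rr s) (ebox rr t) K.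
  by apply: Bbound_ge0 => r; rewrite mulr_ge0// ebox_ge0.
have := Bbox_tail (ebox_ge0 s) (ebox_ge0 t) (leqW (leqnSn K)) Tj.
rewrite big_ltn ?leqnSn// big_nat1 => h.
apply: le_trans (le_trans h _).
  rewrite -mulrA ler_wpM2l// ler_wpM2l ?mulr_ge0//.
  have := mm K.+1; lra.
rewrite ler_wpM2r// /CC ler_wpM2r ?exprn_ge0// ler_nat.
exact: leqnSn.
Qed.

Lemma cross_moment (s t : nat) :
  (it_int l (fun z => Ncount K (ebox rr s) z * Ncount K (ebox rr t) z) x <=
  (CC * (rho s * rho t + expR (- de) ^+ ((s - t) + (t - s)) * (rho s + rho t)))%:E)%E.
Proof.
have [st|ts] := leqP s t.
  by move: (st); rewrite -subn_eq0 => /eqP ->; rewrite add0n; exact: cross_moment_le.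
have := cross_moment_le (ltnW ts).
under eq_it_int do rewrite muleC.
have -> : (t - s = 0)%N by apply/eqP; rewrite subn_eq0 ltnW.
by rewrite addn0 (mulrC (rho t)) (addrC (rho t)).
Qed.

(** The quotient [e ^ 2 / v] of [paley_zygmund] for [e = S / 4] and [v = CC * (1 + 4 / (1 - exp (-
    de))) * S ^ 2]. It does not depend on the radii, so the same constant serves for all rescaled
    boxes. *)
Definition hit_constant : R := (16 * (CC * (1 + 4 / (1 - expR (- de)))))^-1.

Lemma hit_constant_gt0 : 0 < hit_constant.
Proof.
have w1 : expR (- de) < 1 by rewrite expR_lt1 oppr_lt0.
have C0 : 0 < CC by apply: mulr_gt0; [rewrite ltr0n|exact: exprn_gt0].
rewrite invr_gt0; apply: mulr_gt0 => //; apply: mulr_gt0 => //.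
by apply: addr_gt0 => //; apply: divr_gt0 => //; rewrite subr_gt0.
Qed.

(** The second moment method for the total count up to [T]: the decay in [s - t] is summed by
    [two_sided_geometric], which leaves a multiple of [S], and [S >= 1] absorbs it into [S ^ 2]. *)
Lemma hit_probability (T : nat) : 1 <= \sum_(t < T) rho t ->
  (hit_constant%:E <= it_int l (fun z => (\1_[set z |
     exists2 t, (t < T)%N & Ncount K (ebox rr t) z != 0] z)%:E) x)%E.
Proof.
set S := \sum_(t < T) rho t => S1.
have S0 : 0 < S by apply: lt_le_trans S1.
pose N z := (\sum_(t < T) Ncount K (ebox rr t) z)%E.
have Nt0 t z : (0 <= Ncount K (ebox rr t) z)%E by exact: Ncount_ge0.
have mNt t : measurable_fun setT (Ncount K (ebox rr t)) by exact: measurable_Ncount.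
have N0 z : (0 <= N z)%E by exact: sume_ge0.
have mN : measurable_fun setT N by exact: emeasurable_sum.
set G := 1 + 4 / (1 - expR (- de)).
have w1 : expR (- de) < 1 by rewrite expR_lt1 oppr_lt0.
have w1' : 0 < 1 - expR (- de) by rewrite subr_gt0.
have G0 : 0 < G by rewrite addr_gt0// divr_gt0.
have C0 : 0 < CC by apply: mulr_gt0; [rewrite ltr0n|exact: exprn_gt0].
have v0 : 0 < CC * G * S ^+ 2 by apply: mulr_gt0; [exact: mulr_gt0|exact: exprn_gt0].
have e0 : 0 < 4^-1 * S by rewrite mulr_gt0.
have eN : ((4^-1 * S)%:E <= it_int l N x)%E.
  rewrite /N (@it_int_bigsum R _ _ l (fun (t : 'I_T) z => Ncount K (ebox rr t) z) x)//.
  rewrite mulr_sumr -sumEFin; apply: lee_sum => t _.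
  have [r0|large] := rr_large t.
    rewrite /rho r0 exprS mul0r mulr0; exact: it_int_ge0.
  by rewrite -ebox_prod_all; apply: Ncount_first_moment => // r; exact: ebox_ge0.
have Nv : (it_int l (fun z => N z * N z) x <= (CC * G * S ^+ 2)%:E)%E.
  have -> : it_int l (fun z => (N z * N z)%E) x = (\sum_(s < T) \sum_(t < T)
      it_int l (fun z => Ncount K (ebox rr s) z * Ncount K (ebox rr t) z) x)%E.
    have m2 (s t : 'I_T) : measurable_fun setT (fun z => (Ncount K (ebox rr s) z * Ncount K (ebox rr t) z)%E).
      exact: emeasurable_funM.
    have p2 (s t : 'I_T) z : (0 <= Ncount K (ebox rr s) z * Ncount K (ebox rr t) z)%E by rewrite mule_ge0.
    transitivity (it_int l (fun z => (\sum_(s < T) \sum_(t < T)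
        (Ncount K (ebox rr s) z * Ncount K (ebox rr t) z))%E) x).
      apply: eq_it_int => z; rewrite /N ge0_sume_distrl//; apply: eq_bigr => s _.
      by rewrite ge0_sume_distrr.
    rewrite (@it_int_bigsum R _ _ l (fun (s : 'I_T) z => (\sum_(t < T)
        (Ncount K (ebox rr s) z * Ncount K (ebox rr t) z))%E) x); last 2 first.
    - by move=> s; apply: emeasurable_sum => t; exact: m2.
    - by move=> s z; apply: sume_ge0 => t _; exact: p2.
    apply: eq_bigr => s _.
    by rewrite (@it_int_bigsum R _ _ l (fun (t : 'I_T) z =>
        (Ncount K (ebox rr s) z * Ncount K (ebox rr t) z)%E) x).
  apply: (@le_trans _ _ (\sum_(s < T) \sum_(t < T)
     (CC * (rho s * rho t + expR (- de) ^+ ((s - t) + (t - s)) * (rho s + rho t)))%:E)%E).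
    by apply: lee_sum => s _; apply: lee_sum => t _; exact: cross_moment.
  under eq_bigr do rewrite sumEFin.
  rewrite sumEFin lee_fin.
  have -> : \sum_(s < T) \sum_(t < T)
     (CC * (rho s * rho t + expR (- de) ^+ ((s - t) + (t - s)) * (rho s + rho t))) =
     CC * (S ^+ 2 + 2 * \sum_(s < T) rho s * \sum_(t < T) expR (- de) ^+ ((s - t) + (t - s))).
    under eq_bigr do rewrite -mulr_sumr.
    rewrite -mulr_sumr; congr (_ * _).
    have -> : S ^+ 2 = \sum_(s < T) \sum_(t < T) rho s * rho t.
      by rewrite expr2 mulr_suml; apply: eq_bigr => s _; rewrite mulr_sumr.
    have -> : 2 * \sum_(s < T) rho s * \sum_(t < T) expR (- de) ^+ ((s - t) + (t - s)) =
       \sum_(s < T) \sum_(t < T) expR (- de) ^+ ((s - t) + (t - s)) * rho s +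
       \sum_(s < T) \sum_(t < T) expR (- de) ^+ ((s - t) + (t - s)) * rho t.
      rewrite [X in _ = _ + X]exchange_big /= mulrDl mul1r; congr (_ + _).
        by apply: eq_bigr => s _; rewrite mulrC mulr_suml.
      apply: eq_bigr => s _; rewrite mulrC mulr_suml; apply: eq_bigr => t _.
      by rewrite addnC.
    rewrite -!big_split /=; apply: eq_bigr => s _; rewrite -!big_split /=.
    by apply: eq_bigr => t _; rewrite mulrDr.
  rewrite -mulrA; apply: ler_wpM2l; first exact: ltW.
  rewrite /G [leRHS]mulrDl mul1r lerD2l.
  apply: (@le_trans _ _ (2 * (\sum_(s < T) rho s * (2 / (1 - expR (- de)))))).
    rewrite ler_wpM2l//; apply: ler_sum => s _; rewrite ler_wpM2l//.
    by apply: two_sided_geometric; rewrite expR_ge0.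
  rewrite -mulr_suml -/S.
  have -> : 2 * (S * (2 / (1 - expR (- de)))) = 4 / (1 - expR (- de)) * S.
    by field; rewrite gt_eqF.
  by apply: ler_wpM2l; [rewrite divr_ge0// ltW|exact: ler_eXnr].
have := paley_zygmund mN N0 e0 v0 eN Nv.
have -> : (4^-1 * S) ^+ 2 / (CC * G * S ^+ 2) = hit_constant.
  by rewrite /hit_constant -/G; field; rewrite !gt_eqF.
move/le_trans; apply; apply: le_it_int.
- apply/measurable_EFinP; apply: measurable_indic.
  have := mN measurableT (~` [set 0%E]) (measurableC (emeasurable_set1 0%E)).
  by rewrite setTI; congr measurable; apply/seteqP; split => y /= /eqP.
- apply/measurable_EFinP; apply: measurable_indic.
  rewrite (_ : [set z | _] = \bigcup_(t in [set t | (t < T)%N]) [set z | Ncount K (ebox rr t) z != 0]%E); last first.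
    by apply/seteqP; split => z /= [t tT Nz]; exists t.
  apply: bigcup_measurable => t _.
  have := mNt t measurableT (~` [set 0%E]) (measurableC (emeasurable_set1 0%E)).
  by rewrite setTI; congr measurable; apply/seteqP; split => y /= /eqP.
- by move=> z; rewrite lee_fin.
move=> z; rewrite lee_fin !indicE ler_nat.
have [zA|zA] := boolP (z \in [set z | exists2 t, (t < T)%N & Ncount K (ebox rr t) z != 0%E]).
  by rewrite leq_b1.
rewrite memNset//= => /eqP; apply.
rewrite /N big1// => t _; apply: contrapT => /eqP nt; move: zA; rewrite notin_setE; apply.
by exists t.
Qed.

End moments.

Definition hits (b : nat -> R) (z : cspace) : Prop :=
  exists q : nat -> int, [/\ q K.+1 != 0, `|(q K.+1)%:~R| <= b K.+1 &
    forall r, (r <= K)%N -> `|(q r)%:~R + tl K.+2 r q z| <= b r].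

(** For every [m] the boxes shrunk by [m + 1] and restricted to late times are hit with probability
    at least [hit_constant]. The events [A n], that this happens for some [m >= n], decrease, so
    their intersection keeps the lower bound, and on it hits occur at every scale and arbitrarily
    late. *)
Lemma hits_io_positive (rr : nat -> R) (et : R) : et < sg K.+1 ->
  (forall t, 0 <= rr t <= 1) ->
  (forall t, rr t = 0 \/ expR (- (et * t%:R)) <= rr t) ->
  (forall B, exists T, B <= \sum_(t < T) rr t ^+ K.+2) ->
  ~ AE l (fun z => ~ (forall c N : nat, exists2 t, (N <= t)%N &
       hits (fun r => ebox rr t r / c.+1%:R) z)) x.
Proof.
move=> et_lt rr01 rr_large rr_div.
have rr0 t : 0 <= rr t by have /andP[] := rr01 t.
have rr1 t : rr t <= 1 by have /andP[] := rr01 t.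
(* As [et < sg K.+1], the last side of a box with nonzero radius grows without bound; from [tc c] on
   it may be divided by [c.+1] and still be at least 1, as [Ncount_first_moment] demands. *)
have [tc tcP] : exists tc : nat -> nat, forall c t, (tc c <= t)%N ->
    c.+1%:R <= expR ((sg K.+1 - et) * t%:R).
  have h c : exists n : nat, forall t, (n <= t)%N -> c.+1%:R <= expR ((sg K.+1 - et) * t%:R).
    have [n nP] : exists n : nat, c.+1%:R / (sg K.+1 - et) <= n%:R.
      exists (Num.truncn (c.+1%:R / (sg K.+1 - et))).+1.
      by apply: ltW; exact: Num.Theory.truncnS_gt.
    exists n => t nt; apply: le_trans (expR_ge1Dx _).
    have d0 : 0 < sg K.+1 - et by rewrite subr_gt0.
    have : c.+1%:R <= (sg K.+1 - et) * t%:R.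
      by rewrite mulrC -ler_pdivrMr//; apply: le_trans nP _; rewrite ler_nat.
    by lra.
  exists (fun c => projT1 (cid (h c))) => c.
  exact: (projT2 (cid (h c))).
(* The radius zero at early times excludes hits there, because counted vectors have a nonzero last
   coordinate. *)
pose rc m t : R := if (maxn m (tc m) <= t)%N then rr t / m.+1%:R else 0.
have m1 (m : nat) : 1 <= m.+1%:R :> R by rewrite ler1n.
have m0 (m : nat) : 0 < m.+1%:R :> R by rewrite ltr0n.
have rc01 m t : 0 <= rc m t <= 1.
  rewrite /rc; case: ifP => _; last by rewrite lexx ler01.
  by rewrite divr_ge0//= ler_pdivrMr// mul1r (le_trans (rr1 t)).
have rc_large m t : rc m t = 0 \/ 1 <= ebox (rc m) t K.+1.
  rewrite /ebox /rc; case: ifP => [mt|_]; last by left.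
  have [->|rt] := rr_large t; first by left; rewrite mul0r.
  right; rewrite mulrA ler_pdivlMr// mul1r.
  apply: le_trans (tcP m t _) _; first by apply: leq_trans mt; rewrite leq_maxr.
  have -> : (sg K.+1 - et) * t%:R = sg K.+1 * t%:R + - (et * t%:R) by ring.
  by rewrite expRD ler_wpM2l ?expR_ge0.
have rc_div m : exists T, 1 <= \sum_(t < T) rc m t ^+ K.+2.
  pose M := maxn m (tc m).
  have [T hT] := rr_div (m.+1%:R ^+ K.+2 + M%:R).
  exists T; rewrite -(ler_pM2l (exprn_gt0 K.+2 (m0 m))) mulr1.
  rewrite -(lerD2r M%:R); apply: le_trans hT _.
  rewrite mulr_sumr.
  apply: (@le_trans _ _ (\sum_(t < T) (m.+1%:R ^+ K.+2 * rc m t ^+ K.+2 + (t < M)%:R))).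
    apply: ler_sum => t _; rewrite /rc -/M -exprMn.
    case: leqP => [Mt|tM].
      by rewrite addr0 mulrC divfK// gt_eqF.
    by rewrite mulr0 expr0n add0r exprn_ile1.
  rewrite big_split /= lerD2l -natr_sum ler_nat.
  suff : (\sum_(i < T) (i < M) <= minn T M)%N by move/leq_trans; apply; exact: geq_minr.
  elim: T => [|T ih]; first by rewrite big_ord0.
  by rewrite big_ord_recr /=; apply: leq_trans (leq_add ih (leqnn _)) _; case: (ltnP T M) => TM /=; lia.
pose A n := \bigcup_(m in [set m | (n <= m)%N]) [set z | exists t, Ncount K (ebox (rc m) t) z != 0%E].
have mB m : measurable [set z | exists t, Ncount K (ebox (rc m) t) z != 0%E].
  rewrite (_ : [set z | _] = \bigcup_t [set z | Ncount K (ebox (rc m) t) z != 0%E]); last first.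
    by apply/seteqP; split => z /= [t]; [exists t|move=> _ ?; exists t].
  apply: bigcupT_measurable => t.
  have := @measurable_Ncount R K (ebox (rc m) t) measurableT (~` [set 0%E]) (measurableC (emeasurable_set1 0%E)).
  by rewrite setTI; congr measurable; apply/seteqP; split => y /= /eqP.
have mA n : measurable (A n) by apply: bigcup_measurable.
have dA n : A n.+1 `<=` A n by move=> z [m nm hz]; exists m => //; exact: ltnW.
have A_ge n : (hit_constant%:E <= it_int l (fun z => (\1_(A n) z)%:E) x)%E.
  have [T hT] := rc_div n.
  apply: le_trans (hit_probability (rc01 n) (rc_large n) hT) _.
  apply: le_it_int.
  - apply/measurable_EFinP; apply: measurable_indic.
    rewrite (_ : [set z | _] = \bigcup_(t in [set t | (t < T)%N]) [set z | Ncount K (ebox (rc n) t) z != 0]%E); last first.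
      by apply/seteqP; split => z /= [t tT Nz]; exists t.
    apply: bigcup_measurable => t _.
    have := @measurable_Ncount R K (ebox (rc n) t) measurableT (~` [set 0%E]) (measurableC (emeasurable_set1 0%E)).
    by rewrite setTI; congr measurable; apply/seteqP; split => y /= /eqP.
  - by apply/measurable_EFinP; exact: measurable_indic.
  - by move=> z; rewrite lee_fin.
  move=> z; rewrite lee_fin !indicE ler_nat.
  have [zA|zA] := boolP (z \in A n); first by rewrite leq_b1.
  rewrite memNset// => -[t _ Nt]; move: zA; rewrite notin_setE; apply.
  by exists n => /=; [exact: leqnn|exists t].
move=> AEn.
have mI : measurable (\bigcap_n A n) by exact: bigcapT_measurable.
have AEI : AE l (fun z => ~ (\bigcap_n A n) z) x.
  apply: AE_imp AEn => z nz Az; apply: nz => c N.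
  have [m /= nm [t Nt]] := Az (maxn c N) I.
  have b0 r : 0 <= ebox (rc m) t r.
    by rewrite mulr_ge0 ?expR_ge0//; have /andP[] := rc01 m t.
  have [q [q1 q2 q3]] := Ncount_hit b0 Nt.
  have tm : (maxn m (tc m) <= t)%N.
    apply: contraT => nt; move: q2 q1; rewrite /ebox /rc (negbTE nt) mulr0.
    by rewrite normr_le0 intr_eq0 => ->.
  exists t; first by apply: leq_trans (leq_trans (leq_maxl _ _) tm); apply: leq_trans nm; exact: leq_maxr.
  have br r : ebox (rc m) t r <= ebox rr t r / c.+1%:R.
    rewrite /ebox /rc tm mulrA; apply: ler_wpM2l; first by rewrite mulr_ge0 ?expR_ge0.
    by rewrite lef_pV2 ?posrE// ler_nat ltnS; apply: leq_trans nm; exact: leq_maxl.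
  exists q; split => //; first exact: le_trans q2 (br _).
  by move=> r rK; apply: le_trans (q3 r rK) (br r).
have := @it_int_decreasing_cvg R l A x mA dA.
have /(AE_it_int l x mI) -> := AEI => cv.
have : (hit_constant%:E <= 0)%E.
  rewrite -(cvg_lim _ cv)//; apply: lime_ge; first by apply/cvg_ex; exists 0%E.
  by apply: nearW => n; exact: A_ge.
by rewrite lee_fin leNgt hit_constant_gt0.
Qed.

End hit_infinitely_often.

(** * Reduction from arbitrary to unipotent matrices *)

Section triangular_substitution.
Context {R : realType}.
Local Notation cspace := (@cspace R).
Local Notation leb := (@lebesgue_measure R).

Lemma index_le_drop (T : eqType) (s : seq T) n d : uniq s -> d \in drop n s ->
  (n <= index d s)%N.
Proof.
move=> us dn; rewrite leqNgt; apply/negP => lt.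
have ds : d \in s by exact: mem_drop dn.
have dt : d \in take n s by rewrite in_take.
move: us; rewrite -(cat_take_drop n s) cat_uniq => /and3P[_ /hasPn h _].
by have := h d dn; rewrite /= dt.
Qed.

Lemma AE_neq0 l c (x : cspace) : uniq l -> c \in l -> AE l (fun z => z c != 0) x.
Proof.
elim: l x => //= d l ih x /andP[dl ul]; rewrite in_cons => /orP[/eqP ->|cl].
  have n0 : leb.-negligible [set 0%R].
    by apply/(lebesgue_negligibleP (measurable_set1 _)); exact: lebesgue_measure_set1.
  apply: negligibleS n0 => y /= ny; have [//|y0] := eqVneq y 0; exfalso; apply: ny.
  apply: (@AE_congr _ l (fun _ => True) _ (upd x d y)); last exact: AE_true.
  by move=> z z' _ _ zx _; rewrite zx// updE.
apply: (@negligibleS _ _ _ leb set0) => [y /= ny|]; last exact: negligible_set0.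
by apply: ny; exact: ih.
Qed.

(* [kap] orders the integrations: the coefficients at [c] may depend on the
   coordinates with smaller key and on those that are not integrated. *)
Definition triangular (kap : coord -> nat) (l : seq coord) (al be : coord -> cspace -> R) :=
  (forall c (z z' : cspace), c \in l ->
     (forall d, d \notin l \/ (kap d < kap c)%N -> z d = z' d) ->
     al c z = al c z' /\ be c z = be c z') /\
  (forall c z, c \in l -> al c z != 0).

Lemma AE_subst_sorted (kap : coord -> nat) l (Q : cspace -> Prop) al be x :
  sorted (relpre kap leq) l -> uniq l -> triangular kap l al be -> AE l Q x ->
  AE l (fun z => Q (fun c => if c \in l then al c z * z c + be c z else z c)) x.
Proof.
move=> sl ul [dep al0]; apply: AE_subst => // c z z' cl zz'; apply: dep => // d dd.
have tr : transitive (relpre kap leq) by move=> b a e /=; exact: leq_trans.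
apply: zz'; apply/negP => din.
have dl : d \in l by exact: mem_drop din.
case: dd => [|lt]; first by rewrite dl.
have := sorted_leq_index tr (fun c => leqnn _) sl c d cl dl (index_le_drop ul din).
by rewrite /= leqNgt lt.
Qed.

(** The list is sorted by [kap], the triangular substitution is made in that order, and [AE_perm]
    restores the original order. The condition on [c0] adds that a chosen pivot is almost surely
    nonzero. *)
Lemma AE_subst_key (kap : coord -> nat) l c0 (Q Q' : set cspace)
    (al be : coord -> cspace -> R) x :
  uniq l -> c0 \in l -> measurable Q -> measurable Q' -> triangular kap l al be ->
  (forall z : cspace, z c0 != 0 -> (forall c, c \notin l -> z c = x c) ->
     Q (fun c => if c \in l then al c z * z c + be c z else z c) -> Q' z) ->
  AE l Q x -> AE l Q' x.
Proof.
move=> ul cl mQ mQ' [dep al0] H h.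
pose l' := sort (relpre kap leq) l.
have pl : perm_eq l l' by rewrite perm_sym perm_sort.
have ul' : uniq l' by rewrite sort_uniq.
have ml' c : (c \in l') = (c \in l) by rewrite mem_sort.
have sl : sorted (relpre kap leq) l' by apply: sort_sorted => c d; exact: leq_total.
apply: (@AE_perm _ l' l) => //; first by rewrite perm_sym.
have h' : AE l' Q x by exact: AE_perm pl h.
have cl' : c0 \in l' by rewrite ml'.
have tri : triangular kap l' al be.
  split=> [c z z'|c z]; rewrite ml'; last exact: al0.
  by move=> c1 zz'; apply: dep => // d dd; apply: zz'; rewrite ml'.
have h2 := AE_and (AE_neq0 x ul' cl') (AE_subst_sorted sl ul' tri h').
apply: AE_congr h2 => z z' zz' zx zx' [n0 q].
have -> : z' = z.
  apply/funext => c; have [cl1|cl1] := boolP (c \in l'); first by rewrite zz'.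
  by rewrite zx// zx'.
apply: H => //; first by move=> c cn; rewrite zx// ml'.
by move: q; congr Q; apply/funext => c; rewrite ml'.
Qed.

End triangular_substitution.

Section row_reduction.
Context {R : realType}.
Local Notation cspace := (@cspace R).
Variables (k n : nat).
Hypothesis kn : (k <= n)%N.

Definition full : seq coord := [seq (i, j) | i <- iota 0 k, j <- iota 0 n].

Lemma mem_full i j : ((i, j) \in full) = (i < k)%N && (j < n)%N.
Proof.
apply/allpairsP/andP => [[[a b] /= [ha hb [-> ->]]]|[ik jn]].
  by move: ha hb; rewrite !mem_iota !add0n.
by exists (i, j) => /=; rewrite !mem_iota !add0n.
Qed.

Lemma uniq_full : uniq full.
Proof. by apply: allpairs_uniq; rewrite ?iota_uniq// => -[a b] [c d]. Qed.

(* The entries left free by Gaussian elimination of the first [r] columns. *)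
Definition reduced (r : nat) (c : coord) : bool :=
  (c.1 < r)%N && (c.1 < c.2)%N || (r <= c.1)%N && (r <= c.2)%N.

Definition free_coords r := [seq c <- full | reduced r c].

Lemma mem_free_coords r i j : ((i, j) \in free_coords r) =
  [&& (i < k)%N, (j < n)%N & reduced r (i, j)].
Proof. by rewrite mem_filter mem_full andbC andbA. Qed.

Lemma uniq_free_coords r : uniq (free_coords r).
Proof. by rewrite filter_uniq// uniq_full. Qed.

Definition reduced_base r (x : cspace) :=
  forall i j, (i < k)%N -> (j < n)%N -> ~~ reduced r (i, j) -> x (i, j) = (i == j)%:R.

Variable Q : set cspace.
Hypothesis mQ : measurable Q.
(** Only rows below the pivot row [r] are modified. With sorted exponents these have the longer box
    sides, so the events considered later satisfy this condition. *)
Hypothesis row_invariant : forall r (a : R) (c : nat -> R) (z z' : cspace),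
  (r < k)%N -> a != 0 ->
  (forall i, (i <= r)%N -> c i = 0) ->
  (forall j, (j < n)%N -> z' (r, j) = a * z (r, j)) ->
  (forall i j, (i < k)%N -> (j < n)%N -> i != r -> z' (i, j) = z (i, j) + c i * z (r, j)) ->
  Q z' -> Q z.

Lemma measurable_if_coord (p : coord -> bool) (v : coord -> R) :
  measurable_fun setT (fun z : cspace => (fun c => if p c then v c else z c) : cspace).
Proof.
apply: measurable_to_cspace => c; case: (p c); first exact: measurable_cst.
exact: measurable_coord.
Qed.

(** One elimination step. After the pivot column is fixed, the passage from the remaining entries to
    those of the eliminated matrix is affine and triangular, so it preserves null sets;
    [row_invariant] then returns from the eliminated matrix to the original one. *)
Lemma row_reduction_step r x : (r < k)%N ->
  (forall x, reduced_base r.+1 x -> AE (free_coords r.+1) Q x) ->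
  reduced_base r x -> AE (free_coords r) Q x.
Proof.
move=> rk ih bx.
pose p (c : coord) := (c.2 == r) && (r <= c.1)%N.
(* Sets column [r], from row [r] down, to its value after elimination, so that the entries
   integrated there no longer matter. *)
pose rst (z : cspace) : cspace := fun c => if p c then (c.1 == r)%:R else z c.
have mrst : measurable_fun setT rst by exact: measurable_if_coord.
pose Q1 := rst @^-1` Q.
have mQ1 : measurable Q1 by have := mrst measurableT Q mQ; rewrite setTI.
set l := free_coords r.
have ul : uniq l by exact: uniq_free_coords.
have redS i j : reduced r.+1 (i, j) = ~~ p (i, j) && reduced r (i, j).
  by rewrite /reduced /p /=; apply/idP/idP; lia.
have l2E : [seq c <- l | predC p c] = free_coords r.+1.
  rewrite /l /free_coords -filter_predI; apply: eq_filter => -[i j] /=.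
  by rewrite redS.
have h1 : AE l Q1 x.
  apply: (@AE_perm _ ([seq c <- l | p c] ++ [seq c <- l | predC p c])) => //.
  - by rewrite (perm_uniq (permEl (perm_filterC p l))).
  - exact: permEl (perm_filterC p l).
  rewrite AE_cat l2E.
  apply: (@AE_congr _ _ (fun _ => True) _ x); last exact: AE_true.
  move=> _ z _ _ zx _.
  have : AE (free_coords r.+1) Q (rst z).
    apply: ih => i j ik jn; rewrite redS negb_and negbK /rst.
    case: ifP => [pij _|pij] /=.
      by move: pij => /andP[/= /eqP -> _].
    move=> nr; rewrite zx; first exact: bx.
    by rewrite mem_filter pij.
  apply: AE_congr => w w' ww' wx wx' Qw.
  rewrite /Q1 /=; suff <- : w = rst w' by [].
  apply/funext => -[i j]; have [cl|cl] := boolP ((i, j) \in free_coords r.+1).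
    rewrite ww'// /rst; move: cl; rewrite mem_free_coords redS => /and3P[_ _ /andP[np _]].
    by rewrite (negbTE np).
  by rewrite wx// /rst wx'.
(* The pivot column comes first, then row [r], then the entries whose correction involves both. *)
pose kap (c : coord) : nat := if p c then 0%N else if c.1 == r then 1%N else 2.
(* The value 1 at a zero pivot is a default that keeps the coefficient nonzero everywhere; [be]
   below is the Schur complement correction. *)
pose al (c : coord) (z : cspace) : R :=
  if (c.1 == r) && (r < c.2)%N then (if z (r, r) == 0 then 1 else (z (r, r))^-1) else 1.
pose be (c : coord) (z : cspace) : R :=
  if (r < c.1)%N && (r < c.2)%N then - (z (c.1, r) * z (r, c.2) / z (r, r)) else 0.
have rl : (r, r) \in l.
  by rewrite mem_free_coords rk (leq_trans rk kn)/= /reduced /= leqnn orbT.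
apply: (@AE_subst_key _ kap l (r, r) Q1 Q al be) => //; first split.
- move=> [i j] z z' cl zz'; rewrite /al /be /=; split.
    case: ifP => // /andP[/eqP ir rj]; rewrite zz'//.
    by right; rewrite /kap /p /= ir !eqxx leqnn /= (gtn_eqF rj).
  case: ifP => // /andP[ri rj].
  rewrite (zz' (i, r)) ?(zz' (r, j)) ?(zz' (r, r))//.
  + by right; rewrite /kap /p /= !eqxx leqnn /= (gtn_eqF rj)/= (gtn_eqF ri).
  + by right; rewrite /kap /p /= !eqxx leqnn /= (gtn_eqF rj)/= (gtn_eqF ri).
  + by right; rewrite /kap /p /= !eqxx (ltnW ri) /= (gtn_eqF rj)/= (gtn_eqF ri).
- move=> [i j] z _; rewrite /al /=; case: ifP => // _.
  by case: ifPn => // ?; rewrite invr_eq0.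
move=> z z0 zx; apply: (@row_invariant r (z (r, r))^-1
    (fun i => if (r < i)%N then - (z (i, r) / z (r, r)) else 0) z) => //.
- by rewrite invr_eq0.
- by move=> i ir; rewrite ltnNge ir.
- move=> j jn; rewrite /rst /p /= leqnn andbT.
  have [->|jr] := eqVneq j r; first by rewrite eqxx mulVf.
  rewrite mem_free_coords rk jn /= /reduced ltnn leqnn /=.
  have [rj|jr'] := leqP r j; last first.
    rewrite zx ?bx ?(gtn_eqF jr') ?mulr0// ?mem_free_coords /reduced /= ?ltnn ?leqnn /= ?(leqNgt r) ?jr' ?andbF//.
  have {}rj : (r < j)%N by rewrite ltn_neqAle eq_sym jr.
  by rewrite /al /be /= eqxx rj ltnn (negbTE z0) /= addr0.
move=> i j ik jn ir; rewrite /rst /p /=.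
have [ri|ri] := ltnP r i; last first.
  have ir' : (i < r)%N by rewrite ltn_neqAle ir.
  rewrite (leqNgt r) ir' andbF mul0r addr0.
  rewrite mem_free_coords ik jn /= /reduced /= (leqNgt r) ir' /=.
  by rewrite orbF /al /be /= (negbTE ir) (ltnNge r i) ri /= mul1r addr0; case: ifP.
rewrite (ltnW ri) andbT.
have [->|jr] := eqVneq j r; first by rewrite (negbTE ir) mulNr divfK// subrr.
rewrite mem_free_coords ik jn /= /reduced /= (ltnNge i r) (ltnW ri) /=.
have [rj|jr'] := leqP r j; last first.
  rewrite (zx (r, j)) ?bx ?(gtn_eqF jr') ?mulr0 ?addr0//.
  + by rewrite /reduced /= ltnn leqnn /= (leqNgt r) jr'.
  + by rewrite mem_free_coords /reduced /= ltnn leqnn /= (leqNgt r) jr' !andbF.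
have {}rj : (r < j)%N by rewrite ltn_neqAle eq_sym jr.
rewrite /al /be /= (negbTE ir) ri rj /= mul1r; congr (_ + _).
by rewrite mulrAC mulNr.
Qed.

Lemma AE_full : (forall x, reduced_base k x -> AE (free_coords k) Q x) ->
  forall x, AE full Q x.
Proof.
move=> H.
have St r : (r <= k)%N -> forall x, reduced_base (k - r) x -> AE (free_coords (k - r)) Q x.
  elim: r => [|r ih] rk x; first by rewrite subn0; exact: H.
  apply: row_reduction_step; first by rewrite ltn_subrL /= (leq_ltn_trans _ rk).
  by rewrite subnSK//; apply: ih; exact: ltnW.
move=> x; have := St k (leqnn k) x; rewrite subnn.
have -> : free_coords 0 = full by rewrite /free_coords -[RHS]filter_predT; apply: eq_filter.
by apply=> i j _ _; rewrite /reduced /=.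
Qed.

End row_reduction.

(** * Column operations and affine changes of variables *)

Section column_operations.
Context {R : realType}.
Local Notation cspace := (@cspace R).
Variable K : nat.
Local Notation k := K.+1.
Local Notation F := (full k k.+1).

Definition mat (z : cspace) : 'M[R]_k := \matrix_(i, j) z (nat_of_ord i, nat_of_ord j).
Definition trl (z : cspace) : 'cV[R]_k := \col_i z (nat_of_ord i, k).
Definition coords (A : 'M[R]_k) (v : 'cV[R]_k) : cspace := fun c =>
  if (c.1 < k)%N then
    if (c.2 < k)%N then A (inord c.1) (inord c.2) else
    if c.2 == k then v (inord c.1) ord0 else 0
  else 0.

Lemma mat_coords A v : mat (coords A v) = A.
Proof. by apply/matrixP => i j; rewrite mxE /coords /= !ltn_ord !inord_val. Qed.

Lemma trl_coords A v : trl (coords A v) = v.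
Proof. by apply/colP => i; rewrite mxE /coords /= ltn_ord ltnn eqxx inord_val. Qed.

Definition full_only (Q : set cspace) :=
  forall z z' : cspace, {in F, z =1 z'} -> Q z -> Q z'.

Lemma measurable_coords d (T : measurableType d) (A : T -> 'M[R]_k) (v : T -> 'cV[R]_k) :
  (forall i j, measurable_fun setT (fun t => A t i j : R)) ->
  (forall i, measurable_fun setT (fun t => v t i ord0 : R)) ->
  measurable_fun setT (fun t => coords (A t) (v t)).
Proof.
move=> mA mv; apply: measurable_to_cspace => -[i j]; rewrite /coords /=.
by case: (i < k)%N => //; case: (j < k)%N => //; case: (j == k).
Qed.

Lemma measurable_mat i j : measurable_fun setT (fun z : cspace => mat z i j).
Proof.
rewrite (_ : (fun z => _) = fun z : cspace => z (nat_of_ord i, nat_of_ord j)); last first.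
  by apply/funext => z; rewrite mxE.
exact: measurable_coord.
Qed.

Lemma measurable_trl i : measurable_fun setT (fun z : cspace => trl z i ord0).
Proof.
rewrite (_ : (fun z => _) = fun z : cspace => z (nat_of_ord i, k)); last first.
  by apply/funext => z; rewrite mxE.
exact: measurable_coord.
Qed.

Lemma measurable_mulmx d (T : measurableType d) m n p (A : T -> 'M[R]_(m, n)) (B : T -> 'M[R]_(n, p)) :
  (forall i j, measurable_fun setT (fun t => A t i j : R)) ->
  (forall i j, measurable_fun setT (fun t => B t i j : R)) ->
  forall i j, measurable_fun setT (fun t => (A t *m B t) i j : R).
Proof.
move=> mA mB i j.
rewrite (_ : (fun t => _) = fun t => \sum_m A t i m * B t m j); last first.
  by apply/funext => t; rewrite mxE.
by apply: measurable_sum => m'; exact: measurable_funM.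
Qed.

(** In the product, column [j] is a nonzero multiple of itself plus columns of smaller key, hence a
    triangular substitution. The free [key] covers upper and lower triangular matrices at once. *)
Lemma AE_mul_triangular (key : nat -> nat) (Q : set cspace) (T : 'M[R]_k) x :
  measurable Q -> full_only Q -> (forall j, T j j != 0) ->
  (forall m j : 'I_k, m != j -> ~~ (key m < key j)%N -> T m j = 0) ->
  AE F Q x -> AE F (fun z => Q (coords (mat z *m T) (trl z))) x.
Proof.
move=> mQ fQ T0 Tk.
pose kap (c : coord) := if (c.2 < k)%N then key c.2 else 0%N.
pose al (c : coord) (z : cspace) : R := if (c.2 < k)%N then T (inord c.2) (inord c.2) else 1.
pose be (c : coord) (z : cspace) : R :=
  if (c.2 < k)%N then \sum_(m < k | m != inord c.2) z (c.1, nat_of_ord m) * T m (inord c.2) else 0.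
apply: (@AE_subst_key _ kap F (0%N, 0%N) Q _ al be) => //.
- exact: uniq_full.
- have mf : measurable_fun setT (fun z : cspace => coords (mat z *m T) (trl z)).
    apply: measurable_coords => [i j|i]; last exact: measurable_trl.
    by apply: measurable_mulmx => i' j' //; exact: measurable_mat.
  by have := mf measurableT Q mQ; rewrite setTI.
- split; last by move=> [i j] z _; rewrite /al /=; case: ifP.
  move=> [i j] z z' cl zz'; rewrite /al /be /=; split=> //; case: ifP => // jk.
  apply: eq_bigr => m mj; have [lt|nlt] := boolP (key m < key (inord j : 'I_k))%N.
    by rewrite zz'//; right; rewrite /kap /= ltn_ord jk; move: lt; rewrite inordK.
  by rewrite Tk// !mulr0.
move=> z _ _; apply: fQ => -[i j] cF; rewrite cF.
move: cF; rewrite mem_full => /andP[ik]; rewrite ltnS leq_eqVlt => /orP[/eqP ->|jk].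
  by rewrite /al /be /coords /= ltnn ik eqxx mul1r addr0 mxE inordK.
rewrite /al /be /coords /= jk ik [RHS]mxE [RHS](bigD1 (inord j))//= mxE !inordK// mulrC.
by congr (_ + _); apply: eq_bigr => m _; rewrite mxE inordK.
Qed.

Lemma AE_shear (Q : set cspace) (w : 'cV[R]_k) x :
  measurable Q -> full_only Q ->
  AE F Q x -> AE F (fun z => Q (coords (mat z) (trl z + mat z *m w))) x.
Proof.
move=> mQ fQ.
pose al (c : coord) (z : cspace) : R := 1.
pose be (c : coord) (z : cspace) : R :=
  if (c.2 == k)%N then \sum_(m < k) z (c.1, nat_of_ord m) * w m ord0 else 0.
apply: (@AE_subst_key _ (fun c => c.2) F (0%N, 0%N) Q _ al be) => //.
- exact: uniq_full.
- have mf : measurable_fun setT (fun z : cspace => coords (mat z) (trl z + mat z *m w)).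
    apply: measurable_coords => [i j|i]; first exact: measurable_mat.
    rewrite (_ : (fun z => _) = fun z => trl z i ord0 + (mat z *m w) i ord0); last first.
      by apply/funext => z; rewrite [in LHS]mxE.
    apply: measurable_funD; first exact: measurable_trl.
    by apply: measurable_mulmx => i' j' //; exact: measurable_mat.
  by have := mf measurableT Q mQ; rewrite setTI.
- split; last by move=> c z _; exact: oner_neq0.
  move=> [i j] z z' cl zz'; rewrite /al /be /=; split=> //; case: eqP => // jk.
  by apply: eq_bigr => m _; rewrite zz'//; right; rewrite /= jk.
move=> z _ _; apply: fQ => -[i j] cF; rewrite cF.
move: cF; rewrite mem_full => /andP[ik]; rewrite ltnS leq_eqVlt => /orP[/eqP ->|jk].
  rewrite /al /be /coords /= ltnn ik eqxx mul1r !mxE inordK//; congr (_ + _).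
  by apply: eq_bigr => m _; rewrite mxE inordK.
by rewrite /al /be /coords /= jk ik (ltn_eqF jk) mul1r addr0 mxE !inordK.
Qed.

Definition column_symmetric (Q : set cspace) := forall (s : 'S_k) A v,
  Q (coords A v) -> Q (coords (A *m perm_mx s) v).

(** The LUP decomposition of the transpose, transposed back, so that the permutation acts last and
    on columns. *)
Lemma mxLUP (h : 'M[R]_k) : h \in unitmx -> exists (T1 T2 : 'M[R]_k) (s : 'S_k),
  [/\ h = T1 *m T2 *m perm_mx s, forall j, T1 j j != 0, forall j, T2 j j != 0,
      (forall m j : 'I_k, (m < j)%N -> T1 m j = 0) &
      (forall m j : 'I_k, (j < m)%N -> T2 m j = 0)].
Proof.
move=> uh.
have := cormen_lup_correct h^T; have := cormen_lup_perm h^T.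
have := cormen_lup_lower h^T; have := cormen_lup_upper h^T; have := cormen_lup_detL h^T.
case: (cormen_lup h^T) => [[P L] U] /= dL uU lL /is_perm_mxP[s ->] E.
have hE : h = U^T *m L^T *m perm_mx s.
  apply: trmx_inj; rewrite trmx_mul trmx_mul !trmxK tr_perm_mx.
  rewrite -[L *m U]/(L * U) -E -[perm_mx s * h^T]/(perm_mx s *m h^T) mulmxA.
  by rewrite -perm_mxM mulVg perm_mx1 mul1mx.
exists U^T, L^T, s; split => //.
- move=> j; rewrite mxE; apply/eqP => Ujj.
  have : \det h = 0.
    rewrite hE !det_mulmx (det_trig (A := U^T)).
      by rewrite (bigD1 j)//= mxE Ujj !mul0r.
    by apply/is_trig_mxP => a b ab; rewrite mxE uU.
  by move=> d0; move: uh; rewrite unitmxE d0 unitr0.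
- by move=> j; rewrite mxE lL// eqxx oner_neq0.
- by move=> m j mj; rewrite mxE uU.
- by move=> m j jm; rewrite mxE lL ?(ltnW jm)// -val_eqE /= (ltn_eqF jm).
Qed.

Lemma full_only_mul (Q : set cspace) (T : 'M[R]_k) : full_only Q ->
  full_only (fun z => Q (coords (mat z *m T) (trl z))).
Proof.
move=> fQ z z' zz'.
have -> : mat z' = mat z.
  by apply/matrixP => i j; rewrite !mxE zz'// mem_full ltn_ord ltnW// ltnS ltn_ord.
suff -> : trl z' = trl z by [].
by apply/colP => i; rewrite !mxE zz'// mem_full ltn_ord /=.
Qed.

Lemma measurable_mul (Q : set cspace) (T : 'M[R]_k) : measurable Q ->
  measurable [set z | Q (coords (mat z *m T) (trl z))].
Proof.
move=> mQ.
have mf : measurable_fun setT (fun z : cspace => coords (mat z *m T) (trl z)).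
  apply: measurable_coords => [i j|i]; last exact: measurable_trl.
  by apply: measurable_mulmx => i' j' //; exact: measurable_mat.
by have := mf measurableT Q mQ; rewrite setTI.
Qed.

(** The matrix [h] is factored into two triangular matrices, which are substitutions, and a
    permutation of columns, under which [Q] is invariant. This passes from the integer lattice to an
    arbitrary fixed grid. *)
Lemma AE_affine (Q : set cspace) (h : 'M[R]_k) (w : 'cV[R]_k) x : measurable Q ->
  full_only Q -> column_symmetric Q -> h \in unitmx -> AE F Q x ->
  AE F (fun z => Q (coords (mat z *m h) (trl z + mat z *m w))) x.
Proof.
move=> mQ fQ sQ uh; have [T1 [T2 [s [hE d1 d2 t1 t2]]]] := mxLUP uh.
move=> h1.
have h2 : AE F (fun z => Q (coords (mat z *m T2) (trl z))) x.
  apply: (@AE_mul_triangular id) => // m j mj; rewrite -leqNgt leq_eqVlt.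
  move=> /orP[/eqP jm|]; last exact: t2.
  by move: mj; rewrite -val_eqE /= -jm eqxx.
have h3 := @AE_mul_triangular (fun j => k - j)%N _ T1 x (@measurable_mul Q T2 mQ) (@full_only_mul Q T2 fQ) d1 _ h2.
have {}h3 : AE F (fun z => Q (coords (mat z *m T1 *m T2) (trl z))) x.
  apply: AE_imp (h3 _) => [z|m j mj].
    by rewrite /= mat_coords trl_coords.
  rewrite -leqNgt => le; apply: t1; rewrite ltn_neqAle (_ : (m != j :> nat))//=.
  by move: le (ltn_ord m) (ltn_ord j) => /=; lia.
have h4 := AE_shear w (@measurable_mul Q (T1 *m T2) mQ) (@full_only_mul Q (T1 *m T2) fQ).
have {}h4 : AE F (fun z => Q (coords (mat z *m T1 *m T2) (trl z + mat z *m w))) x.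
  have h3' : AE F (fun z => Q (coords (mat z *m (T1 *m T2)) (trl z))) x.
    by apply: AE_imp h3 => z; rewrite mulmxA.
  by apply: AE_imp (h4 _ h3') => z; rewrite /= mat_coords trl_coords mulmxA.
by apply: AE_imp h4 => z /(sQ s); rewrite hE !mulmxA.
Qed.

End column_operations.

(** * Hits of a box as events about integer vectors *)

Section linear_forms.
Context {R : realType}.
Local Notation cspace := (@cspace R).

Definition lform (n : nat) (z : cspace) (i : nat) (q : nat -> int) : R :=
  \sum_(j < n) z (i, nat_of_ord j) * (q j)%:~R.

Lemma measurable_lform n i q : measurable_fun setT (fun z : cspace => lform n z i q).
Proof.
by apply: measurable_sum => j; apply: measurable_funM => //; exact: measurable_coord.
Qed.

Lemma eq_lform n (z z' : cspace) i q q' :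
  (forall j, (j < n)%N -> z (i, j) = z' (i, j)) -> (forall j, (j < n)%N -> q j = q' j) ->
  lform n z i q = lform n z' i q'.
Proof. by move=> zz' qq'; apply: eq_bigr => j _; rewrite zz'// qq'. Qed.

Lemma lform_reduced k n (z : cspace) i q : (k <= n)%N -> (i < k)%N ->
  reduced_base k n k z -> lform n z i q = (q i)%:~R + tl n i q z.
Proof.
move=> kn ik bz; rewrite /lform /tl -(big_mkord xpredT (fun j => z (i, j) * (q j)%:~R)).
have i_n : (i < n)%N by exact: leq_trans kn.
rewrite [LHS](big_cat_nat (n := i)) ?(ltnW i_n)//= [X in _ + X = _]big_ltn// addrA; congr (_ + _).
rewrite big_nat big1 ?add0r; last first.
  move=> j /andP[_ ji]; rewrite bz ?(ltn_trans ji)// ?(gtn_eqF ji) ?mul0r//.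
  by rewrite /reduced /= ik (leqNgt k) ik /= ltnNge (ltnW ji).
by rewrite bz// ?eqxx ?mul1r// /reduced /= ltnn andbF (leqNgt k) ik.
Qed.

(** The predicate [P] tells the two uses apart: points of an affine lattice ([translate]) and
    nonzero points of a lattice ([nontrivial]). *)
Definition hit (n k : nat) (P : set (nat -> int)) (b : nat -> R) (z : cspace) : Prop :=
  exists2 q, P q & forall r, (r < k)%N -> `|lform n z r q| <= b r.

Definition local_pred (n : nat) (P : set (nat -> int)) :=
  forall q q', (forall j, (j < n)%N -> q j = q' j) -> P q -> P q'.

(** Only the first [n] values of [q] matter, so the event is a union over finite integer sequences,
    which are countably many. *)
Lemma measurable_hit n k P b : local_pred n P -> measurable [set z | hit n k P b z].
Proof.
move=> lP.
pose A (s : seq int) := [set z : cspace | P (nth 0 s) /\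
  forall r, (r < k)%N -> `|lform n z r (nth 0 s)| <= b r].
have -> : [set z | hit n k P b z] = \bigcup_s A s.
  apply/seteqP; split => z /=; last by move=> [s _ [Ps hs]]; exists (nth 0 s).
  move=> [q Pq hq]; exists (mkseq q n) => //=.
  have E j : (j < n)%N -> q j = nth 0 (mkseq q n) j by move=> jn; rewrite nth_mkseq.
  split; first exact: lP Pq.
  by move=> r rk; rewrite -(eq_lform (z := z) (q := q))//; exact: hq.
apply: countable_bigcupT_measurable => [|s]; first exact: countableP.
have [Ps|nPs] := pselect (P (nth 0 s)); last first.
  rewrite (_ : A s = set0); first exact: measurable0.
  by apply/seteqP; split => // z [].
rewrite (_ : A s = \bigcap_r [set z : cspace | (r < k)%N -> `|lform n z r (nth 0 s)| <= b r]); last first.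
  apply/seteqP; split => z /=; first by move=> [_ h] r _; exact: h.
  by move=> h; split => // r rk; exact: h.
apply: bigcapT_measurable => r.
have [rk|rk] := boolP (r < k)%N; last first.
  by rewrite (_ : [set z | _] = setT); [exact: measurableT|apply/seteqP; split].
have ml := @measurable_lform n r (nth 0 s).
have := ml measurableT `[(- b r)%R, b r]%classic (measurable_itv _).
rewrite setTI; congr measurable; apply/seteqP; split => z /=; rewrite in_itv /= -ler_norml//.
exact.
Qed.

Lemma row_op_bound (k : nat) (a : R) (c : nat -> R) : exists2 M : nat,
  1 <= M.+1%:R :> R & forall i, (i < k)%N -> `|a^-1| <= M.+1%:R /\ 1 + `|c i * a^-1| <= M.+1%:R.
Proof.
pose S := `|a^-1| + 1 + \sum_(i < k) `|c i * a^-1|.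
exists (Num.truncn S); first by rewrite ler1n.
have Sc i : (i < k)%N -> `|c i * a^-1| <= \sum_(i < k) `|c i * a^-1|.
  move=> ik; rewrite (bigD1 (Ordinal ik))//= lerDl; exact: sumr_ge0.
have S0 : S < (Num.truncn S).+1%:R by exact: Num.Theory.truncnS_gt.
have a0 : 0 <= `|a^-1| by [].
have s0 : 0 <= \sum_(i < k) `|c i * a^-1| by exact: sumr_ge0.
by move=> i /Sc h; rewrite /S in S0 *; split; lra.
Qed.

(** Undoing the operation subtracts a multiple of the form in row [r] from the forms in lower rows,
    where the side is at least [b r]; the loss is the constant [M.+1]. *)
Lemma hit_row_op n k P (b : nat -> R) r (a : R) (c : nat -> R) (M : nat) (z z' : cspace) :
  (r < k)%N -> a != 0 -> (forall i, (i <= r)%N -> c i = 0) ->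
  (forall i, 0 <= b i) -> (forall i, (r <= i < k)%N -> b r <= b i) ->
  (forall i, (i < k)%N -> `|a^-1| <= M.+1%:R /\ 1 + `|c i * a^-1| <= M.+1%:R) ->
  (forall j, (j < n)%N -> z' (r, j) = a * z (r, j)) ->
  (forall i j, (i < k)%N -> (j < n)%N -> i != r -> z' (i, j) = z (i, j) + c i * z (r, j)) ->
  hit n k P (fun i => b i / M.+1%:R) z' -> hit n k P b z.
Proof.
move=> rk a0 c0 b0 brs bM zr zi [q Pq hq]; exists q => // i ik.
have M0 : 0 < M.+1%:R :> R by rewrite ltr0n.
have fr : lform n z' r q = a * lform n z r q.
  by rewrite /lform mulr_sumr; apply: eq_bigr => j _; rewrite zr// mulrA.
have fr' : lform n z r q = a^-1 * lform n z' r q by rewrite fr mulrA mulVf// mul1r.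
have [ir|ir] := eqVneq i r.
  rewrite ir fr' normrM; have [h1 _] := bM r rk.
  apply: le_trans (ler_pM _ _ h1 (hq r rk)) _ => //.
  by rewrite mulrC divfK// gt_eqF.
have fi : lform n z i q = lform n z' i q - c i * a^-1 * lform n z' r q.
  rewrite -mulrA -fr' /lform mulr_sumr -sumrB; apply: eq_bigr => j _.
  by rewrite zi// mulrDl mulrA addrK.
rewrite fi; apply: le_trans (ler_normB _ _) _; rewrite normrM.
have [_ h2] := bM i ik.
have [ltir|] := ltnP i r.
  rewrite c0 ?(ltnW ltir)// mul0r normr0 mul0r addr0.
  apply: le_trans (hq i ik) _; rewrite ler_pdivrMr// ler_peMr//.
  by rewrite c0 ?(ltnW ltir)// mul0r normr0 addr0 in h2.
move=> ri.
apply: (@le_trans _ _ (b i / M.+1%:R + `|c i * a^-1| * (b i / M.+1%:R))).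
  apply: lerD; first exact: hq.
  apply: ler_wpM2l => //; apply: le_trans (hq r rk) _.
  by rewrite ler_wpM2r ?invr_ge0 ?ler0n// brs// ri.
rewrite -[X in X + _]mul1r -mulrDl.
apply: le_trans (ler_wpM2r _ h2) _; first by rewrite divr_ge0.
by rewrite mulrC divfK// gt_eqF.
Qed.

Lemma lform_col_perm K n (A : 'M[R]_K.+1) (v : 'cV[R]_K.+1) (s : 'S_K.+1)
    (i : nat) (q q' : nat -> int) :
  (n = K.+1 \/ n = K.+2) -> (i < K.+1)%N ->
  (forall j : 'I_K.+1, q' (s j) = q j) -> q' K.+1 = q K.+1 ->
  lform n (coords (A *m perm_mx s) v) i q' = lform n (coords A v) i q.
Proof.
move=> nK iK qq' qK.
have E : \sum_(j < K.+1) coords (A *m perm_mx s) v (i, nat_of_ord j) * (q' j)%:~R =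
         \sum_(j < K.+1) coords A v (i, nat_of_ord j) * (q j)%:~R.
  rewrite (reindex_inj (@perm_inj _ s)) /=; apply: eq_bigr => j _; rewrite qq'; congr (_ * _).
  rewrite /coords /= iK !ltn_ord !inord_val [LHS]mxE (bigD1 j)//= !mxE eqxx mulr1 big1 ?addr0//.
  by move=> m mj; rewrite !mxE (inj_eq perm_inj) (negbTE mj) mulr0n mulr0.
case: nK => ->; first exact: E.
rewrite /lform big_ord_recr [RHS]big_ord_recr /= qK; congr (_ + _ * _).
  exact: E.
by rewrite /coords /= iK ltnn eqxx.
Qed.

End linear_forms.

(** * Eventual and frequent hits for almost every matrix *)

Section almost_every_matrix.
Context {R : realType}.
Local Notation cspace := (@cspace R).
Local Notation leb := (@lebesgue_measure R).
Variables (K : nat) (sg : nat -> R) (de : R) (rr : nat -> R).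
Local Notation k := K.+1.
Hypothesis sg_sorted : forall i j, (i <= j)%N -> (j < k)%N -> sg i <= sg j.
Hypothesis rr0 : forall t, 0 <= rr t.

Let bx t i := ebox sg rr t i.
Let bx0 t i : 0 <= bx t i. Proof. by rewrite mulr_ge0 ?expR_ge0. Qed.
Let bx_sorted t i j : (i <= j)%N -> (j < k)%N -> bx t i <= bx t j.
Proof.
by move=> ij jk; rewrite ler_wpM2r// ler_expR ler_wpM2r// sg_sorted.
Qed.

(* Column [k] of [z] is a translation, so [q k = 1] selects points of an affine lattice. *)
Definition translate : set (nat -> int) := [set q | q k = 1].
Definition nontrivial : set (nat -> int) := [set q | exists2 j, (j < k)%N & q j != 0].

Lemma local_translate : local_pred k.+1 translate.
Proof. by move=> q q' qq' qk; rewrite /translate /= -qq'. Qed.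

Lemma local_nontrivial : local_pred k nontrivial.
Proof. by move=> q q' qq' [j jk qj]; exists j => //; rewrite -qq'. Qed.

(** Asking for every scale [c] makes the event insensitive to constant factors, and thus invariant
    under row operations. The same device is used in [often_hit]. *)
Definition eventually_hit : set cspace := [set z | forall c : nat, exists N : nat,
  forall t, (N <= t)%N -> hit k.+1 k translate (fun i => bx t i / c.+1%:R) z].

Definition often_hit : set cspace := [set z | forall c N : nat,
  exists2 t, (N <= t)%N & hit k k nontrivial (fun i => bx t i / c.+1%:R) z].

Lemma measurable_eventually_hit : measurable eventually_hit.
Proof.
rewrite (_ : eventually_hit = \bigcap_c \bigcup_N \bigcap_t [set z |
   (N <= t)%N -> hit k.+1 k translate (fun i => bx t i / c.+1%:R) z]); last first.
  apply/seteqP; split => z /= h c.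
    by move=> _; have [N hN] := h c; exists N => // t _; exact: hN.
  by have [N _ hN] := h c I; exists N => t; exact: hN.
apply: bigcapT_measurable => c; apply: bigcupT_measurable => N; apply: bigcapT_measurable => t.
have [Nt|Nt] := boolP (N <= t)%N; last first.
  by rewrite (_ : [set z | _] = setT); [exact: measurableT|apply/seteqP; split].
have := @measurable_hit R k.+1 k translate (fun i => bx t i / c.+1%:R) local_translate.
by congr measurable; apply/seteqP; split => z //=; exact.
Qed.

Lemma measurable_often_hit : measurable often_hit.
Proof.
rewrite (_ : often_hit = \bigcap_c \bigcap_N \bigcup_t [set z |
   (N <= t)%N /\ hit k k nontrivial (fun i => bx t i / c.+1%:R) z]); last first.
  apply/seteqP; split => z /= h c.
    by move=> _ N _; have [t Nt ht] := h c N; exists t.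
  by move=> N; have [t _ [Nt ht]] := h c I N I; exists t.
apply: bigcapT_measurable => c; apply: bigcapT_measurable => N; apply: bigcupT_measurable => t.
have [Nt|Nt] := boolP (N <= t)%N; last first.
  by rewrite (_ : [set z | _] = set0); [exact: measurable0|apply/seteqP; split => // z []].
have := @measurable_hit R k k nontrivial (fun i => bx t i / c.+1%:R) local_nontrivial.
by congr measurable; apply/seteqP; split => z //= [].
Qed.

Lemma row_invariant_eventually_hit r (a : R) (c : nat -> R) (z z' : cspace) :
  (r < k)%N -> a != 0 -> (forall i, (i <= r)%N -> c i = 0) ->
  (forall j, (j < k.+1)%N -> z' (r, j) = a * z (r, j)) ->
  (forall i j, (i < k)%N -> (j < k.+1)%N -> i != r -> z' (i, j) = z (i, j) + c i * z (r, j)) ->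
  eventually_hit z' -> eventually_hit z.
Proof.
move=> rk a0 c0 zr zi hz e.
have [M M1 bM] := row_op_bound k a c.
(* The predecessor compensates the successor in the scale: the boxes of [z'] are divided by exactly
   [e.+1 * M.+1]. *)
have [N hN] := hz (e.+1 * M.+1).-1; exists N => t Nt.
apply: (hit_row_op (r := r) rk a0 c0 _ _ bM zr zi).
- by move=> i; rewrite divr_ge0.
- by move=> i /andP[ri ik]; rewrite ler_wpM2r// bx_sorted.
have [q Pq hq] := hN t Nt; exists q => // i ik.
by apply: le_trans (hq i ik) _; rewrite prednK// natrM invfM mulrA.
Qed.

Lemma row_invariant_often_hit r (a : R) (c : nat -> R) (z z' : cspace) :
  (r < k)%N -> a != 0 -> (forall i, (i <= r)%N -> c i = 0) ->
  (forall j, (j < k)%N -> z' (r, j) = a * z (r, j)) ->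
  (forall i j, (i < k)%N -> (j < k)%N -> i != r -> z' (i, j) = z (i, j) + c i * z (r, j)) ->
  often_hit z' -> often_hit z.
Proof.
move=> rk a0 c0 zr zi hz e N.
have [M M1 bM] := row_op_bound k a c.
have [t Nt [q Pq hq]] := hz (e.+1 * M.+1).-1 N; exists t => //.
apply: (hit_row_op (r := r) rk a0 c0 _ _ bM zr zi).
- by move=> i; rewrite divr_ge0.
- by move=> i /andP[ri ik]; rewrite ler_wpM2r// bx_sorted.
exists q => // i ik.
by apply: le_trans (hq i ik) _; rewrite prednK// natrM invfM mulrA.
Qed.

Lemma perm_vector (s : 'S_k) (q : nat -> int) : exists q' : nat -> int,
  (forall j : 'I_k, q' (s j) = q j) /\ q' k = q k.
Proof.
exists (fun j => if (j < k)%N then q (s^-1 (inord j) : 'I_k)%g else q j); split.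
  by move=> j; rewrite ltn_ord inord_val permK.
by rewrite ltnn.
Qed.

Lemma column_symmetric_eventually_hit : column_symmetric K eventually_hit.
Proof.
move=> s A v h c; have [N hN] := h c; exists N => t Nt.
have [q /= qk hq] := hN t Nt; have [q' [q's q'k]] := perm_vector s q.
exists q' => [|i ik]; first by rewrite /translate /= q'k.
by rewrite (@lform_col_perm _ _ _ A v s i q q' (or_intror erefl) ik q's q'k); exact: hq.
Qed.

Lemma column_symmetric_often_hit : column_symmetric K often_hit.
Proof.
move=> s A v h c N; have [t Nt [q [j jk qj] hq]] := h c N; exists t => //.
have [q' [q's q'k]] := perm_vector s q.
exists q' => [|i ik].
  by exists (s (Ordinal jk)) => //; rewrite q's.
by rewrite (@lform_col_perm _ _ _ A v s i q q' (or_introl erefl) ik q's q'k); exact: hq.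
Qed.

Lemma full_only_eventually_hit : full_only K eventually_hit.
Proof.
move=> z z' zz' h c; have [N hN] := h c; exists N => t Nt.
have [q Pq hq] := hN t Nt; exists q => // i ik.
rewrite -(eq_lform (z := z) (q := q))//; first exact: hq.
by move=> j jk; rewrite zz'// mem_full ik.
Qed.

Lemma full_only_often_hit : full_only K often_hit.
Proof.
move=> z z' zz' h c N; have [t Nt [q Pq hq]] := h c N; exists t => //.
exists q => // i ik.
rewrite -(eq_lform (z := z) (q := q))//; first exact: hq.
by move=> j jk; rewrite zz'// mem_full ik ltnW.
Qed.

Lemma AE_eventually_hit x : (forall t, 0 < rr t) ->
  (forall t j, (j < k)%N -> \prod_(r < j) (2 * bx t r) <= 1) ->
  (\sum_(t <oo) ((\prod_(r < k) (2 * bx t r))^-1)%:E < +oo)%E ->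
  AE (full k k.+1) eventually_hit x.
Proof.
move=> rrp b1 fin.
apply: AE_full => //.
- exact: measurable_eventually_hit.
- exact: row_invariant_eventually_hit.
move=> {}x bxx; set l := free_coords k k.+1 k.
have ul : uniq l by exact: uniq_free_coords.
have upl i j : (i < j)%N -> (j < k.+1)%N -> (i, j) \in l.
  move=> ij jk; have ik : (i < k)%N by exact: leq_trans ij _.
  by rewrite mem_free_coords ik jk /reduced /= ik ij.
have h c : AE l (fun z => exists N, forall t, (N <= t)%N -> exists q : nat -> int,
    q k = 1%R /\ forall r, (r < k)%N -> `|(q r)%:~R + tl k.+1 r q z| <= bx t r / c.+1%:R) x.
  have c0 : 0 < c.+1%:R :> R by rewrite ltr0n.
  have c1 : c.+1%:R^-1 <= 1 :> R by rewrite invf_le1// ler1n.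
  apply: (AE_hit_eventually x ul upl (b := fun t r => bx t r / c.+1%:R)).
  - by move=> t r; rewrite divr_gt0// mulr_gt0 ?expR_gt0.
  - move=> t j jk; apply: le_trans (b1 t j jk).
    apply: ler_prod => r _; rewrite mulr_ge0 ?divr_ge0//=.
    by rewrite ler_wpM2l// ler_piMr.
  have pE t : (\prod_(r < k) (2 * (bx t r / c.+1%:R)))^-1 =
      c.+1%:R ^+ k * (\prod_(r < k) (2 * bx t r))^-1.
    have -> : \prod_(r < k) (2 * (bx t r / c.+1%:R)) = (\prod_(r < k) (2 * bx t r)) / c.+1%:R ^+ k.
      transitivity (\prod_(r < k) (2 * bx t r * c.+1%:R^-1)).
        by apply: eq_bigr => r _; rewrite mulrA.
      by rewrite big_split /= prodr_const card_ord exprVn.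
    by rewrite invfM invrK mulrC.
  under eq_eseriesr do rewrite pE EFinM.
  rewrite nneseriesZl; last first.
    by move=> t _; rewrite lee_fin invr_ge0 prodr_ge0// => r _; rewrite mulr_ge0.
  by rewrite lte_mul_pinfty ?lee_fin ?exprn_ge0.
have := AE_forall h; apply: AE_congr => z z' zz' zx zx' hz c.
have zE : z = z'.
  apply/funext => d; have [dl|dl] := boolP (d \in l); first by rewrite zz'.
  by rewrite zx// zx'.
have bz : reduced_base k k.+1 k z'.
  move=> i j ik jk nr; rewrite zx'; first exact: bxx.
  by rewrite mem_free_coords ik jk.
have [N hN] := hz c; exists N => t Nt; have [q [qk hq]] := hN t Nt.
exists q => // r rk; rewrite (lform_reduced _ _ rk bz)// -zE; exact: hq.
Qed.

(** From [q] the integer vector [(n + 1) * q - p * q_j * e_m] is formed; its image under the new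
    matrix is [n + 1] times the image of [q] under the old one, and the scale [c] absorbs the
    factor. *)
Lemma often_hit_column_op (m j n : nat) (p : int) (z z' : cspace) :
  (m < k)%N -> (j < k)%N -> m != j ->
  (forall i, (i < k)%N -> z' (i, j) = z (i, j) + p%:~R / n.+1%:R * z (i, m)) ->
  (forall i j', (i < k)%N -> (j' < k)%N -> j' != j -> z' (i, j') = z (i, j')) ->
  often_hit z -> often_hit z'.
Proof.
move=> mk jk mj zj zo hz c N.
have n0 : (n.+1%:R : R) != 0 by rewrite pnatr_eq0.
have [t Nt [q [j0 j0k qj0] hq]] := hz (c.+1 * n.+1).-1 N; exists t => //.
pose q' (i : nat) : int := n.+1%:Z * q i - (if i == m then p * q j else 0).
have fE i : (i < k)%N -> lform k z' i q' = n.+1%:R * lform k z i q.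
  move=> ik; pose ms := Ordinal mk; pose js := Ordinal jk.
  have msj : ms != js by rewrite -val_eqE.
  rewrite /lform (bigD1 js)//= (bigD1 ms)//= [in RHS](bigD1 js)//= [in RHS](bigD1 ms)//=.
  rewrite zj// (zo i m)// /q' eqxx eq_sym (negbTE mj) subr0 !mulrDr mulr_sumr.
  rewrite !addrA; congr (_ + _).
    rewrite rmorphB /= !rmorphM /= -!pmulrn; field.
    by rewrite addrC natr1.
  apply: eq_bigr => j' /andP[j'j j'm].
  have -> : (nat_of_ord j' == m) = false by apply/negbTE.
  rewrite subr0 rmorphM /= zo//; first by rewrite mulrCA.
exists q' => [|i ik].
  have [qj|qj] := eqVneq (q j) 0.
    by exists j0 => //; rewrite /q' qj mulr0 if_same subr0 mulf_neq0.
  by exists j => //; rewrite /q' [j == m]eq_sym (negbTE mj) subr0 mulf_neq0.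
rewrite fE// normrM normr_nat.
apply: le_trans (ler_wpM2l (ler0n _ _) (hq i ik)) _.
have c0 : (c.+1%:R : R) != 0 by rewrite pnatr_eq0.
have E (u v w : R) : u != 0 -> v != 0 -> v * (w / (u * v)) = w / u.
  by move=> u0 v0; field; rewrite u0.
by rewrite prednK// natrM E.
Qed.

(** A key that puts lower rows first and orders each row from left to right. *)
Definition rows_down (c : coord) : nat := ((k - c.1) * k.+1 + c.2)%N.

Lemma rows_down_lt r m j j' : (r < m)%N -> (m < k)%N -> (j' < k)%N ->
  (rows_down (m, j') < rows_down (r, j))%N.
Proof.
move=> rm mk j'k; rewrite /rows_down /=.
have : ((k - m).+1 * k.+1 <= (k - r) * k.+1)%N by rewrite leq_mul2r /=; lia.
by rewrite mulSn; lia.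
Qed.

(** Induction on the entries. Adding a rational multiple [s] of column [m] to column [j] moves the
    entry [(m, j)] by [s], since the diagonal is 1. It does not affect the entries of column [j]
    below row [m], where column [m] vanishes, and it changes those above, which are integrated
    later, by a substitution. Hence the set [C] of good values of [(m, j)] is invariant under
    rational translations. *)
Lemma often_hit_zero_one (l : seq coord) x : uniq l ->
  sorted (relpre rows_down leq) l -> reduced_base k k k x ->
  (forall i j, (i, j) \in l -> (i < j < k)%N) ->
  (forall m j r, (m, j) \in l -> (r < m)%N -> (r, j) \in l) ->
  AE l often_hit x \/ AE l (fun z => ~ often_hit z) x.
Proof.
have mG := measurable_often_hit.
elim: l x => [|[m j] l ih] x; first by move=> *; have [|] := pselect (often_hit x); [left|right].
move=> /= /andP[cl ul] pl bx_ lt clo.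
have sl : sorted (relpre rows_down leq) l by exact: path_sorted pl.
have tr : transitive (relpre rows_down leq) by move=> b a e /=; exact: leq_trans.
have [mj jk] : (m < j)%N /\ (j < k)%N by apply/andP; apply: lt; exact: mem_head.
have mk : (m < k)%N by exact: ltn_trans jk.
have lt' i j' : (i, j') \in l -> (i < j' < k)%N by move=> h; apply: lt; rewrite in_cons h orbT.
have after d : d \in l -> (rows_down (m, j) <= rows_down d)%N.
  by move=> dl; have := order_path_min tr pl => /allP/(_ d dl).
have clo' m' j' r : (m', j') \in l -> (r < m')%N -> (r, j') \in l.
  move=> m'l rm'; have := clo m' j' r; rewrite in_cons m'l orbT => /(_ isT rm').
  rewrite in_cons => /orP[/eqP [er ej]|//].
  have := after _ m'l; have /andP[m'j' j'k] := lt' _ _ m'l.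
  by rewrite leqNgt -er -ej rows_down_lt// (ltn_trans m'j').
have bxy y : reduced_base k k k (upd x (m, j) y).
  move=> i j' ik j'k nr; rewrite upd_neq ?bx_//.
  by apply: contra nr => /eqP [-> ->]; rewrite /reduced /= mk mj.
have IH y := ih (upd x (m, j) y) ul sl (bxy y) lt' clo'.
pose C : set R := [set y | AE l often_hit (upd x (m, j) y)].
have mC : measurable C.
  have m1 : measurable_fun setT (fun z => (\1_(~` often_hit) z)%:E : \bar R).
    by apply/measurable_EFinP; apply: measurable_indic; exact: measurableC.
  have p1 z : (0 <= (\1_(~` often_hit) z)%:E :> \bar R)%E by rewrite lee_fin.
  have := @measurable_it_int_upd R l _ x (m, j) m1 p1 measurableT [set 0%E] (emeasurable_set1 0%E).
  rewrite setTI; congr measurable; apply/seteqP; split => y /=.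
    move=> h; have /(AE_it_int l (upd x (m, j) y) (measurableC mG)) := h.
    by apply: AE_imp => z /contrapT.
  move=> h; apply/(AE_it_int l (upd x (m, j) y) (measurableC mG)).
  by apply: AE_imp h => z hz; exact.
have trC (n : nat) (p : int) y : C y -> C (y + p%:~R / n.+1%:R).
  rewrite /C /= => h; set s := p%:~R / n.+1%:R.
  (* Subtracts in advance what the column operation will add to the entries of column [j] above row
     [m]. *)
  pose be (c : coord) (z : cspace) : R :=
    if (c.2 == j) && (c.1 < m)%N then - (s * z (c.1, m)) else 0.
  have tri : triangular rows_down l (fun _ _ => 1) be.
    split=> [[r j'] z z' cl' zz'|c z _]; last exact: oner_neq0.
    split=> //; rewrite /be /=; case: ifP => // /andP[/eqP j'j rm].
    by rewrite zz'//; right; rewrite /rows_down /= j'j ltn_add2l.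
  have := AE_subst_sorted sl ul tri h; apply: AE_congr => z z' zz' zx zx'.
  have zmm : z' (m, m) = 1.
    rewrite zx'; first by rewrite upd_neq ?bx_ ?eqxx// ?xpair_eqE ?eqxx ?(ltn_eqF mj)// /reduced /= ltnn andbF (leqNgt k) mk.
    by apply/negP => /lt'; rewrite ltnn.
  have zout c : c \notin l -> c != (m, j) -> z c = z' c.
    by move=> cl' cm; rewrite zx// zx'// !upd_neq.
  have zall c : c != (m, j) -> z c = z' c.
    by move=> cm; have [cl'|cl'] := boolP (c \in l); [exact: zz'|exact: zout].
  apply: (@often_hit_column_op m j n p) => //.
  + by rewrite ltn_eqF.
  + move=> i ik; rewrite /be /= eqxx !mul1r -/s.
    have im : ((i, m) == (m, j)) = false.
      by rewrite xpair_eqE (ltn_eqF mj) andbF.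
    have [im'|mi|->] := ltngtP i m.
    * have := clo m j i (mem_head _ _) im'.
      rewrite in_cons xpair_eqE (ltn_eqF im') /= => il.
      rewrite il (ltn_eqF mj) /= addr0 if_same subrK zall// xpair_eqE (ltn_eqF im')//.
    * have iml : (i, m) \notin l by apply/negP => /lt'; rewrite ltnNge (ltnW mi).
      have zim : z (i, m) = 0.
        rewrite zx// upd_neq ?im// bx_ ?(gtn_eqF mi)//.
        by rewrite /reduced /= (leqNgt k) ik /= ltnNge (ltnW mi).
      rewrite (negbTE iml) zim mulr0 !addr0 if_same zall// xpair_eqE (gtn_eqF mi)//.
    * rewrite (negbTE cl) (ltn_eqF mj) /= addr0 if_same (zall (m, m)); last first.
        by rewrite xpair_eqE (ltn_eqF mj) andbF.
      by rewrite zmm mulr1 zx// zx'// !updE.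
  + move=> i j' ik j'k j'j; rewrite /be /= (negbTE j'j) /= mul1r addr0 if_same zall//.
    by rewrite xpair_eqE (negbTE j'j) andbF.
have [C0|C0] := zero_one_translation mC trC.
  right; have nC : leb.-negligible C by apply/(lebesgue_negligibleP mC).
  apply: negligibleS nC => y /= ny; have [h|h] := IH y; first exact: h.
  by exfalso; exact: ny.
left; have nC : leb.-negligible (~` C) by apply/(lebesgue_negligibleP (measurableC mC)).
exact: negligibleS nC.
Qed.

End almost_every_matrix.

Section often_hit_almost_surely.
Context {R : realType}.
Local Notation cspace := (@cspace R).
Variables (K : nat) (sg : nat -> R) (de : R) (rr : nat -> R) (et : R).
Local Notation k := K.+2.
Hypothesis sg_sorted : forall i j, (i <= j)%N -> (j < k)%N -> sg i <= sg j.
Hypothesis de0 : 0 < de.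
Hypothesis sg_sum : \sum_(r < k) sg r = 0.
Hypothesis sg_part : forall j, (0 < j < k)%N -> \sum_(r < j) sg r <= - de.
Hypothesis et_lt : et < sg K.+1.
Hypothesis rr01 : forall t, 0 <= rr t <= 1.
Hypothesis rr_large : forall t, rr t = 0 \/ expR (- (et * t%:R)) <= rr t.
Hypothesis rr_div : forall B, exists T, B <= \sum_(t < T) rr t ^+ k.

Let rr0 t : 0 <= rr t. Proof. by have /andP[] := rr01 t. Qed.

(** By the zero-one law for unipotent matrices it suffices to exclude the null alternative, which
    [hits_io_positive] does. *)
Lemma AE_often_hit_square x : AE (full k k) (often_hit K.+1 sg rr) x.
Proof.
apply: AE_full => //; first exact: measurable_often_hit.
  exact: row_invariant_often_hit.
move=> {}x bx.
pose l := sort (relpre (rows_down K.+1) leq) (free_coords k k k).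
have ul : uniq l by rewrite sort_uniq uniq_free_coords.
have ml i j : ((i, j) \in l) = (i < j < k)%N.
  rewrite mem_sort mem_free_coords /reduced /=.
  by apply/idP/idP; lia.
suff : AE l (often_hit K.+1 sg rr) x.
  by apply: AE_perm => //; [exact: measurable_often_hit|rewrite perm_sort].
have [//|nG] : AE l (often_hit K.+1 sg rr) x \/ AE l (fun z => ~ often_hit K.+1 sg rr z) x.
  apply: often_hit_zero_one => //.
  - by apply: sort_sorted => c d; exact: leq_total.
  - by move=> i j; rewrite ml.
  - by move=> m j r; rewrite !ml => /andP[mj ->] rm; rewrite (ltn_trans rm).
exfalso.
have upl i j : (i < j)%N -> (j < K.+2)%N -> (i, j) \in l by rewrite ml => -> ->.
apply: (hits_io_positive (x := x) ul upl de0 sg_sum sg_part et_lt rr01 rr_large rr_div).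
move: nG; apply: AE_congr => z z' zz' zx zx' nz hz; apply: nz => c N.
have bz : reduced_base k k k z.
  move=> i j ik jk nr; rewrite zx; first exact: bx.
  rewrite ml; apply: contra nr => /andP[ij _]; by rewrite /reduced /= ik ij.
have zE : z = z'.
  apply/funext => d; have [dl|dl] := boolP (d \in l); first by rewrite zz'.
  by rewrite zx// zx'.
have [t Nt [q [q1 q2 q3]]] := hz c N; exists t => //.
exists q => [|r rk]; first by exists K.+1.
rewrite (lform_reduced _ _ rk bz)// zE.
move: rk; rewrite ltnS leq_eqVlt => /orP[/eqP ->|]; last by rewrite ltnS; exact: q3.
by rewrite /tl big_geq// addr0.
Qed.

Lemma AE_often_hit x : AE (full k k.+1) (often_hit K.+1 sg rr) x.
Proof.
pose W := [seq (i, k) | i <- iota 0 k].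
have ul : uniq (W ++ full k k).
  rewrite cat_uniq uniq_full andbT; apply/andP; split.
    by rewrite map_inj_uniq ?iota_uniq// => i j [].
  apply/hasPn => -[i j]; rewrite mem_full => /andP[ik jk].
  by apply/mapP => -[i' _ [_ ej]]; rewrite ej ltnn in jk.
apply: (@AE_perm _ (W ++ full k k)) => //; first exact: measurable_often_hit.
  apply: uniq_perm => //; first exact: uniq_full.
  move=> [i j]; rewrite mem_cat !mem_full; apply/orP/andP.
    case=> [/mapP[i']|/andP[ik jk]]; last by rewrite ik ltnW.
    by rewrite mem_iota add0n => /andP[_ i'k] [-> ->].
  move=> [ik]; rewrite ltnS leq_eqVlt => /orP[/eqP ->|jk]; [left|right].
    by apply: map_f; rewrite mem_iota add0n.
  by rewrite ik.
by rewrite AE_cat; apply: AE_true => z; exact: AE_often_hit_square.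
Qed.

End often_hit_almost_surely.

(** * Grids *)

Section matrix_norm.
Context {R : realType}.

Lemma mx_norm_le m n (x : 'M[R]_(m, n)) c : 0 <= c ->
  (forall i j, `|x i j| <= c) -> `|x| <= c.
Proof.
move=> c0 h; rewrite [`|x|]mx_normrE; apply: bigmax_le => // -[i j] _; exact: h.
Qed.

Lemma mx_norm_lt m n (x : 'M[R]_(m, n)) c : 0 < c ->
  (forall i j, `|x i j| < c) -> `|x| < c.
Proof.
move=> c0 h; rewrite [`|x|]mx_normrE; apply: bigmax_lt => // -[i j] _; exact: h.
Qed.

Lemma mx_norm_ge m n (x : 'M[R]_(m, n)) i j : `|x i j| <= `|x|.
Proof.
by rewrite [`|x|]mx_normrE; exact: (le_bigmax _ (fun ij => `|x ij.1 ij.2|) (i, j)).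
Qed.

Lemma mx_entryB m n (A B : 'M[R]_(m, n)) i j : (A - B) i j = A i j - B i j.
Proof. by rewrite !mxE. Qed.

Lemma mx_entryD m n (A B : 'M[R]_(m, n)) i j : (A + B) i j = A i j + B i j.
Proof. by rewrite !mxE. Qed.

Definition mx_sum m n (A : 'M[R]_(m, n)) : R := \sum_i \sum_j `|A i j|.

Lemma mx_sum_ge0 m n (A : 'M[R]_(m, n)) : 0 <= mx_sum A.
Proof. by apply: sumr_ge0 => i _; apply: sumr_ge0. Qed.

Lemma mulmx_entry_le m n (A : 'M[R]_(m, n)) (v : 'cV[R]_n) e i :
  (forall j, `|v j ord0| <= e) -> `|(A *m v) i ord0| <= (\sum_j `|A i j|) * e.
Proof.
move=> h; rewrite mxE; apply: le_trans (ler_norm_sum _ _ _) _.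
by rewrite mulr_suml; apply: ler_sum => j _; rewrite normrM ler_wpM2l.
Qed.

Lemma mx_sum_row m n (A : 'M[R]_(m, n)) i : \sum_j `|A i j| <= mx_sum A.
Proof.
rewrite /mx_sum [leRHS](bigD1 i)//= lerDl sumr_ge0// => i' _; exact: sumr_ge0.
Qed.

Lemma norm_mulmx m n (A : 'M[R]_(m, n)) (v : 'cV[R]_n) : `|A *m v| <= mx_sum A * `|v|.
Proof.
apply: mx_norm_le => [|i j]; first by rewrite mulr_ge0 ?mx_sum_ge0.
rewrite [j]ord1; apply: le_trans (mulmx_entry_le (e := `|v|) _ _ _) _.
  by move=> j'; exact: mx_norm_ge.
by rewrite ler_wpM2r// mx_sum_row.
Qed.

End matrix_norm.

Lemma cvg_bigsum (R : realType) (T I : Type) (F : set_system T) (FF : Filter F)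
    (r : seq I) (f : I -> T -> R) (l : I -> R) :
  (forall j, f j @ F --> l j) -> (fun x => \sum_(j <- r) f j x) @ F --> \sum_(j <- r) l j.
Proof.
move=> h; elim: r => [|j r ih].
  by rewrite big_nil; under eq_fun do rewrite big_nil; exact: cvg_cst.
by rewrite big_cons; under eq_fun do rewrite big_cons; exact: cvgD.
Qed.

Section grid_measurability.
Context {R : realType} {K : nat}.
Local Notation k := K.+1.
Local Notation grid := (grid R k).
Local Notation bgrid := (borel_grid R k).
Local Notation ASL := (ASL R k).

Definition meet (v0 : 'cV[R]_k) (e : R) : set grid :=
  [set L | exists2 v, grid_set L v & forall i, `|v i ord0 - v0 i ord0| < e].

Lemma continuous_affine_entry (n : 'cV[R]_k) i :
  continuous (fun a : ASL => affine_map a n i ord0).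
Proof.
have cv : continuous (fun a : SL R k => set_val a : 'M[R]_k) by exact: initial_continuous.
move=> a.
rewrite (_ : (fun a : ASL => _) = fun a : ASL =>
    \sum_j (set_val a.1 i j * n j ord0) + a.2 i ord0); last first.
  by apply/funext => b; rewrite /affine_map !mxE.
apply: cvgD; last first.
  apply: (@cvg_comp _ _ _ (fun a : ASL => a.2) (fun v : 'cV[R]_k => v i ord0) _ (nbhs a.2)).
    exact: cvg_snd.
  exact: coord_continuous.
apply: cvg_bigsum => j; apply: cvgM; last exact: cvg_cst.
apply: (@cvg_comp _ _ _ (fun a : ASL => a.1) (fun g : SL R k => set_val g i j) _ (nbhs a.1)).
  exact: cvg_fst.
apply: (@cvg_comp _ _ _ (fun g : SL R k => set_val g : 'M[R]_k) (fun M : 'M[R]_k => M i j) _ (nbhs (set_val a.1))).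
  exact: cv.
exact: coord_continuous.
Qed.

Lemma open_meet v0 e : open (meet v0 e).
Proof.
rewrite /open /= /grid_open /= openE => a /= [_ [n nZ <-] hn]; rewrite /interior.
have : \forall b \near a, forall i, `|affine_map b n i ord0 - v0 i ord0| < e.
  apply: (@filter_forall _ _ (fun i (b : ASL) => `|affine_map b n i ord0 - v0 i ord0| < e) (nbhs a) _) => i.
  apply: (@cvgr_lt _ _ (nbhs a) _ (fun a : ASL => `|affine_map a n i ord0 - v0 i ord0|)
            `|affine_map a n i ord0 - v0 i ord0|); last exact: hn.
  apply: cvg_norm; apply: cvgB; last exact: cvg_cst.
  exact: continuous_affine_entry.
apply: filterS => b hb /=.
by exists (affine_map b n) => //; exists n.
Qed.

Lemma measurable_meet v0 e : measurable (meet v0 e : set bgrid).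
Proof. by apply: sub_sigma_algebra; exact: open_meet. Qed.

Definition avoid (T : 'M[R]_k) (r : R) : set grid :=
  [set L | forall v, grid_set L v -> r <= `|T *m v|].

Lemma Delta_avoid (g : SL R k) (z : R) (L : grid) :
  (z%:E <= Delta (SL_act g L))%E <-> avoid (set_val g) (expR z) L.
Proof.
have e0 : 0 < expR z by exact: expR_gt0.
set S := [set (`|v|)%:E | v in grid_set (SL_act g L)].
have S0 : (0 <= ereal_inf S)%E by apply: le_ereal_inf_tmp => _ [v _ <-]; rewrite lee_fin.
have zE : z%:E = lne (expR z)%:E by rewrite lne_EFin// expRK.
rewrite /Delta -/S zE lee_lne ?in_itv/= ?leey ?andbT ?lee_fin ?expR_ge0//.
split => [h v Lv|h].
  rewrite -lee_fin; apply: le_trans h _; apply: ereal_inf_lbound.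
  exists (set_val g *m v) => //; exists v => //.
  by rewrite /affine_map /= addr0.
apply: le_ereal_inf_tmp => _ [_ [v Lv <-] <-].
by rewrite lee_fin /affine_map /= addr0; exact: h.
Qed.

Section joint.
Context {d : measure_display} {X : measurableType d}.
Variable a : X -> ASL.
Hypothesis ma1 : forall i j, measurable_fun setT (fun x => set_val (a x).1 i j : R).
Hypothesis ma2 : forall i, measurable_fun setT (fun x => (a x).2 i ord0 : R).

Lemma measurable_lt (f : X -> R) (r : R) : measurable_fun setT f ->
  measurable [set x | f x < r].
Proof.
move=> mf; have := mf measurableT `]-oo, r[%classic (measurable_itv _).
by rewrite setTI; congr measurable; apply/seteqP; split => x /=; rewrite in_itv.
Qed.

(** The complement is a countable union of rectangles: the grid meets a small cube with rational
    centre, and the affine map sends the whole cube into the ball of radius [r]. Joint measurability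
    is what Tonelli's theorem requires later. *)
Lemma measurable_avoid_joint (T : 'M[R]_k) (r : R) :
  measurable [set p : X * bgrid | avoid T r (ASL_act (a p.1) p.2)].
Proof.
rewrite -[X in measurable X]setCK; apply: measurableC.
(* Bounds the [i]-th entry of the image of any point of the cube of radius [1 / (n + 1)] about
   [v0]. *)
pose f x (v0 : 'cV[R]_k) (n : nat) i : R :=
  `|(T *m (set_val (a x).1 *m v0 + (a x).2)) i ord0| +
  (\sum_j `|(T *m set_val (a x).1) i j|) * n.+1%:R^-1.
pose rv (q : 'cV[rat]_k) : 'cV[R]_k := map_mx ratr q.
pose A (s : 'cV[rat]_k * nat) : set X := [set x | forall i, f x (rv s.1) s.2 i < r].
rewrite (_ : ~` _ = \bigcup_s (A s `*` (meet (rv s.1) s.2.+1%:R^-1 : set bgrid))); last first.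
  apply/seteqP; split => [[x L] /= nav|[x L] /= [[q n] _ [/= Ax [v Lv hv]]] av].
    have [u [Lu hu]] : exists v, grid_set L v /\ `|T *m affine_map (a x) v| < r.
      apply: contrapT => h; apply: nav => _ [v Lv <-].
      by rewrite leNgt; apply/negP => hr; apply: h; exists v.
    pose y := T *m affine_map (a x) u.
    pose S := mx_sum (T *m set_val (a x).1).
    have S0 : 0 <= S by exact: mx_sum_ge0.
    have [n hn] : exists n : nat, 2 * S / (r - `|y|) < n.+1%:R.
      exists (Num.truncn (2 * S / (r - `|y|))); exact: Num.Theory.truncnS_gt.
    have ry : 0 < r - `|y| by rewrite subr_gt0.
    have n0 : 0 < n.+1%:R :> R by rewrite ltr0n.
    have hn' : `|y| + 2 * S * n.+1%:R^-1 < r.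
      by rewrite addrC -ltrBrDr ltr_pdivrMr// [X in _ < X]mulrC -ltr_pdivrMr.
    have [q hq] : exists q : 'cV[rat]_k, forall i, `|u i ord0 - rv q i ord0| < n.+1%:R^-1.
      have h i : exists q : rat, `|u i ord0 - ratr q| < n.+1%:R^-1.
        have lt : u i ord0 - n.+1%:R^-1 < u i ord0 + n.+1%:R^-1.
          by rewrite ltrD2l gtrN ?invr_gt0.
        have [q] := rat_in_itvoo lt; rewrite in_itv /= => /andP[h1 h2].
        by exists q; rewrite ltr_distlC h1.
      exists (\col_i projT1 (cid (h i))) => i; rewrite !mxE.
      exact: (projT2 (cid (h i))).
    exists (q, n) => //=; split; last by exists u.
    move=> i; apply: le_lt_trans hn'; rewrite /f /=.
    have -> : T *m (set_val (a x).1 *m rv q + (a x).2) = y - (T *m set_val (a x).1) *m (u - rv q).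
      by rewrite /y /affine_map mulmxBr !mulmxDr !mulmxA opprB [RHS]addrC addrA subrK.
    have Si : \sum_j `|(T *m set_val (a x).1) i j| <= S.
      exact: mx_sum_row.
    have h1 : `|(y - T *m set_val (a x).1 *m (u - rv q)) i ord0| <= `|y| + S * n.+1%:R^-1.
      rewrite mx_entryB; apply: le_trans (ler_normB _ _) _; apply: lerD.
        exact: mx_norm_ge.
      apply: le_trans (mulmx_entry_le (e := n.+1%:R^-1) _ _ _) _.
        by move=> j; rewrite mx_entryB ltW.
      by rewrite ler_wpM2r ?invr_ge0 ?ler0n.
    apply: (@le_trans _ _ (`|y| + S * n.+1%:R^-1 + S * n.+1%:R^-1)).
      by apply: lerD => //; rewrite ler_wpM2r ?invr_ge0 ?ler0n.
    by rewrite -addrA -mulrDl mulr_natl mulr2n.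
  have Lv' : grid_set (ASL_act (a x) L) (affine_map (a x) v) by exists v.
  have := av _ Lv'; rewrite leNgt => /negP; apply.
  have r0 : 0 < r by apply: le_lt_trans (Ax ord0); rewrite /f addr_ge0// mulr_ge0 ?invr_ge0 ?sumr_ge0.
  apply: mx_norm_lt => // i j; rewrite [j]ord1; apply: le_lt_trans (Ax i); rewrite /f.
  have -> : T *m affine_map (a x) v = T *m (set_val (a x).1 *m rv q + (a x).2) +
      (T *m set_val (a x).1) *m (v - rv q).
    by rewrite /affine_map mulmxBr !mulmxDr !mulmxA [RHS]addrC addrA subrK.
  rewrite mx_entryD; apply: le_trans (ler_normD _ _) _; rewrite lerD2l.
  apply: mulmx_entry_le => j'; rewrite mx_entryB ltW//; exact: hv.
apply: countable_bigcupT_measurable => [|s]; first exact: countableP.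
apply: measurableX; last exact: measurable_meet.
rewrite (_ : A s = \bigcap_(i in [set: 'I_k]) [set x | f x (rv s.1) s.2 i < r]); last first.
  by apply/seteqP; split => x /= h i; [move=> _|]; exact: h.
apply: fin_bigcap_measurable => [|i _]; first exact: finite_finset.
apply: measurable_lt; apply: measurable_funD.
  apply: (measurableT_comp (@normr_measurable R setT)).
  apply: measurable_mulmx => [i' j'|i' j']; first exact: measurable_cst.
  rewrite [j']ord1 (_ : (fun t => _) = fun t => (set_val (a t).1 *m rv s.1) i' ord0 + (a t).2 i' ord0); last first.
    by apply/funext => t; rewrite [LHS]mxE.
  apply: measurable_funD; last exact: ma2.
  by apply: measurable_mulmx => i2 j2; [exact: ma1|exact: measurable_cst].
apply: measurable_funM; last exact: measurable_cst.
apply: measurable_sum => j; apply: (measurableT_comp (@normr_measurable R setT)).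
by apply: measurable_mulmx => i2 j2; [exact: measurable_cst|exact: ma1].
Qed.

End joint.

End grid_measurability.

(** * Averaging an invariant measure over random affine maps *)

Section averaging.
Context {R : realType}.
Local Notation cspace := (@cspace R).
Local Notation lam := (@lam R).
Local Notation RR := (measurableTypeR R).
Local Open Scope ereal_scope.

Section tonelli.
Context {d : measure_display} {T : measurableType d}.
Variables (m : {sigma_finite_measure set T -> \bar R}) (f : cspace -> T -> \bar R).
Hypothesis mf : measurable_fun setT (fun p : cspace * T => f p.1 p.2).
Hypothesis f0 : forall x t, 0 <= f x t.

Lemma measurable_it_int_joint l :
  measurable_fun setT (fun p : cspace * T => it_int l (f^~ p.2) p.1).
Proof.
elim: l => //= c l ih.
apply: (@measurable_fun_integralR _ _ (cspace * T)%type lam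
  (fun p y => it_int l (f^~ p.2) (upd p.1 c y))); last by move=> *; exact: it_int_ge0.
have m1 : measurable_fun setT (fun q : (cspace * T) * R => (q.1.1, q.2)).
  apply: measurable_fun_pair; last exact: measurable_snd.
  exact: (measurableT_comp measurable_fst measurable_fst).
have m2 : measurable_fun setT (fun q : (cspace * T) * R => (upd q.1.1 c q.2, q.1.2)).
  apply: measurable_fun_pair; first exact: (measurableT_comp (measurable_upd c) m1).
  exact: (measurableT_comp measurable_snd measurable_fst).
exact: (measurableT_comp ih m2).
Qed.

Lemma it_int_tonelli l x : it_int l (fun x => \int[m]_t f x t) x = \int[m]_t it_int l (f^~ t) x.
Proof.
elim: l x => //= c l ih x.
under eq_integral do rewrite ih.
rewrite (@tonelliR _ _ T lam m (fun y t => it_int l (f^~ t) (upd x c y)))//; last first.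
  by move=> *; exact: it_int_ge0.
have m1 : measurable_fun setT (fun q : R * T => (upd x c q.1, q.2)).
  apply: measurable_fun_pair; last exact: measurable_snd.
  exact: (measurableT_comp (measurable_upd2 x c) measurable_fst).
exact: (measurableT_comp (measurable_it_int_joint l) m1).
Qed.

End tonelli.

(** By invariance [mu B] is the measure of the grids sent into [B] by any single map [a x].
    Averaging over [x] and exchanging the integrals leaves, for each grid [L], an integral that
    vanishes by assumption. *)
Lemma invariant_measure_null k (mu : probability (borel_grid R k) R) (a : cspace -> ASL R k)
    (l : seq coord) (x0 : cspace) (B : set (borel_grid R k)) :
  ASL_invariant mu -> measurable B ->
  measurable [set p : cspace * borel_grid R k | B (ASL_act (a p.1) p.2)] ->
  (forall L : grid R k, AE l (fun x => ~ B (ASL_act (a x) L)) x0) -> mu B = 0.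
Proof.
move=> inv mB mS hB.
set S := [set p | _] in mS.
pose f (x : cspace) (L : borel_grid R k) : \bar R := (\1_S (x, L))%:E.
have mf : measurable_fun setT (fun p : cspace * borel_grid R k => f p.1 p.2).
  rewrite (_ : (fun p => _) = fun p => (\1_S p)%:E); last by apply/funext => -[].
  by apply/measurable_EFinP; exact: measurable_indic.
have f0 x L : 0 <= f x L by rewrite lee_fin.
have E1 x : \int[mu]_L f x L = mu B.
  have mx : measurable (xsection S x) by exact: measurable_xsection.
  rewrite -(inv (a x) B mB) (_ : _ @^-1` B = xsection S x); last first.
    by apply/seteqP; split => L /= h; [exact: mem_set|exact: set_mem].
  rewrite -[in RHS](setIT (xsection S x)) -integral_indic//; apply: eq_integral => L _.
  by rewrite /f !indicE mem_xsection.
have E2 : it_int l (fun x => \int[mu]_L f x L) x0 = mu B.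
  by under eq_it_int do rewrite E1; rewrite it_int_cst.
rewrite -E2 (it_int_tonelli mu mf f0).
apply: integral0_eq => L _.
have mL : measurable (ysection S L) by exact: measurable_ysection.
rewrite (_ : f^~ L = fun x => (\1_(ysection S L) x)%:E).
  by apply/(AE_it_int l x0 mL); apply: AE_imp (hB L) => x nB /= /set_mem.
by apply/funext => x; rewrite /f !indicE mem_ysection.
Qed.

End averaging.

(** * Exponents of the one-parameter subgroup *)

Section exponents.
Context {R : realType} {k : nat}.
Variable g : R -> SL R k.
Hypothesis g_subgroup : one_parameter_subgroup g.
Hypothesis g_diag : diagonalizable_subgroup g.
Hypothesis g_unbounded : unbounded_subgroup g.

Let G t : 'M[R]_k := set_val (g t).

Let GD s t : G (s + t) = G s *m G t.
Proof. by have [_ h] := g_subgroup; rewrite /G h. Qed.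

Let detG t : \det (G t) = 1.
Proof. exact: set_mem (valP (g t)). Qed.

(** Such a subgroup has period 1, so its image is that of the compact interval [[0, 1]] and is
    bounded. *)
Lemma trivial_at_one_bounded : (forall n : nat, G n%:R = 1%:M) -> False.
Proof.
move=> G1; apply: g_unbounded.
have [gc _] := g_subgroup.
have cG : continuous (fun t => `|G t|).
  move=> t; apply: cvg_norm.
  have cv : continuous (fun a : SL R k => set_val a : 'M[R]_k) by exact: initial_continuous.
  apply: (@cvg_comp _ _ _ g (fun a : SL R k => set_val a : 'M[R]_k) _ (nbhs (g t))).
    exact: gc.
  exact: (cv (g t)).
have [c _ hc] := @EVT_max R (fun t => `|G t|) 0 1 ler01 (continuous_subspaceT cG).
exists `|G c|; split; first exact: num_real.
move=> B cB _ [t _ <-]; apply: le_trans (ltW cB).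
rewrite -/(G t); have [f f01 ->] : exists2 f, f \in `[0, 1] & G t = G f.
  pose m := Num.floor t; exists (t - m%:~R).
    have := Num.Theory.floorD1_gt t; rewrite intrD -/m => h.
    by rewrite in_itv /= subr_ge0 floor_le_tmp lerBlDl; exact: ltW.
  have [n nm] : exists n : nat, m = n%:Z \/ m = - n%:Z.
    by case: m => n; [exists n; left|exists n.+1; right; rewrite NegzE].
  case: nm => ->.
    have E : G t = G (t - n%:R) *m G n%:R by rewrite -GD subrK.
    by rewrite -pmulrn E G1 mulmx1.
  by rewrite mulrNz opprK -pmulrn GD G1 mulmx1.
exact: hc.
Qed.

(** The exponents are logarithms of the eigenvalues at time 1, which determine the subgroup at the
    integer times in question. Determinant one makes them sum to zero; if all vanished, the subgroup
    would be trivial at integers and thus bounded. *)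
Lemma eigenvalues : exists P : 'M[R]_k, exists tau : 'I_k -> R,
  [/\ P \in unitmx, (forall t : nat, P *m G t%:R = diag_mx (\row_i expR (tau i * t%:R)) *m P),
      \sum_i tau i = 0 & exists i, tau i != 0].
Proof.
have [P uP hP] := g_diag.
have /choice[d dP] : forall t, exists d : 'rV[R]_k, P *m G t = diag_mx d *m P.
  move=> t; have /similar_diagPex[d hd] := hP t; exists d.
  exact: (elimT (similarP uP) hd).
have dD s t i : d (s + t) ord0 i = d s ord0 i * d t ord0 i.
  have : diag_mx (d (s + t)) = diag_mx (d s) *m diag_mx (d t).
    apply: (can_inj (mulmxK uP)).
    by rewrite -dP GD mulmxA dP -mulmxA dP mulmxA.
  rewrite mulmx_diag => /matrixP/(_ i i); rewrite !mxE eqxx !mulr1n.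
  by rewrite ?mxE.
have dprod t : \prod_i d t ord0 i = 1.
  have : \det (P *m G t) = \det (diag_mx (d t) *m P) by rewrite dP.
  rewrite !det_mulmx detG mulr1 det_diag => /esym.
  by rewrite -[RHS]mul1r; apply: mulIf; rewrite -unitfE -unitmxE.
have dneq0 t i : d t ord0 i != 0.
  apply/eqP => d0; have := dprod t; rewrite (bigD1 i)//= d0 mul0r => /eqP.
  by rewrite eq_sym oner_eq0.
(* The eigenvalue at time [t] is the square of the one at [t / 2], which excludes negative
   values. *)
have dpos t i : 0 < d t ord0 i.
  rewrite lt_neqAle eq_sym dneq0 /=.
  have -> : t = t / 2 + t / 2 by lra.
  by rewrite dD -expr2 sqr_ge0.
pose tau i := ln (d 1 ord0 i).
have d0 i : d 0 ord0 i = 1.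
  have := dD 0 0 i; rewrite addr0 -[LHS]mulr1; move/(mulfI (dneq0 0 i)).
  by move=> <-.
have dn (n : nat) i : d n%:R ord0 i = expR (tau i * n%:R).
  elim: n => [|n ih]; first by rewrite d0 mulr0 expR0.
  by rewrite -natr1 dD ih mulrDr mulr1 expRD [in RHS]lnK ?posrE.
have dE (n : nat) : d n%:R = \row_i expR (tau i * n%:R).
  by apply/rowP => i; rewrite mxE dn.
exists P, tau; split => //.
- by move=> t; rewrite dP dE.
- apply: (@expR_inj R); rewrite expR0 expR_sum -[RHS](dprod 1).
  by apply: eq_bigr => i _; rewrite lnK ?posrE.
apply: contrapT => h; apply: trivial_at_one_bounded => n.
have t0 i : tau i = 0 by apply/eqP; apply: contrapT => /negP ti; apply: h; exists i.
apply: (can_inj (mulKmx uP)); rewrite dP dE mulmx1.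
rewrite (_ : \row_i _ = const_mx 1); first by rewrite diag_const_mx mul1mx.
by apply/rowP => i; rewrite !mxE t0 mul0r expR0.
Qed.

Lemma sorting_perm (f : 'I_k -> R) :
  exists s : 'S_k, forall i j : 'I_k, (i <= j)%N -> f (s i) <= f (s j).
Proof.
pose t := sort_tuple (fun i j => f i <= f j) (ord_tuple k).
have pt : perm_eq t (ord_tuple k) by rewrite perm_sort.
have /tuple_permP[s sE] := pt.
exists s => i j ij.
have tot : total (fun i j : 'I_k => f i <= f j) by move=> a b; exact: le_total.
have tr : transitive (fun i j : 'I_k => f i <= f j) by move=> a b c; exact: le_trans.
have rf : reflexive (fun i j : 'I_k => f i <= f j) by move=> a; exact: lexx.
have st : sorted (fun i j => f i <= f j) t by exact: sort_sorted.
have tE a : nth i t a = nth i [tuple tnth (ord_tuple k) (s i) | i < k] a by rewrite sE.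
have sa (a : 'I_k) : nth i t a = s a.
  by rewrite tE -tnth_nth tnth_mktuple tnth_ord_tuple.
have := sorted_leq_nth tr rf i st i j.
rewrite !inE size_tuple !ltn_ord !sa; exact.
Qed.

(** The sign is a parameter because the two cases order oppositely: in the convergent case boxes for
    grid points have sides growing with the exponents of the inverse flow, in the divergent case
    boxes for dual vectors follow the flow itself. *)
Lemma sorted_exponents (neg : bool) : exists P : 'M[R]_k, exists sg : nat -> R,
  [/\ P \in unitmx,
      (forall (t : nat) (v : 'cV[R]_k) i, (P *m (G t%:R *m v)) i ord0 =
         expR ((-1) ^+ neg * sg i * t%:R) * (P *m v) i ord0),
      (forall i j, (i <= j)%N -> (j < k)%N -> sg i <= sg j),
      \sum_(i < k) sg i = 0 & exists2 i, (i < k)%N & sg i != 0].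
Proof.
have [P [tau [uP PG st [i0 ti0]]]] := eigenvalues.
have [s hs] := sorting_perm (fun i => (-1) ^+ neg * tau i).
pose sg (i : nat) : R := if insub i is Some j then (-1) ^+ neg * tau (s j) else 0.
have sgE (i : 'I_k) : sg i = (-1) ^+ neg * tau (s i) by rewrite /sg valK.
exists (row_perm s P), sg; split.
- by rewrite row_permE unitmx_mul unitmx_perm.
- move=> t v i.
  have E (w : 'cV[R]_k) : (row_perm s P *m w) i ord0 = (P *m w) (s i) ord0.
    by rewrite !mxE; apply: eq_bigr => j _; rewrite mxE.
  rewrite !E mulmxA PG -mulmxA mul_diag_mx mxE [(\row_ _ _) _ _]mxE sgE mulrA -signr_addb addbb mul1r.
  by [].
- move=> i j ij jk; have ik : (i < k)%N by exact: leq_ltn_trans jk.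
  have := hs (Ordinal ik) (Ordinal jk) ij.
  by rewrite -(sgE (Ordinal ik)) -(sgE (Ordinal jk)).
- under eq_bigr do rewrite sgE.
  have E : \sum_(i < k) tau (s i) = \sum_i tau i by rewrite [RHS](reindex_inj (@perm_inj _ s)).
  by rewrite -mulr_sumr E st mulr0.
exists (s^-1 i0 : 'I_k)%g => //; rewrite sgE permKV mulf_neq0//.
by rewrite signr_eq0.
Qed.

End exponents.

(** If the last term of a partial sum is nonnegative, the partial sum is minus a tail of nonnegative
    terms containing [sg K]. Otherwise all its terms are negative and it is at most [sg 0]. *)
Lemma sorted_partial_sums (R : realType) (K : nat) (sg : nat -> R) :
  (forall i j, (i <= j)%N -> (j < K.+1)%N -> sg i <= sg j) ->
  \sum_(i < K.+1) sg i = 0 -> (exists2 i, (i < K.+1)%N & sg i != 0) ->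
  [/\ (0 < K)%N, 0 < sg K & exists2 de, 0 < de &
   forall j, (0 < j < K.+1)%N -> \sum_(r < j) sg r <= - de].
Proof.
move=> srt s0 [i0 i0k si0].
have sK : 0 < sg K.
  rewrite ltNge; apply/negP => le.
  have l0 (i : 'I_K.+1) : 0 <= - sg i.
    by rewrite oppr_ge0; apply: le_trans (srt i K _ _) le => //; rewrite -ltnS.
  have : \sum_(i < K.+1) - sg i == 0 by rewrite sumrN s0 oppr0.
  rewrite psumr_eq0// => /allP/(_ (Ordinal i0k) (mem_index_enum _)) /=.
  by rewrite oppr_eq0 (negbTE si0).
have s00 : sg 0%N < 0.
  rewrite ltNge; apply/negP => ge.
  have l0 (i : 'I_K.+1) : 0 <= sg i by apply: le_trans ge (srt _ _ _ _).
  have : \sum_(i < K.+1) sg i == 0 by rewrite s0.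
  rewrite psumr_eq0// => /allP/(_ (Ordinal i0k) (mem_index_enum _)) /=.
  by rewrite (negbTE si0).
split => //.
  by case: K sK {srt s0 i0k} => // s1; have := lt_trans s00 s1; rewrite ltxx.
exists (Num.min (- sg 0%N) (sg K)); first by rewrite lt_min oppr_gt0 s00.
case=> // j /= jK.
have jK' : (j < K)%N by rewrite -ltnS.
have [m0|m0] := leP 0 (sg j).
  have -> : \sum_(r < j.+1) sg r = - \sum_(j.+1 <= r < K.+1) sg r.
    apply/eqP; rewrite -addr_eq0; apply/eqP.
    by rewrite -[RHS]s0 -!(big_mkord xpredT sg) -big_cat_nat//= ltnW.
  rewrite lerN2 big_nat_recr//= ge_min; apply/orP; right.
  rewrite lerDr big_nat_cond sumr_ge0// => r /andP[/andP[jr rK] _].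
  by apply: le_trans m0 (srt _ _ (ltnW jr) _); exact: ltnW.
rewrite big_ord_recl /= lerNr opprD ge_min; apply/orP; left.
rewrite lerDl oppr_ge0 sumr_le0// => r _.
apply: le_trans (ltW m0); apply: srt; last exact: ltnW.
exact: ltn_ord.
Qed.

Section measurable_matrices.
Context {R : realType} {d : measure_display} {X : measurableType d}.

Definition measurable_mx m n (A : X -> 'M[R]_(m, n)) :=
  forall i j, measurable_fun setT (fun x => A x i j : R).

Lemma measurable_inv : measurable_fun setT (fun y : R => y^-1).
Proof.
have -> : [set: R] = [set 0] `|` ~` [set 0] by rewrite setUv.
have m0 : measurable [set 0 : R] by exact: measurable_set1.
apply/measurable_funU => //; [exact: measurableC|split].
  exact: measurable_fun_set1.
apply: open_continuous_measurable_fun.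
  by rewrite openC; exact: closed_eq.
by move=> y /set_mem /= /eqP y0; exact: inv_continuous.
Qed.

Lemma measurable_det n (A : X -> 'M[R]_n) : measurable_mx A ->
  measurable_fun setT (fun x => \det (A x)).
Proof.
move=> mA; rewrite /determinant; apply: measurable_sum => s; apply: measurable_funM => //.
by apply: measurable_prod => i _; exact: mA.
Qed.

Lemma measurable_adj n (A : X -> 'M[R]_n) : measurable_mx A ->
  measurable_mx (fun x => \adj (A x)).
Proof.
move=> mA i j.
rewrite (_ : (fun x => _) = fun x => (-1) ^+ (j + i) * \det (row' j (col' i (A x)))); last first.
  by apply/funext => x; rewrite mxE.
apply: measurable_funM => //; apply: measurable_det => i' j'.
rewrite (_ : (fun x => _) = fun x => A x (lift j i') (lift i j')); first exact: mA.
by apply/funext => x; rewrite !mxE.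
Qed.

Lemma measurable_SL n (A : X -> 'M[R]_n) : measurable_mx A ->
  measurable_mx (fun x => set_val (insubd (SL_one R n) (A x))).
Proof.
move=> mA i j.
pose S := [set x | \det (A x) = 1].
have mS : measurable S.
  by have := measurable_det mA measurableT (measurable_set1 1); rewrite setTI.
rewrite (_ : (fun x => _) = fun x => \1_S x * A x i j + \1_(~` S) x * (1%:M : 'M[R]_n) i j); last first.
  apply/funext => x; rewrite set_valE val_insubd !indicE in_setC.
  have -> : (A x \in SL R n) = (x \in S) by apply/idP/idP => /set_mem h; exact/mem_set.
  by case: (x \in S); rewrite ?mul1r ?mul0r ?addr0 ?add0r.
apply: measurable_funD.
  by apply: measurable_funM; [exact: measurable_indic|exact: mA].
apply: measurable_funM; last exact: measurable_cst.
by apply: measurable_indic; exact: measurableC.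
Qed.

End measurable_matrices.

Section invertible_almost_surely.
Context {R : realType} {K : nat}.
Local Notation k := K.+1.
Local Notation cspace := (@cspace R).

(** Row reduction again: a nonzero determinant survives undoing a row operation, and a unipotent
    matrix has determinant 1. *)
Lemma AE_det_neq0 (x : cspace) : AE (full k k.+1) [set z | \det (mat K z) != 0] x.
Proof.
apply: AE_full => //.
- have md : measurable_fun setT (fun z : cspace => \det (mat K z)).
    by apply: measurable_det => i j; exact: measurable_mat.
  have := md measurableT (~` [set 0]) (measurableC (measurable_set1 0)).
  by rewrite setTI; congr measurable; apply/seteqP; split => z /= /eqP.
- move=> r a c z z' rk a0 c0 zr zi /= d0; apply/eqP => dz; move: d0; rewrite /=.
  pose E : 'M[R]_k := \matrix_(i, j) if i == r :> nat then a * (i == j)%:R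
     else (i == j)%:R + c i * (Ordinal rk == j)%:R.
  have -> : mat K z' = E *m mat K z.
    apply/matrixP => i j; rewrite !mxE.
    have jk : (j < k.+1)%N by exact: ltnW (ltn_ord j).
    have pick (i0 : 'I_k) (b : R) : \sum_j0 b * (i0 == j0)%:R * mat K z j0 j = b * z (nat_of_ord i0, nat_of_ord j).
      rewrite (bigD1 i0)//= eqxx mulr1 mxE big1 ?addr0// => j0 j0i.
      by rewrite eq_sym (negbTE j0i) mulr0 mul0r.
    have [ir|ir] := eqVneq (nat_of_ord i) r.
      transitivity (\sum_j0 a * (i == j0)%:R * mat K z j0 j).
        by rewrite pick ir zr.
      by apply: eq_bigr => j0 _; rewrite !mxE ir eqxx.
    rewrite zi//; transitivity (\sum_j0 1 * (i == j0)%:R * mat K z j0 j +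
        \sum_j0 c i * (Ordinal rk == j0)%:R * mat K z j0 j).
      by rewrite !pick mul1r.
    rewrite -big_split /=; apply: eq_bigr => j0 _; rewrite !mxE (negbTE ir) mul1r.
    by rewrite mulrDl.
  by rewrite det_mulmx dz mulr0 eqxx.
move=> {}x bx.
apply: (@AE_congr _ _ (fun _ => True) _ x); last exact: AE_true.
move=> _ z _ _ zx _ /=.
have bz : reduced_base k k.+1 k z.
  by move=> i j ik jk nr; rewrite zx ?bx// mem_free_coords ik jk.
rewrite -det_tr det_trig.
  rewrite big1 ?oner_neq0// => i _; rewrite !mxE bz ?eqxx ?ltn_ord//; first exact: ltnW (ltn_ord i).
  by rewrite /reduced /= ltnn andbF leqNgt ltn_ord.
apply/is_trig_mxP => i j ij; rewrite !mxE bz ?ltn_ord ?(gtn_eqF ij)//; first exact: ltnW (ltn_ord i).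
by rewrite /reduced /= ltn_ord /= (ltnNge _ i) (ltnW ij) /= leqNgt ltn_ord.
Qed.

End invertible_almost_surely.

Lemma infinite_natP (A : set nat) : infinite_set A <-> forall N, exists2 t, (N <= t)%N & A t.
Proof.
split => [iA N|h fA].
  apply: contrapT => h; apply: iA; apply: (@sub_finite_set _ _ `I_N) => [t At|]; last exact: finite_II.
  by rewrite /= ltnNge; apply/negP => Nt; apply: h; exists t.
have /finite_seqP[X XA] := fA.
have [t] := h (\max_(t <- X) t).+1; rewrite XA /= => lt tX.
by move: lt; rewrite ltnNge (big_rem t)//= leq_maxl.
Qed.

Lemma AE_cst (R : realType) l (P : Prop) (x : @cspace R) : AE l (fun=> P) x -> P.
Proof.
move=> h; apply: contrapT => nP.
have : AE l (fun z => ~ [set: @cspace R] z) x by apply: AE_imp h.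
move/(AE_it_int l x measurableT).
rewrite (_ : (fun z => _) = fun=> 1%:E); last by apply/funext => z; rewrite indicT.
by rewrite it_int_cst => /eqP; rewrite eqe oner_eq0.
Qed.

Section limsup_sets.
Context {R : realType} {K : nat}.
Local Notation k := K.+1.
Local Notation cspace := (@cspace R).
Local Notation F := (full k k.+1).
Variables (T : nat -> 'M[R]_k) (z : nat -> R).

Definition often_avoided : set (borel_grid R k) :=
  [set L : grid R k | forall N, exists2 t, (maxn 1 N <= t)%N & avoid (T t) (expR (z t)) L].

Lemma measurable_often_avoided_joint (a : cspace -> ASL R k) :
  measurable_mx (fun x => set_val (a x).1) -> measurable_mx (fun x => (a x).2) ->
  measurable [set p : cspace * borel_grid R k | often_avoided (ASL_act (a p.1) p.2)].
Proof.
move=> ma1 ma2.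
rewrite (_ : [set p | _] = \bigcap_N \bigcup_t [set p : cspace * borel_grid R k |
   (maxn 1 N <= t)%N /\ avoid (T t) (expR (z t)) (ASL_act (a p.1) p.2)]); last first.
  apply/seteqP; split => p /= h N; first by move=> _; have [t Nt ht] := h N; exists t.
  by have [t _ [Nt ht]] := h N I; exists t.
apply: bigcapT_measurable => N; apply: bigcupT_measurable => t.
have [Nt|Nt] := boolP (maxn 1 N <= t)%N; last first.
  by rewrite (_ : [set p | _] = set0); [exact: measurable0|apply/seteqP; split => // p []].
have := measurable_avoid_joint ma1 (fun i => ma2 i ord0) (T t) (expR (z t)).
by congr measurable; apply/seteqP; split => p //= [].
Qed.

Lemma measurable_often_avoided : measurable often_avoided.
Proof.
pose a (x : cspace) : ASL R k := (SL_one R k, 0).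
have ma1 : measurable_mx (fun x => set_val (a x).1) by move=> i j; exact: measurable_cst.
have ma2 : measurable_mx (fun x => (a x).2) by move=> i j; exact: measurable_cst.
have := measurable_xsection ((fun=> 0) : cspace) (measurable_often_avoided_joint ma1 ma2).
congr measurable; apply/seteqP; split => L /=.
  move=> /set_mem /= h N; have [t Nt ht] := h N; exists t => // v Lv.
  apply: ht; exists v => //.
  by rewrite /affine_map /= set_valE /= mul1mx addr0.
move=> h; apply/mem_set => /= N; have [t Nt ht] := h N; exists t => // _ [v Lv <-].
by rewrite /affine_map /= set_valE /= mul1mx addr0; exact: ht.
Qed.

Variable mu : probability (borel_grid R k) R.
Hypothesis mu_inv : ASL_invariant mu.
Variable a : cspace -> ASL R k.
Hypothesis ma1 : measurable_mx (fun x => set_val (a x).1).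
Hypothesis ma2 : measurable_mx (fun x => (a x).2).

Lemma often_avoided_null :
  (forall L, AE F (fun x => ~ often_avoided (ASL_act (a x) L)) (fun=> 0)) ->
  mu.-negligible often_avoided.
Proof.
move=> h; have mE := measurable_often_avoided.
apply: (proj2 (@negligibleP _ (borel_grid R k) R mu _ mE)).
exact: (invariant_measure_null mu_inv mE (measurable_often_avoided_joint ma1 ma2) h).
Qed.

Lemma often_avoided_full :
  (forall L, AE F (fun x => often_avoided (ASL_act (a x) L)) (fun=> 0)) ->
  mu.-negligible (~` often_avoided).
Proof.
move=> h; have mE := measurableC measurable_often_avoided.
apply: (proj2 (@negligibleP _ (borel_grid R k) R mu _ mE)).
apply: (invariant_measure_null (a := a) (l := F) (x0 := fun=> 0) mu_inv mE).
  have := measurableC (measurable_often_avoided_joint ma1 ma2).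
  by congr measurable.
by move=> L; apply: AE_imp (h L) => x hx; exact.
Qed.

End limsup_sets.

Section row_scaling.
Context {R : realType} {K : nat}.
Local Notation k := K.+1.

(** Used to normalise a determinant by changing the first row only, which is one of the admissible
    row operations. *)
Definition rowscale (c : R) : 'M[R]_k := diag_mx (\row_i (if i == ord0 then c else 1)).

Lemma det_rowscale c : \det (rowscale c) = c.
Proof.
by rewrite det_diag (bigD1 ord0)//= mxE eqxx big1 ?mulr1// => i /negbTE i0; rewrite mxE i0.
Qed.

Lemma rowscale_entry c n (A : 'M[R]_(k, n)) i j :
  (rowscale c *m A) i j = (if i == ord0 then c else 1) * A i j.
Proof. by rewrite mul_diag_mx mxE mxE. Qed.

Lemma rowscaleV c : c != 0 -> rowscale c *m rowscale c^-1 = 1%:M.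
Proof.
move=> c0; apply/matrixP => i j; rewrite rowscale_entry !mxE.
by case: (i == ord0); rewrite ?mul1r// mulrnAr mulfV.
Qed.

Lemma tr_rowscale c : (rowscale c)^T = rowscale c.
Proof. exact: tr_diag_mx. Qed.

Lemma measurable_rowscale d (X : measurableType d) (c : X -> R) : measurable_fun setT c ->
  measurable_mx (fun x => rowscale (c x)).
Proof.
move=> mc i j; rewrite (_ : (fun x => _) = fun x => (if i == ord0 then c x else 1) *+ (i == j)).
  by case: (i == j); case: (i == ord0) => //; exact: measurable_cst.
by apply/funext => x; rewrite !mxE.
Qed.

Definition intvec (q : nat -> int) : 'cV[R]_k := \col_j (q j)%:~R.

Lemma intvec_integer q : integer_points (intvec q).
Proof. by move=> i; rewrite mxE intr_int. Qed.

Lemma lform_coords_linear (A : 'M[R]_k) v (i : 'I_k) q :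
  lform k (coords A v) i q = (A *m intvec q) i ord0.
Proof.
rewrite /lform [RHS]mxE; apply: eq_bigr => j _.
by rewrite /coords /= !ltn_ord !inord_val mxE.
Qed.

Lemma lform_coords_affine (A : 'M[R]_k) v (i : 'I_k) q :
  lform k.+1 (coords A v) i q = (A *m intvec q) i ord0 + v i ord0 * (q k)%:~R.
Proof.
rewrite -(lform_coords_linear A v) /lform big_ord_recr /=; congr (_ + _).
by rewrite /coords /= ltn_ord ltnn eqxx inord_val.
Qed.

End row_scaling.

(** * The convergence case *)

Section convergence_case.
Context {R : realType} {K : nat}.
Local Notation k := K.+1.
Local Notation cspace := (@cspace R).
Local Notation F := (full k k.+1).
Variables (T : nat -> 'M[R]_k) (z : nat -> R) (P : 'M[R]_k) (sg rr : nat -> R).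
Hypothesis uP : P \in unitmx.
Hypothesis PT : forall (t : nat) (v : 'cV[R]_k) i,
  (P *m (T t *m v)) i ord0 = expR (- sg i * t%:R) * (P *m v) i ord0.
Hypothesis sg_sorted : forall i j, (i <= j)%N -> (j < k)%N -> sg i <= sg j.
Hypothesis rr0 : forall t, 0 < rr t.
Hypothesis rr_le : forall t, rr t <= expR (z t).
Hypothesis box1 : forall t j, (j < k)%N -> \prod_(r < j) (2 * ebox sg rr t r) <= 1.
Hypothesis box_sum : (\sum_(t <oo) ((\prod_(r < k) (2 * ebox sg rr t r))^-1)%:E < +oo)%E.

Let c (x : cspace) : R := \det P / \det (mat K x).
(** Up to the diagonalizing matrix [P] this is the random affine map given by [x], with its first
    row rescaled to determinant one. On the null set where [mat K x] is singular, [insubd] returns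
    the identity. *)
Definition primal_map (x : cspace) : ASL R k :=
  (insubd (SL_one R k) (invmx P *m rowscale (c x) *m mat K x),
   invmx P *m rowscale (c x) *m trl K x).

Let mc : measurable_fun setT c.
Proof.
apply: measurable_funM => //; apply: (measurableT_comp measurable_inv).
by apply: measurable_det => i j; exact: measurable_mat.
Qed.

Lemma measurable_primal_map1 : measurable_mx (fun x => set_val (primal_map x).1).
Proof.
apply: measurable_SL; apply: measurable_mulmx => [|i j]; last exact: measurable_mat.
by apply: measurable_mulmx => [i j|]; [exact: measurable_cst|exact: measurable_rowscale].
Qed.

Lemma measurable_primal_map2 : measurable_mx (fun x => (primal_map x).2).
Proof.
apply: measurable_mulmx => [|i j]; last by rewrite [j]ord1; exact: measurable_trl.
by apply: measurable_mulmx => [i j|]; [exact: measurable_cst|exact: measurable_rowscale].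
Qed.

Let detP : \det P != 0. Proof. by rewrite -unitfE -unitmxE. Qed.

(** A grid point [v] with [P v] in the box at time [t] is contracted by the flow, in diagonalizing
    coordinates, into a cube of side comparable to [rr t]; so the grid does not avoid the ball of
    radius [exp (z t)]. *)
Lemma eventually_not_avoided L :
  AE F (fun x => ~ often_avoided T z (ASL_act (primal_map x) L)) (fun=> 0).
Proof.
have [b Lb] := gridP L; set h := set_val b.1; set w0 := b.2.
have uh : h \in unitmx by rewrite unitmxE (set_mem (valP b.1) : \det h = 1) unitr1.
have ev : AE F (fun x => eventually_hit K sg rr (coords (mat K x *m h) (trl K x + mat K x *m w0))) (fun=> 0).
  have rr0' t : 0 <= rr t by exact: ltW.
  apply: AE_affine => //; [exact: measurable_eventually_hit|exact: full_only_eventually_hit|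
    exact: column_symmetric_eventually_hit|].
  exact: AE_eventually_hit.
have := AE_and ev (AE_det_neq0 (K := K) (fun=> 0)).
apply: AE_imp => x [evx /= dx] av.
have cx : c x != 0 by rewrite /c mulf_neq0// invr_eq0.
pose D := rowscale (K := K) (c x).
have setA : set_val (primal_map x).1 = invmx P *m D *m mat K x.
  rewrite set_valE /= val_insubd mem_set// /SL /= !det_mulmx det_inv det_rowscale /c.
  by rewrite mulrA divfK// mulVf.
have {}evx : eventually_hit K sg rr (coords (D *m (mat K x *m h)) (D *m (trl K x + mat K x *m w0))).
  have rr0' t : 0 <= rr t by exact: ltW.
  apply: (@row_invariant_eventually_hit R K sg rr sg_sorted rr0' 0%N (c x)^-1 (fun=> 0) _ _ isT _ _ _ _ evx) => //.
  - by rewrite invr_eq0.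
  - move=> j jk; rewrite /coords /=.
    have i0 : inord 0 = ord0 :> 'I_k by apply/val_inj; rewrite /= inordK.
    case: ifP => jk'.
      by rewrite rowscale_entry i0 eqxx mulrA mulVf// mul1r.
    by case: ifP => _; rewrite ?mulr0// rowscale_entry i0 eqxx mulrA mulVf// mul1r.
  move=> i j ik jk i0; rewrite mul0r addr0 /coords /= ik.
  have i0' : (inord i == ord0 :> 'I_k) = false by rewrite -val_eqE /= inordK// (negbTE i0).
  by case: ifP => _; [|case: ifP => // _]; rewrite rowscale_entry i0' mul1r.
(* Shrinking the box by more than [S] pays for leaving the diagonalizing coordinates through the
   inverse of [P]. *)
pose S := mx_sum (invmx P).
have [n hn] : exists n : nat, S < n.+1%:R.
  by exists (Num.truncn S); exact: Num.Theory.truncnS_gt.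
have [N hN] := evx n.
have [t Nt ht] := av N.
have tN : (N <= t)%N by apply: leq_trans Nt; exact: leq_maxr.
have [q qk hq] := hN t tN.
pose v := affine_map (primal_map x) (affine_map b (intvec q)).
have Lv : grid_set (ASL_act (primal_map x) L) v.
  exists (affine_map b (intvec q)) => //; rewrite Lb.
  by exists (intvec q) => //; exact: intvec_integer.
have Pv : P *m v = D *m (mat K x *m h) *m intvec q + D *m (trl K x + mat K x *m w0).
  rewrite /v /affine_map -/h -/w0 setA /= -/D !mulmxDr !mulmxA mulmxV// !mul1mx.
  by rewrite -!addrA; congr (_ + _); rewrite addrC.
have yb (i : 'I_k) : `|(P *m v) i ord0| <= ebox sg rr t i / n.+1%:R.
  have := hq i (ltn_ord i); rewrite lform_coords_affine qk mulr1.
  by rewrite Pv mx_entryD.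
have n0 : 0 < n.+1%:R :> R by rewrite ltr0n.
have : `|T t *m v| < expR (z t).
  apply: lt_le_trans (rr_le t).
  have -> : T t *m v = invmx P *m (P *m (T t *m v)) by rewrite mulKmx.
  apply: le_lt_trans (norm_mulmx _ _) _; rewrite -/S.
  have le : `|P *m (T t *m v)| <= rr t / n.+1%:R.
    apply: mx_norm_le => [|i j]; first by rewrite divr_ge0// ltW.
    rewrite [j]ord1 PT normrM ger0_norm ?expR_ge0//.
    apply: le_trans (ler_wpM2l (expR_ge0 _) (yb i)) _.
    by rewrite /ebox !mulrA -expRD mulNr addNr expR0 mul1r.
  apply: le_lt_trans (ler_wpM2l (mx_sum_ge0 _) le) _.
  by rewrite mulrCA -[ltRHS]mulr1 ltr_pM2l// ltr_pdivrMr// mul1r.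
by rewrite ltNge (ht v Lv).
Qed.

End convergence_case.

(** * The divergence case *)

Section middle.
Context {R : realType} {K : nat}.
Local Notation k := K.+1.
Local Notation cspace := (@cspace R).

Definition wcoords : seq coord := [seq (i, k) | i <- iota 0 k].

Lemma mem_wcoords i j : ((i, j) \in wcoords) = (i < k)%N && (j == k).
Proof.
apply/mapP/andP => [[i']|[ik /eqP ->]].
  by rewrite mem_iota add0n => /andP[_ i'k] [-> ->].
by exists i => //; rewrite mem_iota add0n.
Qed.

Lemma uniq_wcoords : uniq wcoords.
Proof. by rewrite map_inj_uniq ?iota_uniq// => i j []. Qed.

Definition often_middle (u : nat -> 'cV[R]_k) (c : nat -> R) : set cspace :=
  [set x | forall N : nat, exists2 n, (N <= n)%N & exists m : int,
     1 / 3 <= \sum_r u n r ord0 * x (nat_of_ord r, k) + c n - m%:~R <= 2 / 3].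

Lemma measurable_often_middle u c : measurable (often_middle u c).
Proof.
pose f n (x : cspace) : R := \sum_r u n r ord0 * x (nat_of_ord r, k) + c n.
have mf n : measurable_fun setT (f n).
  apply: measurable_funD => //; apply: measurable_sum => r; apply: measurable_funM => //.
  exact: measurable_coord.
pose A n (m : int) : set cspace := [set x | 1 / 3 <= f n x - m%:~R <= 2 / 3].
rewrite (_ : often_middle u c = \bigcap_N \bigcup_n [set x | (N <= n)%N /\ exists m, A n m x]); last first.
  apply/seteqP; split => x /= h N; first by move=> _; have [n Nn hn] := h N; exists n.
  by have [n _ [Nn hn]] := h N I; exists n.
apply: bigcapT_measurable => N; apply: bigcupT_measurable => n.
have [Nn|Nn] := boolP (N <= n)%N; last first.
  by rewrite (_ : [set x | _] = set0); [exact: measurable0|apply/seteqP; split => // x []].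
rewrite (_ : [set x | _] = \bigcup_m A n m); last first.
  by apply/seteqP; split => x /=; [move=> [_ [m hm]]; exists m|move=> [m _ hm]; split => //; exists m].
apply: countable_bigcupT_measurable => [|m]; first exact: countableP.
have mfm : measurable_fun setT (fun x => f n x - m%:~R) by exact: measurable_funB.
have := mfm measurableT `[1 / 3, 2 / 3]%classic (measurable_itv _).
by rewrite setTI; congr measurable; apply/seteqP; split => x /=; rewrite in_itv.
Qed.

(** The translation entry paired with the unbounded coordinate [i] is integrated last; with the
    others fixed, the statement is the one-dimensional one. *)
Lemma AE_often_middle (u : nat -> 'cV[R]_k) (c : nat -> R) (i : 'I_k) (x : cspace) :
  (forall B : R, exists n, forall j, (n <= j)%N -> B < `|u j i ord0|) ->
  AE wcoords (often_middle u c) x.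
Proof.
move=> ub.
have iw : (nat_of_ord i, k) \in wcoords by rewrite mem_wcoords ltn_ord eqxx.
have pw : perm_eq (rem (nat_of_ord i, k) wcoords ++ [:: (nat_of_ord i, k)]) wcoords.
  by rewrite perm_sym (perm_trans (perm_to_rem iw))// -cat1s perm_catC.
have uw : uniq (rem (nat_of_ord i, k) wcoords ++ [:: (nat_of_ord i, k)]).
  by rewrite (perm_uniq pw) uniq_wcoords.
apply: (AE_perm (measurable_often_middle u c) uw pw).
rewrite AE_cat; apply: AE_true => y /=.
pose e n := \sum_(r < k | r != i) u n r ord0 * y (nat_of_ord r, k) + c n.
have := @ae_infinitely_often_middle R (fun n => u n i ord0) e ub.
apply: negligibleS => s /= ns.
have [N hN] : exists N, forall n, (N <= n)%N -> ~ exists m : int,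
    1 / 3 <= \sum_r u n r ord0 * upd y (nat_of_ord i, k) s (nat_of_ord r, k) + c n - m%:~R <= 2 / 3.
  apply: contrapT => h; apply: ns => N; apply: contrapT => h'; apply: h; exists N => n Nn hm.
  by apply: h'; exists n.
exists N => n Nn m hm; apply: (hN n Nn); exists m; move: hm.
rewrite (bigD1 i)//= updE /e addrA.
suff -> : \sum_(r < k | r != i) u n r ord0 * upd y (nat_of_ord i, k) s (nat_of_ord r, k) =
          \sum_(r < k | r != i) u n r ord0 * y (nat_of_ord r, k) by [].
by apply: eq_bigr => r ri; rewrite upd_neq// xpair_eqE eqxx andbT.
Qed.

End middle.

Section divergence_case.
Context {R : realType} {K : nat}.
Local Notation k := K.+1.
Local Notation cspace := (@cspace R).
Local Notation F := (full k k.+1).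
Variables (T : nat -> 'M[R]_k) (z : nat -> R) (P : 'M[R]_k) (sg rr : nat -> R).
Hypothesis uP : P \in unitmx.
Hypothesis PT : forall (t : nat) (v : 'cV[R]_k) i,
  (P *m (T t *m v)) i ord0 = expR (sg i * t%:R) * (P *m v) i ord0.
Hypothesis sg_sorted : forall i j, (i <= j)%N -> (j < k)%N -> sg i <= sg j.
Hypothesis rr0 : forall t, 0 <= rr t.
Hypothesis rr_le : forall t, rr t * expR (z t) <= 1.
Hypothesis hit_ae : forall x, AE F (often_hit K sg rr) x.

Let c (x : cspace) : R := \det P * \det (mat K x).
(** The linear part is the inverse transpose of [mat K x], so that [mat K x] itself governs the dual
    lattice. The inverse is written with the adjugate to make measurability of the entries
    visible. *)
Definition dual_map (x : cspace) : ASL R k :=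
  (insubd (SL_one R k) (invmx P *m rowscale (c x) *m
     ((\det (mat K x))^-1 *: \adj (mat K x))^T), invmx P *m trl K x).

Let mdet : measurable_fun setT (fun x : cspace => \det (mat K x)).
Proof. by apply: measurable_det => i j; exact: measurable_mat. Qed.

Lemma measurable_dual_map1 : measurable_mx (fun x => set_val (dual_map x).1).
Proof.
apply: measurable_SL; apply: measurable_mulmx => [|i j].
  apply: measurable_mulmx => [i j|]; first exact: measurable_cst.
  by apply: measurable_rowscale; exact: measurable_funM.
rewrite (_ : (fun x => _) = fun x => (\det (mat K x))^-1 * \adj (mat K x) j i); last first.
  by apply/funext => x; rewrite [LHS]mxE [LHS]mxE.
apply: measurable_funM; first exact: (measurableT_comp measurable_inv mdet).
by apply: measurable_adj => i' j'; exact: measurable_mat.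
Qed.

Lemma measurable_dual_map2 : measurable_mx (fun x => (dual_map x).2).
Proof.
apply: measurable_mulmx => i j; first exact: measurable_cst.
by rewrite [j]ord1; exact: measurable_trl.
Qed.

(** As [A] is invertible, the image of a nonzero integer vector has some coordinate of size at least
    [ka]; a pigeonhole argument makes it the same coordinate [i] for arbitrarily late hits. One
    factor [n.+1] of smallness will pay for lengthening the vectors, the other for constants. *)
Lemma often_hit_sequence (A : 'M[R]_k) v : A \in unitmx ->
  often_hit K sg rr (coords A v) -> exists (i : 'I_k) (ka : R), 0 < ka /\
  forall n : nat, exists p : nat * (nat -> int), [/\ (n <= p.1)%N,
    (forall r : 'I_k, `|(A *m intvec p.2) r ord0| <= ebox sg rr p.1 r / n.+1%:R / n.+1%:R) &
    ka <= `|(A *m intvec p.2) i ord0|].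
Proof.
move=> uA hA.
pose S := mx_sum (invmx A); have S0 : 0 <= S by exact: mx_sum_ge0.
pose ka := (S + 1)^-1; have S1 : 0 < S + 1 by rewrite ltr_wpDl.
have ka0 : 0 < ka by rewrite invr_gt0.
have big (q : nat -> int) : nontrivial K q -> exists i, ka <= `|(A *m intvec q) i ord0|.
  move=> [j jk qj]; apply: contrapT => h.
  have lt i : `|(A *m intvec q) i ord0| <= ka.
    by rewrite leNgt; apply/negP => hi; apply: h; exists i; exact: ltW.
  have := @mulmx_entry_le _ _ _ (invmx A) (A *m intvec q) ka (Ordinal jk) lt.
  rewrite mulKmx// mxE /= => le.
  have : 1 <= `|(q j)%:~R : R|.
    by rewrite -intr_norm (_ : 1 = 1%:~R)// ler_int -gtz0_ge1 normr_gt0.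
  rewrite leNgt => /negP; apply; apply: le_lt_trans le _.
  apply: (@le_lt_trans _ _ (S * ka)).
    by apply: ler_wpM2r; [exact: ltW|exact: mx_sum_row].
  by rewrite ltr_pdivrMr// mul1r ltrDl.
apply: contrapT => hn.
have /choice[n nP] : forall i : 'I_k, exists n : nat, forall p : nat * (nat -> int),
    (n <= p.1)%N ->
    (forall r : 'I_k, `|(A *m intvec p.2) r ord0| <= ebox sg rr p.1 r / n.+1%:R / n.+1%:R) ->
    `|(A *m intvec p.2) i ord0| < ka.
  move=> i; apply: contrapT => h; apply: hn; exists i, ka; split => // n.
  apply: contrapT => h'; apply: h; exists n => p np hp.
  by rewrite ltNge; apply/negP => kp; apply: h'; exists p.
pose N := \max_i n i.
have [t Nt [q ntq hq]] := hA (N.+1 * N.+1).-1 N.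
have [i hi] := big q ntq.
have nN : (n i <= N)%N by exact: leq_bigmax.
have : `|(A *m intvec q) i ord0| < ka.
  apply: (nP i (t, q)); first exact: leq_trans nN Nt.
  move=> r /=; have := hq r (ltn_ord r); rewrite lform_coords_linear => /le_trans; apply.
  rewrite prednK// natrM invfM mulrA.
  have b0 : 0 <= ebox sg rr t r by rewrite mulr_ge0 ?expR_ge0.
  have nN' : N.+1%:R^-1 <= (n i).+1%:R^-1 :> R by rewrite lef_pV2 ?posrE ?ltr0n// ler_nat.
  have N0 (m : nat) : 0 <= m.+1%:R^-1 :> R by rewrite invr_ge0.
  by rewrite ler_pM ?mulr_ge0// ler_wpM2l.
by rewrite ltNge hi.
Qed.

Let detP : \det P != 0. Proof. by rewrite -unitfE -unitmxE. Qed.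

Lemma far_from_integers (th : R) (m e : int) : 1 / 3 <= th - m%:~R <= 2 / 3 ->
  1 / 3 <= `|e%:~R + th|.
Proof.
move=> /andP[h1 h2].
have [e0|e0] := leP 0 (e + m).
  have : 0 <= (e + m)%:~R :> R by rewrite ler0z.
  rewrite intrD => h; apply: le_trans (ler_norm _); lra.
have : (e + m)%:~R <= (-1)%:~R :> R by rewrite ler_int; lia.
rewrite intrD mulrNz => h; rewrite -normrN; apply: le_trans (ler_norm _); lra.
Qed.

(** For every grid point [v] the pairing of [u n] with [P v] is an integer plus a phase that is
    infinitely often in the middle third, hence at least 1/3 in absolute value. It is also at most a
    constant times [rr t / n.+1] times the norm of [T t *m v], which must therefore be large. *)
Lemma often_avoided_translate (b : ASL R k) (L : grid R k) (y : cspace) :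
  grid_set L = affine_map b @` @integer_points R k ->
  \det (mat K y) != 0 ->
  often_hit K sg rr (coords (mat K y *m (invmx (set_val b.1))^T) 0) ->
  AE (wcoords (K := K)) (fun x => often_avoided T z (ASL_act (dual_map x) L)) y.
Proof.
move=> Lb dy hy.
set h := set_val b.1 in hy *; set w0 := b.2; set M := mat K y in dy hy *.
have dh : \det h = 1 by exact: set_mem (valP b.1).
have uh : h \in unitmx by rewrite unitmxE dh unitr1.
have uM : M \in unitmx by rewrite unitmxE unitfE.
have cy : c y != 0 by rewrite mulf_neq0.
pose D := rowscale (K := K) (c y); pose D' := rowscale (K := K) (c y)^-1.
have DD : D *m D' = 1%:M by exact: rowscaleV.
have DD' : D' *m D = 1%:M by have := @rowscaleV R K (c y)^-1; rewrite invrK invr_eq0; exact.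
(* The inverse transpose of [D *m (invmx M)^T *m h]: its integral combinations form the dual of the
   linear part of the grid in diagonalizing coordinates. *)
pose A := D' *m (M *m (invmx h)^T).
have uA : A \in unitmx.
  rewrite /A !unitmx_mul uM unitmx_tr unitmx_inv uh !andbT.
  by rewrite unitmxE det_rowscale unitfE invr_eq0.
have hA : often_hit K sg rr (coords A 0).
  apply: (@row_invariant_often_hit R K sg rr sg_sorted rr0 0%N (c y) (fun=> 0) _ _ isT cy _ _ _ hy) => //.
  - move=> j jk; rewrite /coords /= jk.
    have i0 : inord 0 = ord0 :> 'I_k by apply/val_inj; rewrite /= inordK.
    by rewrite rowscale_entry i0 eqxx mulrA mulfV// mul1r.
  move=> i j ik jk i0; rewrite mul0r addr0 /coords /= ik jk.
  have i0' : (inord i == ord0 :> 'I_k) = false by rewrite -val_eqE /= inordK// (negbTE i0).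
  by rewrite rowscale_entry i0' mul1r.
have [i [ka [ka0 /choice[p pP]]]] := often_hit_sequence uA hA.
(* The factor [n.+1] makes coordinate [i] unbounded, as the equidistribution in the translation
   requires, and keeps the pairing with lattice vectors integral. *)
pose u n : 'cV[R]_k := n.+1%:R *: (A *m intvec (p n).2).
pose cc n : R := n.+1%:R * ((intvec (K := K) (p n).2)^T *m (invmx h *m w0)) ord0 ord0.
have ub (B : R) : exists n, forall j, (n <= j)%N -> B < `|u j i ord0|.
  exists (Num.truncn (B / ka)) => j nj; have [_ _ kp] := pP j.
  rewrite mxE normrM normr_nat.
  apply: lt_le_trans (ler_wpM2l (ler0n _ _) kp).
  rewrite -ltr_pdivrMr//; apply: lt_le_trans (Num.Theory.truncnS_gt _) _.
  by rewrite ler_nat.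
have := AE_often_middle cc y ub; apply: AE_congr => x' x xx _ xy.
move=> mid.
have {}mid : often_middle u cc x.
  move=> N; have [n Nn [m hm]] := mid N; exists n => //; exists m.
  suff E : \sum_r u n r ord0 * x (nat_of_ord r, k) =
     \sum_r u n r ord0 * x' (nat_of_ord r, k) by rewrite E; exact: hm.
  by apply: eq_bigr => r _; rewrite xx// mem_wcoords ltn_ord eqxx.
have matx : mat K x = M.
  apply/matrixP => a j; rewrite !mxE xy// mem_wcoords ltn_ord /=.
  by rewrite neq_ltn ltn_ord.
have MinvE : (\det M)^-1 *: \adj M = invmx M by rewrite /invmx uM.
have cx : c x = c y by rewrite /c matx.
have setA : set_val (dual_map x).1 = invmx P *m D *m (invmx M)^T.
  rewrite set_valE /= val_insubd matx MinvE cx -/D mem_set// /SL /=.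
  rewrite !det_mulmx det_tr !det_inv det_rowscale /c -/M.
  by rewrite mulrA mulVf// mul1r mulfV.
pose S := mx_sum P; have S0 : 0 <= S by exact: mx_sum_ge0.
(* From [N0] on, the remaining factor [n.+1] exceeds the constants: 3 from the distance to the
   integers, [k] from the number of coordinates, [S] from [P]. *)
have [N0 hN0] : exists N0 : nat, forall n, (N0 <= n)%N -> 3 * k%:R * S < n.+1%:R.
  exists (Num.truncn (3 * k%:R * S)) => n Nn.
  by apply: lt_le_trans (Num.Theory.truncnS_gt _) _; rewrite ler_nat.
move=> N; have [n Nn [m hm]] := mid (maxn N0 (maxn 1 N)).
have [np pbox _] := pP n; set t := (p n).1 in np pbox *; set q := (p n).2 in pbox *.
exists t; first by apply: leq_trans np; apply: leq_trans Nn; exact: leq_maxr.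
move=> _ [v0 Lv0 <-]; move: Lv0; rewrite Lb => -[nn nnZ <-].
set v := affine_map _ _.
have n0 : 0 < n.+1%:R :> R by rewrite ltr0n.
have Pv : P *m v = D *m (invmx M)^T *m (h *m nn + w0) + trl K x.
  by rewrite /v /affine_map -/h -/w0 setA /= mulmxDr !mulmxA mulmxV// !mul1mx.
have utE : (u n)^T *m (P *m v) =
    n.+1%:R *: ((intvec q)^T *m nn) + n.+1%:R *: ((intvec q)^T *m (invmx h *m w0)) +
    (u n)^T *m trl K x.
  rewrite Pv mulmxDr; congr (_ + _).
  have -> : (u n)^T = n.+1%:R *: ((intvec q)^T *m invmx h *m M^T *m D').
    by rewrite /u linearZ /= !trmx_mul trmxK tr_rowscale !mulmxA.
  rewrite -!scalemxAl -scalerDr; congr (_ *: _).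
  rewrite !mulmxA -[_ *m D' *m D]mulmxA DD' mulmx1.
  rewrite -[_ *m M^T *m (invmx M)^T]mulmxA -trmx_mul mulVmx// trmx1 mulmx1.
  by rewrite mulmxDr -!mulmxA (mulmxA (invmx h)) mulVmx// mul1mx.
have [e eE] : exists e : int, (n.+1%:R *: ((intvec q)^T *m nn)) ord0 ord0 = e%:~R :> R.
  apply/intrP; rewrite mxE rpredM ?natr_int// mxE rpred_sum// => r _.
  by rewrite !mxE rpredM ?intr_int//; exact: nnZ.
have lower : 1 / 3 <= `|((u n)^T *m (P *m v)) ord0 ord0|.
  rewrite utE !mx_entryD eE -addrA.
  apply: (far_from_integers (m := m)).
  suff E : (n.+1%:R *: ((intvec q)^T *m (invmx h *m w0))) ord0 ord0 +
      ((u n)^T *m trl K x) ord0 ord0 = \sum_r u n r ord0 * x (nat_of_ord r, k) + cc n.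
    by rewrite E; exact: hm.
  rewrite addrC; congr (_ + _); last by rewrite mxE.
  by rewrite mxE; apply: eq_bigr => r _; rewrite /trl !mxE.
have upper : `|((u n)^T *m (P *m v)) ord0 ord0| <= k%:R * (rr t / n.+1%:R * (S * `|T t *m v|)).
  rewrite mxE; apply: le_trans (ler_norm_sum _ _ _) _.
  rewrite (_ : k%:R * _ = \sum_(r < k) rr t / n.+1%:R * (S * `|T t *m v|)); last first.
    by rewrite sumr_const card_ord mulr_natl.
  apply: ler_sum => r _.
  have -> : (u n)^T ord0 r = n.+1%:R * (A *m intvec q) r ord0 by rewrite mxE /u mxE.
  rewrite normrM normrM normr_nat.
  apply: (@le_trans _ _ (ebox sg rr t r / n.+1%:R * `|(P *m v) r ord0|)).
    rewrite ler_wpM2r//; apply: le_trans (ler_wpM2l (ler0n _ _) (pbox r)) _.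
    by rewrite mulrC divfK// gt_eqF.
  have -> : ebox sg rr t r / n.+1%:R * `|(P *m v) r ord0| =
      rr t / n.+1%:R * `|(P *m (T t *m v)) r ord0|.
    by rewrite PT normrM ger0_norm ?expR_ge0// /ebox; ring.
  apply: ler_wpM2l; first by rewrite divr_ge0.
  by apply: le_trans (mx_norm_ge _ _ _) (norm_mulmx _ _).
rewrite leNgt; apply/negP => lt.
have e0 : 0 < expR (z t) by exact: expR_gt0.
have hN : 3 * k%:R * S < n.+1%:R by apply: hN0; apply: leq_trans Nn; exact: leq_maxl.
have k0 : 0 <= k%:R :> R by rewrite ler0n.
have h1 : n.+1%:R / 3 <= k%:R * S * (rr t * expR (z t)).
  have := le_trans lower upper.
  have -> : k%:R * (rr t / n.+1%:R * (S * `|T t *m v|)) =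
            k%:R * S * (rr t * `|T t *m v|) / n.+1%:R by ring.
  rewrite ler_pdivlMr// mul1r mulrC => /le_trans; apply.
  by apply: ler_wpM2l; [rewrite mulr_ge0|rewrite ler_wpM2l// ltW].
have h2 : k%:R * S * (rr t * expR (z t)) <= k%:R * S.
  by rewrite ler_piMr// mulr_ge0.
by have := le_trans h1 h2; lra.
Qed.

(** The vectors [u n] are chosen from the matrix alone, so the matrix entries must be fixed before
    the translation varies; the list of coordinates is split accordingly. *)
Lemma AE_often_avoided L :
  AE F (fun x => often_avoided T z (ASL_act (dual_map x) L)) (fun=> 0).
Proof.
have [b Lb] := gridP L; set h := set_val b.1.
have uh : h \in unitmx by rewrite unitmxE (set_mem (valP b.1) : \det h = 1) unitr1.
pose hT := (invmx h)^T.
have uhT : hT \in unitmx by rewrite unitmx_tr unitmx_inv.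
pose Q1 : set cspace := [set x | often_hit K sg rr (coords (mat K x *m hT) (trl K x))].
pose Q2 : set cspace := [set x | \det (mat K x) != 0].
have mQ1 : measurable Q1 by apply: measurable_mul; exact: measurable_often_hit.
have mQ2 : measurable Q2.
  have := mdet measurableT (measurableC (measurable_set1 0)).
  by rewrite setTI; congr measurable; apply/seteqP; split => x /= /eqP.
have hQ : AE F (Q1 `&` Q2) (fun=> 0).
  apply: AE_and; last exact: AE_det_neq0.
  have := @AE_affine R K (often_hit K sg rr) hT 0 (fun=> 0) (measurable_often_hit _ _ _)
    (@full_only_often_hit R K sg rr) (@column_symmetric_often_hit R K sg rr) uhT (hit_ae _).
  by apply: AE_imp => x; rewrite mulmx0 addr0.
pose G : set cspace := [set x | often_avoided T z (ASL_act (dual_map x) L)].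
have mG : measurable G.
  have := measurable_ysection (L : borel_grid R k) (measurable_often_avoided_joint T z measurable_dual_map1 measurable_dual_map2).
  by congr measurable; apply/seteqP; split => x /=; [move/set_mem|move=> ?; apply/mem_set].
have pF : perm_eq F (full k k ++ wcoords (K := K)).
  have ul : uniq (full k k ++ wcoords (K := K)).
    rewrite cat_uniq uniq_full uniq_wcoords andbT; apply/hasPn => -[i j].
    by rewrite mem_wcoords => /andP[_ /eqP ->]; rewrite mem_full ltnn andbF.
  apply: uniq_perm => //; first exact: uniq_full.
  move=> [i j]; rewrite [in RHS]mem_cat mem_wcoords !mem_full.
  by apply/idP/idP; lia.
have uF : uniq F by exact: uniq_full.
apply: (@AE_perm _ (full k k ++ wcoords (K := K))) => //.
- by rewrite -(perm_uniq pF).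
- by rewrite perm_sym.
have hQ' := AE_perm (measurableI _ _ mQ1 mQ2) uF pF hQ.
rewrite AE_cat; rewrite AE_cat in hQ'.
apply: AE_imp hQ' => y hy.
(* Neither condition involves the translation, so holding for almost every translation means
   holding. *)
have [q1 q2] : (Q1 `&` Q2) (coords (mat K y) 0).
  apply: (@AE_cst R (wcoords (K := K)) _ y).
  apply: AE_congr hy => x x' _ xy _ [q1 q2].
  have matx : mat K x = mat K y.
    apply/matrixP => a j; rewrite !mxE xy// mem_wcoords ltn_ord /=.
    by rewrite neq_ltn ltn_ord.
  rewrite /Q1 /Q2 /= mat_coords trl_coords -matx; split => //.
  move=> c' N; have [t Nt [q ntq hq]] := q1 c' N; exists t => //; exists q => // i ik.
  rewrite (_ : lform _ _ _ _ = lform k (coords (mat K x *m hT) (trl K x)) i q); first exact: hq.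
  by apply: eq_lform => // j jk; rewrite /coords /= ik jk.
move: q1 q2; rewrite /Q1 /Q2 /= mat_coords trl_coords => q1 q2.
exact: (often_avoided_translate Lb).
Qed.

End divergence_case.

(** * Series and the choice of radii *)

Section series.
Context {R : realType}.

Lemma bounded_nneseries (u : nat -> R) (B : R) : (forall t, 0 <= u t) ->
  (forall n, \sum_(t < n) u t <= B) -> (\sum_(t <oo) (u t)%:E < +oo)%E.
Proof.
move=> u0 uB; apply: (@le_lt_trans _ _ B%:E); last exact: ltry.
apply: lime_le; first by apply: is_cvg_nneseries => n _ _; rewrite lee_fin.
by apply: nearW => n; rewrite big_mkord sumEFin lee_fin.
Qed.

Lemma geometric_le (w : R) (n : nat) : 0 <= w < 1 -> \sum_(t < n) w ^+ t <= 2 / (1 - w).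
Proof.
move=> w01; apply: le_trans (two_sided_geometric 0 n w01).
by apply: ler_sum => t _; rewrite sub0n subn0 add0n.
Qed.

Lemma eventually_lt1 (v : nat -> R) (C : R) : (forall t, 0 <= v t) ->
  (forall n, \sum_(t < n) v t <= C) -> exists T1, forall t, (T1 <= t)%N -> v t < 1.
Proof.
move=> v0 vC; apply: contrapT => h.
have io N : exists2 t, (N <= t)%N & 1 <= v t.
  apply: contrapT => h'; apply: h; exists N => t Nt; rewrite ltNge; apply/negP => v1.
  by apply: h'; exists t.
have mono m n : (m <= n)%N -> \sum_(t < m) v t <= \sum_(t < n) v t.
  elim: n => [|n ih]; first by rewrite leqn0 => /eqP ->.
  rewrite leq_eqVlt => /orP[/eqP ->//|]; rewrite ltnS => /ih le.
  by apply: le_trans le _; rewrite big_ord_recr /= lerDl.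
have big (n : nat) : exists T, n%:R <= \sum_(t < T) v t.
  elim: n => [|n [T hT]]; first by exists 0%N; rewrite big_ord0.
  have [t Tt v1] := io T; exists t.+1; rewrite big_ord_recr /= -natr1.
  by apply: lerD => //; apply: le_trans hT _; exact: mono.
have [T hT] := big (Num.truncn C).+1.
have := Num.Theory.truncnS_gt C; rewrite ltNge => /negP; apply.
exact: le_trans hT (vC T).
Qed.

Lemma truncated_sum_le (u : nat -> R) (T1 n : nat) : (forall t, 0 <= u t) ->
  \sum_(t < n) (if (t < T1)%N then u t else 0) <= \sum_(t < T1) u t.
Proof.
move=> u0.
have H m : (m <= T1)%N -> \sum_(t < m) u t <= \sum_(t < T1) u t.
  move=> mT; rewrite -!(big_mkord xpredT) (big_cat_nat (n := m) (p := T1))//= lerDl.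
  by apply: sumr_ge0.
suff -> : \sum_(t < n) (if (t < T1)%N then u t else 0) = \sum_(t < minn n T1) u t.
  by apply: H; exact: geq_minr.
elim: n => [|n ih]; first by rewrite min0n !big_ord0.
rewrite big_ord_recr /= ih; case: ltnP => nT.
  have -> : minn n.+1 T1 = n.+1 by apply/minn_idPl.
  by rewrite big_ord_recr.
have -> : minn n.+1 T1 = T1 by apply/minn_idPr; exact: leqW.
by rewrite addr0.
Qed.

End series.

Section radii.
Context {R : realType}.

(** A large [z t] would violate the bound 1 on the shorter products of sides, so the radius is
    capped. The cap still grows like [exp (de * t / (K + 1))], and the capped times add only a
    geometric series with ratio [exp (- de)]. *)
Lemma convergence_radii (K : nat) (sg z : nat -> R) (de B : R) : 0 < de ->
  (forall j, (0 < j < K.+1)%N -> \sum_(r < j) sg r <= - de) -> \sum_(r < K.+1) sg r = 0 ->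
  (forall n, \sum_(t < n) expR (- (K.+1%:R * z t)) <= B) ->
  exists rr : nat -> R, [/\ forall t, 0 < rr t, forall t, rr t <= expR (z t),
    forall t j, (j < K.+1)%N -> \prod_(r < j) (2 * ebox sg rr t r) <= 1 &
    (\sum_(t <oo) ((\prod_(r < K.+1) (2 * ebox sg rr t r))^-1)%:E < +oo)%E].
Proof.
move=> de0 sg_part sg_sum zB.
pose ee (t : nat) := expR (de * t%:R / K.+1%:R).
have eeK t : ee t ^+ K.+1 = expR (de * t%:R) by rewrite /ee -expRM_natl mulrC divfK.
have ee1 t : 1 <= ee t by rewrite -expR0 ler_expR !mulr_ge0// ltW.
pose rr t := Num.min (expR (z t)) (ee t / 2).
have rr0 t : 0 < rr t by rewrite lt_min expR_gt0 divr_gt0// expR_gt0.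
have prodE t j : \prod_(r < j) (2 * ebox sg rr t r) =
    expR ((\sum_(r < j) sg r) * t%:R) * (2 * rr t) ^+ j.
  rewrite -(ebox_prod sg (fun t => 2 * rr t)); apply: eq_bigr => r _.
  by rewrite /ebox mulrCA.
have rr2 t : 2 * rr t <= ee t.
  by rewrite -ler_pdivlMl// mulrC ge_min lexx orbT.
exists rr; split => //.
- by move=> t; rewrite ge_min lexx.
- move=> t [_|j jk]; first by rewrite big_ord0.
  rewrite prodE.
  apply: (@le_trans _ _ (expR (- de * t%:R) * ee t ^+ K.+1)).
    apply: ler_pM; rewrite ?expR_ge0 ?exprn_ge0 ?mulr_ge0 ?(ltW (rr0 t))//.
      by rewrite ler_expR; apply: ler_wpM2r => //; exact: sg_part.
    apply: (@le_trans _ _ (ee t ^+ j.+1)).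
      by apply: lerXn2r; rewrite ?nnegrE ?expR_ge0 ?mulr_ge0 ?(ltW (rr0 t)).
    by apply: ler_weXn2l => //; exact: ltnW.
  by rewrite eeK -expRD mulNr addNr expR0.
pose w := expR (- de).
have w01 : 0 <= w < 1 by rewrite expR_ge0 /= expR_lt1 oppr_lt0.
apply: (@bounded_nneseries _ _ (B + 2 / (1 - w))) => [t|n].
  by rewrite invr_ge0 prodE mulr_ge0 ?expR_ge0 ?exprn_ge0 ?mulr_ge0 ?(ltW (rr0 t)).
apply: le_trans (lerD (zB n) (geometric_le n w01)).
rewrite -big_split /=; apply: ler_sum => t _.
rewrite prodE sg_sum mul0r expR0 mul1r.
have [le|le] := leP (expR (z t)) (ee t / 2).
  have -> : rr t = expR (z t) by rewrite /rr; exact: min_l.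
  rewrite ler_wpDr ?exprn_ge0 ?expR_ge0//.
  rewrite expRN expRM_natl lef_pV2 ?posrE ?exprn_gt0 ?mulr_gt0 ?expR_gt0//.
  apply: lerXn2r; rewrite ?nnegrE ?mulr_ge0 ?expR_ge0//.
  by have := expR_ge0 (z t); lra.
have -> : rr t = ee t / 2 by rewrite /rr; apply: min_r; exact: ltW.
rewrite ler_wpDl ?expR_ge0// mulrC divfK// eeK -expRN /w -expRM_natl.
by rewrite ler_expR mulrN mulrC.
Qed.

(** The radius [exp (- z t)] is capped at 1 and replaced by zero when it is below [exp (- et * t)],
    where the last side of the box could be too short. Discarded terms form a convergent series.
    Capping is harmless too: if the capped series converged, its terms would eventually be below 1
    and hence uncapped. *)
Lemma divergence_radii (k : nat) (et : R) (z : nat -> R) : (0 < k)%N -> 0 < et ->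
  (forall B, exists T, B <= \sum_(t < T) expR (- (k%:R * z t))) ->
  exists rr : nat -> R, [/\ forall t, 0 <= rr t <= 1,
    forall t, rr t = 0 \/ expR (- (et * t%:R)) <= rr t,
    forall t, rr t * expR (z t) <= 1 &
    forall B, exists T, B <= \sum_(t < T) rr t ^+ k].
Proof.
move=> k0 et0 zB.
pose rr (t : nat) : R := if expR (- (et * t%:R)) <= expR (- z t)
  then Num.min 1 (expR (- z t)) else 0.
exists rr; split => [t|t|t|B].
- rewrite /rr; case: ifP => _; last by rewrite lexx ler01.
  by rewrite le_min ler01 expR_ge0 /= ge_min lexx.
- rewrite /rr; case: ifP => h; last by left.
  by right; rewrite le_min h andbT expR_le1 oppr_le0 mulr_ge0// ltW.
- rewrite /rr; case: ifP => _; last by rewrite mul0r.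
  apply: (@le_trans _ _ (expR (- z t) * expR (z t))).
    by apply: ler_wpM2r; [exact: expR_ge0|rewrite ge_min lexx orbT].
  by rewrite -expRD addNr expR0.
apply: contrapT => h.
have rB n : \sum_(t < n) rr t ^+ k <= B.
  by rewrite leNgt; apply/negP => lt; apply: h; exists n; exact: ltW.
pose w := expR (- (k%:R * et)).
have w01 : 0 <= w < 1 by rewrite expR_ge0 /= expR_lt1 oppr_lt0 mulr_gt0// ltr0n.
pose u t := expR (- (k%:R * z t)); pose v t := Num.min 1 (u t).
have u0 t : 0 <= u t by exact: expR_ge0.
have v0 t : 0 <= v t by rewrite le_min ler01 u0.
have uE t : u t = expR (- z t) ^+ k by rewrite /u -mulrN expRM_natl.
have wE t : w ^+ t = expR (- (et * t%:R)) ^+ k.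
  by rewrite /w -!expRM_natl; congr expR; ring.
have vle t : v t <= rr t ^+ k + w ^+ t.
  have w0 : 0 <= w ^+ t by rewrite exprn_ge0 ?expR_ge0.
  rewrite /rr; case: ifP => [le|/negbT].
    rewrite ler_wpDr//; case: (leP 1 (expR (- z t))) => _.
      by rewrite expr1n ge_min lexx.
    by rewrite -uE ge_min lexx orbT.
  rewrite -ltNge => lt; rewrite expr0n eqn0Ngt k0 add0r wE ge_min uE.
  by apply/orP; right; apply: lerXn2r; rewrite ?nnegrE ?expR_ge0// ltW.
have vB n : \sum_(t < n) v t <= B + 2 / (1 - w).
  apply: le_trans (lerD (rB n) (geometric_le n w01)).
  by rewrite -big_split /=; apply: ler_sum.
have [T1 hT1] := eventually_lt1 v0 vB.
pose C := B + 2 / (1 - w) + \sum_(t < T1) u t.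
have [T hT] := zB (C + 1).
suff : C + 1 <= C by rewrite gerDl ler10.
apply: le_trans hT _; rewrite /C; apply: le_trans (lerD (vB T) (truncated_sum_le T1 T u0)).
rewrite -big_split /=; apply: ler_sum => t _; rewrite -/(u t).
case: ltnP => [_|/hT1]; first by rewrite lerDr.
by rewrite /v; case: (leP 1 (u t)) => [_|_ _]; rewrite ?ltxx ?addr0.
Qed.

End radii.

Theorem theorem3p6 (R : realType) (k : nat)
    (mu : probability (borel_grid R k) R) (mu_inv : ASL_invariant mu)
    (g : R -> SL R k) (g_subgroup : one_parameter_subgroup g)
    (g_diag : diagonalizable_subgroup g) (g_unbounded : unbounded_subgroup g)
    (z : nat -> R) :
  let E : set (borel_grid R k) :=
    [set L : grid R k | infinite_set [set t : nat |
       (1 <= t)%N /\ ((z t)%:E <= Delta (SL_act (g t%:R) L))%E]] in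
  let s : nat -> R :=
    fun n => \sum_(1 <= t < n.+1) expR (- (k%:R * z t)) in
  (cvgn s -> mu.-negligible E) /\ (~ cvgn s -> mu.-negligible (~` E)).
Proof.
move=> E s.
have sP := sorted_exponents g_subgroup g_diag g_unbounded.
have s_nd : nondecreasing_seq s.
  by apply/nondecreasing_seqP => n; rewrite /s [leRHS]big_nat_recr//= lerDl expR_ge0.
have sE n : \sum_(t < n.+1) expR (- (k%:R * z t)) = expR (- (k%:R * z 0%N)) + s n.
  by rewrite /s -(big_mkord xpredT (fun t => expR (- (k%:R * z t)))) big_ltn.
(* In dimension zero there is no index that could carry a nonzero exponent. *)
case: k => [|K] in mu mu_inv g g_subgroup g_diag g_unbounded E s sP s_nd sE *.
  by have [P [sg [_ _ _ _ [i]]]] := sP false.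
have EE : E = often_avoided (fun t => set_val (g t%:R)) z.
  apply/seteqP; split => L /=.
    move/infinite_natP => h N; have [t Nt [t1 zt]] := h N.
    by exists t; [rewrite geq_max t1|apply/Delta_avoid].
  move=> h; apply/infinite_natP => N; have [t] := h N.
  by rewrite geq_max => /andP[t1 Nt] av; exists t => //; split => //; apply/Delta_avoid.
rewrite EE; split => [cs|ncs].
  have [P [sg [uP PT srt sum0 nz]]] := sP true.
  have [_ _ [de de0 part]] := sorted_partial_sums srt sum0 nz.
  have zB n : \sum_(t < n) expR (- (K.+1%:R * z t)) <= expR (- (K.+1%:R * z 0%N)) + limn s.
    apply: (@le_trans _ _ (\sum_(t < n.+1) expR (- (K.+1%:R * z t)))).
      by rewrite big_ord_recr /= lerDl expR_ge0.
    by rewrite sE lerD2l; exact: nondecreasing_cvgn_le.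
  have [rr [rr0 rrz box1 box_sum]] := convergence_radii de0 part sum0 zB.
  apply: (often_avoided_null mu_inv (measurable_primal_map1 P) (measurable_primal_map2 P)) => L.
  apply: (@eventually_not_avoided R K _ z P sg rr) => //.
  by move=> t v i; rewrite PT expr1 mulN1r.
have [P [sg [uP PT srt sum0 nz]]] := sP false.
have [K0 sgK [de de0 part]] := sorted_partial_sums srt sum0 nz.
have zB B : exists T, B <= \sum_(t < T) expR (- (K.+1%:R * z t)).
  apply: contrapT => h; apply: ncs; apply: nondecreasing_is_cvgn => //.
  exists B => _ [n _ <-]; rewrite leNgt; apply/negP => lt; apply: h; exists n.+1.
  by rewrite sE; apply: le_trans (ltW lt) _; rewrite lerDr expR_ge0.
(* Half of the largest exponent is a threshold strictly below it, so the last sides of the boxes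
   that are kept still grow. *)
have et0 : 0 < sg K / 2 by rewrite divr_gt0.
have [rr [rr01 rr_large rrz rr_div]] := divergence_radii (ltn0Sn K) et0 zB.
have hit x : AE (full K.+1 K.+2) (often_hit K sg rr) x.
  case: K K0 srt sum0 part sgK et0 rr_large rr_div {mu mu_inv g g_subgroup g_diag g_unbounded E s sP s_nd sE EE ncs P uP PT nz zB} => // K _.
  move=> srt sum0 part sgK et0 rr_large rr_div.
  apply: (AE_often_hit (et := sg K.+1 / 2) srt de0 sum0 part _ rr01 rr_large rr_div).
  by lra.
apply: (often_avoided_full mu_inv (measurable_dual_map1 P) (measurable_dual_map2 P)) => L.
apply: (@AE_often_avoided R K _ z P sg rr) => //.
- by move=> t v i; rewrite PT expr0 mul1r.
- by move=> t; have /andP[] := rr01 t.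
Qed.
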